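(* Let $n\ge1$. If $j\in\{1,\ldots,n\}$ and $\zeta\in T_j^n$, then $$\mathrm{t}_{j,\zeta}^*(v)=\int_{\mathbb{R}^n}\alpha(|x|)\,x\,\mathrm{d}\mathrm{MA}_j(v;x)$$ for every $v\in\mathrm{Conv}(\mathbb{R}^n;\mathbb{R})$, where $\alpha\in T_n^n$ is given by $$\alpha(s)=\binom{n}{j}\left(s^{n-j}\zeta(s)+(n-j)\int_s^\infty t^{n-j-1}\zeta(t)\,\mathrm{d}t\right)$$ for $s>0$.
   Context: $C_b((0,\infty))$ is the set of continuous functions $\zeta\colon(0,\infty)\to\mathbb{R}$ with bounded support, and for $j\in\{1,\ldots,n\}$, $T_j^n=\{\zeta\in C_b((0,\infty)):\lim_{s\to0^+}s^{n-j+1}\zeta(s)=0\}$. For $\alpha\in T_n^n$, the map $x\mapsto\alpha(|x|)x$ extends continuously to $\mathbb{R}^n$ with value $o$ (the origin) at $x=o$, and this extension is understood in the integral. $\mathrm{Conv}(\mathbb{R}^n;\mathbb{R})$ is the set of convex functions $v\colon\mathbb{R}^n\to\mathbb{R}$ with the topology of epi-convergence (equivalently, pointwise convergence). A map $\mathrm{z}\colon\mathrm{Conv}(\mathbb{R}^n;\mathbb{R})\to\mathbb{R}^n$ is a valuation if $\mathrm{z}(v\vee w)+\mathrm{z}(v\wedge w)=\mathrm{z}(v)+\mathrm{z}(w)$ whenever $v,w$, their pointwise maximum $v\vee w$ and minimum $v\wedge w$ all belong to $\mathrm{Conv}(\mathbb{R}^n;\mathbb{R})$; it is dually epi-translation invariant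 if $\mathrm{z}(v+a)=\mathrm{z}(v)$ for every affine $a$; it is rotation equivariant if $\mathrm{z}(v\circ\vartheta^{-1})=\vartheta\,\mathrm{z}(v)$ for every $\vartheta\in\mathrm{SO}(n)$. For $\zeta\in T_j^n$, $\mathrm{t}_{j,\zeta}^*\colon\mathrm{Conv}(\mathbb{R}^n;\mathbb{R})\to\mathbb{R}^n$ denotes the unique continuous, dually epi-translation invariant, rotation equivariant valuation such that $\mathrm{t}_{j,\zeta}^*(v)=\int_{\mathbb{R}^n}\zeta(|x|)x\,[\mathrm{D}^2v(x)]_j\,\mathrm{d}x$ for every $v\in\mathrm{Conv}(\mathbb{R}^n;\mathbb{R})\cap C^2(\mathbb{R}^n)$, where $[A]_j$ is the $j$th elementary symmetric function of the eigenvalues of $A$. (Its existence is established in the same work.) The Monge–Ampère measure of $v$ is $\mathrm{MA}(v;B)=\mathcal{H}^n(\bigcup_{x\in B}\partial v(x))$ for Borel $B\subset\mathbb{R}^n$, where $\mathcal H^n$ is $n$-dimensional Hausdorff measure and $\partial v(x)=\{y:v(z)\ge v(x)+\langle y,z-x\rangle\ \forall z\in\mathbb{R}^n\}$. The measures $\mathrm{MA}_j(v;\cdot)$, $0\le j\le n$, are defined by $\mathrm{MA}(v+r h_{B^n};\cdot)=\sum_{j=0}^n\binom{n}{j}r^{n-j}\mathrm{MA}_j(v;\cdot)$ for $r\ge0$, where $h_{B^n}(x)=|x|$ is the Euclidean norm. *)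

(* Defs.v *)
From HB Require Import structures.
From mathcomp Require Import all_boot all_order all_algebra.
From mathcomp Require Import all_classical all_reals all_analysis.

Set Implicit Arguments.
Unset Strict Implicit.
Unset Printing Implicit Defensive.

Import Order.TTheory GRing.Theory Num.Theory.
Import numFieldNormedType.Exports.

Local Open Scope classical_set_scope.
Local Open Scope ring_scope.

(* R^n is 'cV[R]_n. Its library norm is the max-norm, which gives the right   *)
(* topology; metric quantities below use the Euclidean norm enorm instead.    *)
Section Euclidean.
Context {R : realType} {n : nat}.
Implicit Types (x y : 'cV[R]_n) (v w : 'cV[R]_n -> R).

Definition dotv x y : R := \sum_(i < n) x i 0 * y i 0.

Definition enorm x : R := Num.sqrt (dotv x x).

Definition is_SO (theta : 'M[R]_n) : Prop :=
  theta *m theta^T = 1%:M /\ \det theta = 1.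

Definition is_Conv v : Prop := convex_function [set: convex_lmodType 'cV[R]_n] v.

Definition subdiff v x : set 'cV[R]_n :=
  [set y | forall z, v x + dotv y (z - x) <= v z].

Definition epi_cvg (vk : nat -> 'cV[R]_n -> R) v : Prop :=
  forall x,
    (forall xk : nat -> 'cV[R]_n, xk @ \oo --> x ->
       ((v x)%:E <= limn_einf (fun k => (vk k (xk k))%:E))%E) /\
    (exists2 xk : nat -> 'cV[R]_n, xk @ \oo --> x &
       (fun k => vk k (xk k)) @ \oo --> v x).

Definition basis_vec (i : 'I_n) : 'cV[R]_n := delta_mx i 0.

(* Functions of class C^k: all iterated partial derivatives up to order k     *)
(* exist and are continuous.                                                  *)
Fixpoint is_Ck (k : nat) v : Prop :=
  continuous v /\
  if k is k'.+1 then
    forall i, (forall x, derivable v x (basis_vec i)) /\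
              is_Ck k' ('D_(basis_vec i) v)
  else True.

Definition hessian v x : 'M[R]_n :=
  \matrix_(i, j) 'D_(basis_vec j) ('D_(basis_vec i) v) x.

(* The n eigenvalues counted with algebraic multiplicity. The default value   *)
(* is only used when the characteristic polynomial does not split over R; it  *)
(* always splits for a symmetric matrix.                                      *)
Definition eigenvalues (A : 'M[R]_n) : n.-tuple R :=
  xget [tuple of nseq n 0]
    [set s : n.-tuple R | char_poly A = \prod_(a <- s) ('X - a%:P)].

Definition elem_sym (j : nat) (A : 'M[R]_n) : R :=
  \sum_(I : {set 'I_n} | #|I| == j) \prod_(i in I) tnth (eigenvalues A) i.

End Euclidean.

Section Measures.
Context (R : realType).

Definition borelR (n : nat) : measurableType _ :=
  g_sigma_algebraType (@open 'cV[R]_n).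

(* Lebesgue measure on the Borel sets of R^n, as an iterated product measure. *)
Fixpoint lebesgue_n (n : nat) : set (borelR n) -> \bar R :=
  match n with
  | 0%N => \d_((0 : 'cV[R]_0) : borelR 0)
  | n'.+1 =>
      pushforward (@lebesgue_measure R \x @lebesgue_n n')%E
        (fun p => col_mx (p.1%:M : 'cV[R]_1) p.2 : borelR n'.+1)
  end.

Section Hausdorff.
Variable n : nat.
Implicit Types A U : set 'cV[R]_n.
Local Open Scope ereal_scope.

Definition ediam U : \bar R :=
  ereal_sup ([set 0] `|`
    [set z | exists x y, [/\ U x, U y & z = (enorm (x - y))%:E]]).

Definition hausdorff_delta (delta : R) A : \bar R :=
  ereal_inf [set s | exists U : nat -> set 'cV[R]_n,
    [/\ A `<=` \bigcup_k U k, forall k, ediam (U k) <= delta%:E &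
        s = \sum_(k <oo) ediam (U k) ^+ n]].

Definition hausdorff_pre A : \bar R :=
  ereal_sup [set hausdorff_delta delta A | delta in [set d | (0 < d)%R]].

Definition unit_cube : set 'cV[R]_n := [set x | forall i, (0 <= x i 0 <= 1)%R].

(* The n-dimensional Hausdorff (outer) measure on R^n. The constant factor is *)
(* fixed by giving the unit cube measure 1, i.e. so that the measure          *)
(* coincides with Lebesgue measure.                                           *)
Definition hausdorff A : \bar R :=
  ((fine (hausdorff_pre unit_cube))^-1)%:E * hausdorff_pre A.

End Hausdorff.

Definition MA (n : nat) (v : 'cV[R]_n -> R) (B : set 'cV[R]_n) : \bar R :=
  hausdorff (\bigcup_(x in B) subdiff v x).

(* mu j = MA_j(v; .) for 0 <= j <= n; these measures are determined by the    *)
(* expansion below. Values mu j with j > n are irrelevant.                    *)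
Definition is_MAj (n : nat) (v : 'cV[R]_n -> R)
    (mu : nat -> {measure set (borelR n) -> \bar R}) : Prop :=
  forall (r : R) (B : set (borelR n)), 0 <= r -> measurable B ->
    MA (fun x => v x + r * enorm x) B =
    (\sum_(j < n.+1) ('C(n, j)%:R * r ^+ (n - j))%:E * mu j B)%E.

End Measures.

Section Valuations.
Context {R : realType} {n : nat}.
(* Maps on Conv(R^n; R) are represented by total maps on 'cV[R]_n -> R, of    *)
(* which only the values at convex functions are ever constrained or used.    *)
Implicit Types (z : ('cV[R]_n -> R) -> 'cV[R]_n) (v w : 'cV[R]_n -> R).

Definition is_valuation z : Prop := forall v w,
  let vmax := fun x => Num.max (v x) (w x) in
  let vmin := fun x => Num.min (v x) (w x) in
  is_Conv v -> is_Conv w -> is_Conv vmax -> is_Conv vmin ->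
  z vmax + z vmin = z v + z w.

Definition dually_epi_translation_invariant z : Prop :=
  forall v (y : 'cV[R]_n) (c : R), is_Conv v ->
    z (fun x => v x + (dotv y x + c)) = z v.

Definition rotation_equivariant z : Prop :=
  forall v (theta : 'M[R]_n), is_Conv v -> is_SO theta ->
    z (fun x => v (invmx theta *m x)) = theta *m z v.

(* Sequential continuity; the topology of epi-convergence on Conv(R^n; R) is  *)
(* metrizable.                                                                *)
Definition epi_continuous z : Prop :=
  forall (vk : nat -> 'cV[R]_n -> R) v,
    (forall k, is_Conv (vk k)) -> is_Conv v -> epi_cvg vk v ->
    (fun k => z (vk k)) @ \oo --> z v.

(* T_j^n; only the values of zeta on (0, +oo) matter. *)
Definition classT (m j : nat) (zeta : R -> R) : Prop :=
  [/\ forall s, 0 < s -> {for s, continuous zeta},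
      exists M, forall s, M < s -> zeta s = 0 &
      (fun s => s ^+ (m - j + 1) * zeta s) @ 0^'+ --> (0 : R)].

(* z = t^*_{j, zeta}, via its defining properties. The integrals are          *)
(* extended-real valued and taken coordinatewise, so each equation also       *)
(* asserts that the integral is finite. The value of zeta at 0 is immaterial, *)
(* since the integrand vanishes at the origin.                                *)
Definition is_tstar (j : nat) (zeta : R -> R) z : Prop :=
  [/\ is_valuation z, epi_continuous z, dually_epi_translation_invariant z,
      rotation_equivariant z &
      forall v, is_Conv v -> is_Ck 2 v -> forall i : 'I_n,
        (z v i 0)%:E =
        \int[@lebesgue_n R n]_x
          (zeta (enorm x) * x i 0 * elem_sym j (hessian v x))%:E]%E.

End Valuations.

(* Main.v *)
(* The radial weight f(x) = alpha(|x|) x_i is continuous with bounded support. *)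
(* Regularise |x| to q_e(x) = sqrt(|x|^2 + e^2) and v to smooth, strictly      *)
(* convex v_k. The gradient of v_k + r q_e is a homeomorphism of R^n, so a     *)
(* change of variables turns the integral of f det D^2(v_k + r q_e) into the   *)
(* integral of f along the inverse gradient, which converges to the integral   *)
(* of f against MA(v + r|.|) as e and 1/k tend to 0. All terms are polynomials *)
(* in r; the coefficient of r^(n-j) is 'C(n, j) times the integral of f        *)
(* against MA_j(v). For smooth v that coefficient is evaluated in another way: *)
(* the rows of the cofactor matrix of D^2 v + r D^2 q_e are divergence free,   *)
(* and integrating by parts against the tail integral of zeta turns the mixed  *)
(* term into the integral of zeta(|x|) x_i [D^2 v]_j as e tends to 0. This is  *)
(* where alpha comes from.                                                     *)
From HB Require Import structures.
Require Import Defs.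
From mathcomp Require Import all_boot all_order all_algebra.
From mathcomp Require Import all_classical all_reals all_analysis.
From mathcomp Require Import measurable_realfun lra ring.
Import Order.TTheory GRing.Theory Num.Theory.
Import numFieldNormedType.Exports.
Local Open Scope classical_set_scope.
Local Open Scope ring_scope.
Set Implicit Arguments.
Unset Strict Implicit.
Unset Printing Implicit Defensive.

(** Put m = n - j, let [beta] be alpha divided by 'C(n, j), and for smooth u let D(r) = det(r + D^2
    u). The coefficient D_m of r^m is the j-th elementary symmetric function of D^2 u ([elem_symE]),
    so it gives z(u). The measure MA_j corresponds instead to the r^m coefficient of det(D^2 u + r
    D^2 q_e), where q_e(x) = sqrt(|x|^2 + e^2) regularises |x|.

    The two coefficients are compared as follows. D^2 q_e = q_e^-1 (1 - q_e^-2 x x^T) is a multiple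
    of a rank one perturbation of 1, so the second coefficient is q_e^-m (D_m - q_e^-2 Q_(m-1)) with
    Q(r) = x^T adj(r + D^2 u) x ([coef_pencil_rank1]). The matrix adj(r + D^2 u) is divergence free
    ([piola_hessian]), and integration by parts trades Q_(m-1) for m D_m ([radial_identity]). With
    weight beta(|x|) x_i this leaves x_i D_m times a radial factor ([key_identity]). As e tends to 0
    that factor tends to beta(s) s^-m - m s^-m eta(s), where eta(s) is the integral of t^(m-1)
    zeta(t) over t > s; since beta = s^m zeta + m eta, the limit is zeta(s). The factor is dominated
    so that the integrands are bounded by a multiple of |x|^-m on a ball, integrable because m < n;
    this is [regularized_limit].

    For general convex v, choose smooth strongly convex v_k tending to v and e_k tending to 0 so
    slowly indexed that the r^m coefficients tend to z(v) ([approximating_sequence]). For fixed r, w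
    = v + r|.| and w_k = v_k + r q_(e_k), the integrals of f det D^2 w_k tend to the integral of f
    against MA(w) ([weak_convergence]): a change of variables turns them into integrals of f along
    inverse gradients, these converge almost everywhere to the inverse of the subdifferential of w,
    and MA(w) is the image of Lebesgue measure under that inverse ([mu_pushforward], which rests on
    [hausdorff_compact]). Everything is polynomial in r of degree at most n, so coefficients
    converge too ([cvg_coef]), and comparing those of r^m gives [representation]. *)

(** * Euclidean inner product and norm *)

Section euclidean.
Context {R : realType} {n : nat}.
Implicit Types x y z : 'cV[R]_n.

Lemma dotvC x y : dotv x y = dotv y x.
Proof. by apply: eq_bigr => i _; rewrite mulrC. Qed.

Lemma dotvDr x y z : dotv x (y + z) = dotv x y + dotv x z.
Proof. by rewrite /dotv -big_split; apply: eq_bigr => i _; rewrite mxE mulrDr. Qed.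

Lemma dotvZr x a y : dotv x (a *: y) = a * dotv x y.
Proof. by rewrite /dotv mulr_sumr; apply: eq_bigr => i _; rewrite mxE mulrCA. Qed.

Lemma dotvNr x y : dotv x (- y) = - dotv x y.
Proof. by rewrite -scaleN1r dotvZr mulN1r. Qed.

Lemma dotvBr x y z : dotv x (y - z) = dotv x y - dotv x z.
Proof. by rewrite dotvDr dotvNr. Qed.

Lemma dotvDl x y z : dotv (x + y) z = dotv x z + dotv y z.
Proof. by rewrite dotvC dotvDr 2!(dotvC z). Qed.

Lemma dotvZl x a y : dotv (a *: x) y = a * dotv x y.
Proof. by rewrite dotvC dotvZr dotvC. Qed.

Lemma dotvNl x y : dotv (- x) y = - dotv x y.
Proof. by rewrite dotvC dotvNr dotvC. Qed.

Lemma dotvBl x y z : dotv (x - y) z = dotv x z - dotv y z.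
Proof. by rewrite dotvDl dotvNl. Qed.

Lemma dotv0r x : dotv x 0 = 0.
Proof. by rewrite -(scale0r 0) dotvZr mul0r. Qed.

Lemma dotv_basisr x i : dotv x (basis_vec i) = x i 0.
Proof.
rewrite /dotv (bigD1 i)//= mxE !eqxx mulr1 big1 ?addr0// => k ki.
by rewrite mxE (negbTE ki) mulr0.
Qed.

Lemma dotv_ge0 x : 0 <= dotv x x.
Proof. by apply: sumr_ge0 => i _; rewrite -expr2 sqr_ge0. Qed.

Lemma enorm_ge0 x : 0 <= enorm x.
Proof. exact: sqrtr_ge0. Qed.

Lemma sqr_enorm x : enorm x ^+ 2 = dotv x x.
Proof. by rewrite sqr_sqrtr// dotv_ge0. Qed.

Lemma coord_le_enorm x i : `|x i 0| <= enorm x.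
Proof.
rewrite -(ler_pXn2r (n := 2))// ?nnegrE ?enorm_ge0 ?normr_ge0//.
rewrite sqr_enorm /dotv (bigD1 i)//= real_normK ?num_real// -expr2 lerDl.
by apply: sumr_ge0 => k _; rewrite -expr2 sqr_ge0.
Qed.

Lemma normcV_le x (M : R) : 0 <= M -> (`|x| <= M) <-> (forall i, `|x i 0| <= M).
Proof.
move=> M0; rewrite [X in X <= _]/Num.norm/= mx_normrE; split.
  by move=> + i; move/bigmax_leP => -[_ /(_ (i, 0) isT)].
by move=> h; apply/bigmax_leP; split => // -[i j] _ /=; rewrite ord1.
Qed.

Lemma coord_le_norm x i : `|x i 0| <= `|x|.
Proof. by move: i; apply/normcV_le. Qed.

Lemma norm_le_enorm x : `|x| <= enorm x.
Proof. by apply/normcV_le => [|i]; [exact: enorm_ge0|exact: coord_le_enorm]. Qed.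

Lemma enorm_le_norm x : enorm x <= n%:R * `|x|.
Proof.
have [n0|n0] := posnP n.
  rewrite /enorm /dotv big1 ?sqrtr0 ?mulr_ge0// => i.
  by have := leq_ltn_trans (leq0n i) (ltn_ord i); rewrite [X in (_ < X)%N]n0.
rewrite -(ler_pXn2r (n := 2))// ?nnegrE ?enorm_ge0 ?mulr_ge0//.
rewrite sqr_enorm exprMn.
apply: (@le_trans _ _ (n%:R * `|x| ^+ 2)); last first.
  by rewrite ler_wpM2r ?sqr_ge0// expr2 ler_peMl// ler1n.
have -> : n%:R * `|x| ^+ 2 = \sum_(i < n) `|x| ^+ 2.
  by rewrite sumr_const card_ord mulr_natl.
apply: ler_sum => i _; rewrite -expr2 -real_normK ?num_real//.
by rewrite ler_pXn2r ?nnegrE// coord_le_norm.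
Qed.

Lemma enorm_eq0 x : (enorm x == 0) = (x == 0).
Proof.
apply/eqP/eqP => [e0|->]; last by rewrite /enorm dotv0r sqrtr0.
apply/normr0_eq0/eqP; rewrite eq_le normr_ge0 andbT -e0.
exact: norm_le_enorm.
Qed.

Lemma enorm_gt0 x : (0 < enorm x) = (x != 0).
Proof. by rewrite lt_def enorm_eq0 enorm_ge0 andbT. Qed.

Lemma enormN x : enorm (- x) = enorm x.
Proof. by rewrite /enorm dotvNl dotvNr opprK. Qed.

Lemma enormZ a x : enorm (a *: x) = `|a| * enorm x.
Proof.
by rewrite /enorm dotvZl dotvZr mulrA -expr2 sqrtrM ?sqr_ge0// sqrtr_sqr.
Qed.

Lemma dotv_le_enorm x y : dotv x y <= enorm x * enorm y.
Proof.
have [->|x0] := eqVneq x 0; first by rewrite dotvC dotv0r mulr_ge0 ?enorm_ge0.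
have [->|y0] := eqVneq y 0; first by rewrite dotv0r mulr_ge0 ?enorm_ge0.
have := dotv_ge0 (enorm y *: x - enorm x *: y).
rewrite dotvBl !dotvBr !dotvZl !dotvZr -!sqr_enorm (dotvC y x).
have := enorm_gt0 x; have := enorm_gt0 y; rewrite x0 y0.
set a := enorm x; set b := enorm y; set d := dotv x y => b0 a0 h.
have : 0 <= (a * b) * (a * b - d) by nra.
by rewrite pmulr_rge0 ?mulr_gt0// subr_ge0.
Qed.

Lemma enormD x y : enorm (x + y) <= enorm x + enorm y.
Proof.
rewrite -(ler_pXn2r (n := 2))// ?nnegrE ?addr_ge0 ?enorm_ge0//.
rewrite sqr_enorm dotvDl !dotvDr (dotvC y x) -!sqr_enorm.
have := dotv_le_enorm x y; nra.
Qed.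

Lemma cV_eq_sum x : x = \sum_i x i 0 *: basis_vec i.
Proof.
apply/colP => i; rewrite summxE (bigD1 i)//= !mxE !eqxx mulr1 big1 ?addr0//.
by move=> k ki; rewrite !mxE eq_sym (negbTE ki) mulr0.
Qed.

End euclidean.

(** * Topology of R^n: coordinates, compactness *)

Section cV_topology.
Context {R : realType} {n : nat}.
Implicit Types x y : 'cV[R]_n.

Lemma cvg_cVP (T : Type) (F : set_system T) (FF : Filter F)
    (f : T -> 'cV[R]_n) x :
  f @ F --> x <-> forall i, (fun t => f t i 0) @ F --> x i 0.
Proof.
split => [fx i|h].
  exact: (@cvg_comp _ _ _ f (fun M : 'cV[R]_n => M i 0) _ _ _ fx (@coord_continuous _ _ _ i 0 x)).
apply/cvgrPdist_lt => e e0.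
have : \forall t \near F, forall i, `|x i 0 - f t i 0| < e / 2.
  apply: filter_forall => i.
  by move/cvgrPdist_lt : (h i); apply; rewrite divr_gt0.
apply: filterS => t ht; apply: (@le_lt_trans _ _ (e / 2)); last lra.
apply/normcV_le => [|i]; first by rewrite divr_ge0// ltW.
by rewrite !mxE; apply: ltW.
Qed.

Lemma continuous_cV (T : topologicalType) (f : T -> 'cV[R]_n) :
  (forall i, continuous (fun t => f t i 0)) -> continuous f.
Proof. by move=> h t; apply/cvg_cVP => i; exact: h. Qed.

Lemma continuous_coord i : continuous (fun x => x i 0).
Proof. exact: coord_continuous. Qed.

Lemma continuous_sum (T : topologicalType) (I : Type) (r : seq I)
    (f : I -> T -> R) :
  (forall i, continuous (f i)) -> continuous (fun t => \sum_(i <- r) f i t).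
Proof.
move=> cf t; elim: r => [|i r ih].
  by under eq_fun do rewrite big_nil; exact: cvg_cst.
by under eq_fun do rewrite big_cons; apply: cvgD => //; exact: cf.
Qed.

Lemma continuous_prod (T : topologicalType) (I : Type) (r : seq I)
    (f : I -> T -> R) :
  (forall i, continuous (f i)) -> continuous (fun t => \prod_(i <- r) f i t).
Proof.
move=> cf t; elim: r => [|i r ih].
  by under eq_fun do rewrite big_nil; exact: cvg_cst.
by under eq_fun do rewrite big_cons; apply: cvgM => //; exact: cf.
Qed.

Lemma continuous_dotv (T : topologicalType) (f g : T -> 'cV[R]_n) :
  continuous f -> continuous g -> continuous (fun t => dotv (f t) (g t)).
Proof.
move=> cf cg; apply: continuous_sum => i t; apply: cvgM.
  exact: (@continuous_comp _ _ _ f (fun x => x i 0) t (cf t) (@continuous_coord i _)).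
exact: (@continuous_comp _ _ _ g (fun x => x i 0) t (cg t) (@continuous_coord i _)).
Qed.

Lemma continuous_enorm : continuous (@enorm R n).
Proof.
move=> x; apply: continuous_comp; last exact: sqrt_continuous.
by apply: continuous_dotv => // t; exact: cvg_id.
Qed.

Lemma compact_ball (M : R) : compact [set x : 'cV[R]_n | `|x| <= M].
Proof.
have [M0|M0] := ltP M 0.
  rewrite (_ : mkset _ = set0); first exact: compact0.
  by rewrite predeqE => x; split => //=; rewrite leNgt (lt_le_trans M0).
pose A := [set v : 'rV[R]_n | forall i, v 0 i \in `[- M, M]].
have -> : [set x : 'cV[R]_n | `|x| <= M] = (fun v : 'rV[R]_n => v^T) @` A.
  rewrite predeqE => x; split => [/= xM|[v /= Av <-]].
    exists x^T; last by rewrite trmxK.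
    move=> i; rewrite mxE in_itv/= -ler_norml.
    by move: i; exact/normcV_le.
  apply/normcV_le => // i; rewrite mxE ler_norml.
  by have := Av i; rewrite in_itv.
apply: continuous_compact.
  apply: continuous_subspaceT; apply: continuous_cV => i.
  under eq_fun do rewrite mxE.
  exact: coord_continuous.
apply: (@rV_compact _  _ (fun=> `[(- M), M]%classic)) => _.
exact: segment_compact.
Qed.

Lemma closed_norm_compact (K : set 'cV[R]_n) (M : R) :
  closed K -> (forall x, K x -> `|x| <= M) -> compact K.
Proof.
by move=> cK KM; apply: (subclosed_compact cK (@compact_ball M)) => x /KM.
Qed.

Lemma compact_norm_bounded (K : set 'cV[R]_n) :
  compact K -> exists M : R, forall x, K x -> `|x| <= M.
Proof.
move=> /compact_bounded[M [_ h]]; exists (M + 1) => x Kx.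
by apply: h => //; rewrite ltrDl.
Qed.

Lemma compact_norm_bounded_fun (K : set 'cV[R]_n) (f : 'cV[R]_n -> R) :
  compact K -> continuous f -> exists M : R, forall x, K x -> `|f x| <= M.
Proof.
move=> cK cf.
have : compact (f @` K).
  by apply: continuous_compact => //; exact: continuous_subspaceT.
move=> /compact_bounded[M [_ h]]; exists (M + 1) => x Kx.
by apply: (h (M + 1)); [rewrite ltrDl|exists x].
Qed.

Lemma compact_closed_cV (K : set 'cV[R]_n) : compact K -> closed K.
Proof. by apply: compact_closed; exact: norm_hausdorff. Qed.

End cV_topology.

(** * Closure properties of continuous functions *)

Lemma cts_comp (T U V : topologicalType) (f : T -> U) (g : U -> V) :
  continuous f -> continuous g -> continuous (fun t => g (f t)).
Proof. by move=> cf cg t; exact: (@continuous_comp _ _ _ f g t (cf t) (cg _)). Qed.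

Section continuity_closure.
Context {R : realType} {T : topologicalType}.
Implicit Types (f g : T -> R).

Lemma ctsC (c : R) : continuous (fun _ : T => c).
Proof. by move=> t; exact: cvg_cst. Qed.

Lemma ctsD f g : continuous f -> continuous g -> continuous (fun t => f t + g t).
Proof. by move=> cf cg t; exact: (cvgD (cf t) (cg t)). Qed.

Lemma ctsN f : continuous f -> continuous (fun t => - f t).
Proof. by move=> cf t; exact: (cvgN (cf t)). Qed.

Lemma ctsB f g : continuous f -> continuous g -> continuous (fun t => f t - g t).
Proof. by move=> cf cg; apply: ctsD => //; exact: ctsN. Qed.

Lemma ctsM f g : continuous f -> continuous g -> continuous (fun t => f t * g t).
Proof. by move=> cf cg t; exact: (cvgM (cf t) (cg t)). Qed.

Lemma ctsX f k : continuous f -> continuous (fun t => f t ^+ k).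
Proof.
move=> cf; elim: k => [|k ih].
  by under eq_fun do rewrite expr0; exact: ctsC.
by under eq_fun do rewrite exprS; exact: ctsM.
Qed.

Lemma ctsV f : (forall t, f t != 0) -> continuous f -> continuous (fun t => (f t)^-1).
Proof. by move=> f0 cf t; apply: cvgV => //; exact: cf. Qed.

Lemma cts_coord n (f : T -> 'cV[R]_n) i : continuous f -> continuous (fun t => f t i 0).
Proof. by move=> cf; exact: (@cts_comp _ _ _ f (fun x => x i 0) cf (@continuous_coord R n i)). Qed.

Lemma ctsDv n (f g : T -> 'cV[R]_n) :
  continuous f -> continuous g -> continuous (fun t => f t + g t).
Proof.
move=> cf cg; apply: continuous_cV => i; under eq_fun do rewrite mxE.
by apply: ctsD; exact: cts_coord.
Qed.

Lemma ctsZv n (f : T -> R) (g : T -> 'cV[R]_n) :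
  continuous f -> continuous g -> continuous (fun t => f t *: g t).
Proof.
move=> cf cg; apply: continuous_cV => i; under eq_fun do rewrite mxE.
by apply: ctsM => //; exact: cts_coord.
Qed.

Lemma ctsCv n (c : 'cV[R]_n) : continuous (fun _ : T => c).
Proof. by move=> t; exact: cvg_cst. Qed.
End continuity_closure.

Lemma cts_id (T : topologicalType) : continuous (fun t : T => t).
Proof. by move=> t; exact: cvg_id. Qed.

(** * Borel sets, half-open boxes and Lebesgue measure on R^n *)

Section borel_cV.
Context {R : realType}.
Local Notation B n := (borelR R n).

Definition hbox {n} (a b : 'cV[R]_n) : set (borelR R n) :=
  [set x : 'cV[R]_n | forall i, a i 0 <= x i 0 < b i 0].

Lemma open_measurable_cV n (A : set 'cV[R]_n) : open A -> measurable (A : set (B n)).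
Proof. by move=> oA; exact: sub_sigma_algebra. Qed.

Lemma closed_measurable_cV n (A : set 'cV[R]_n) :
  closed A -> measurable (A : set (B n)).
Proof.
by move=> cA; rewrite -(setCK A); apply: measurableC; apply: open_measurable_cV;
  exact: closed_openC.
Qed.

Lemma continuous_measurable_cV n (f : 'cV[R]_n -> R) :
  continuous f -> measurable_fun setT (f : B n -> R).
Proof.
move=> /continuousP cf; apply: (measurability _ (measurable_realfun.RGenOpens.measurableE R)).
move=> _ [_ [a [b ->] <-]]; rewrite setTI; apply: open_measurable_cV.
exact/cf/interval_open.
Qed.

Lemma measurable_coord n (i : 'I_n) :
  measurable_fun setT (fun x : B n => (x : 'cV[R]_n) i 0).
Proof. by apply: continuous_measurable_cV; exact: continuous_coord. Qed.

Lemma measurable_hbox n (a b : 'cV[R]_n) : measurable (hbox a b).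
Proof.
have -> : hbox a b = \bigcap_(i in [set: 'I_n])
    ((fun x : B n => (x : 'cV[R]_n) i 0) @^-1` `[a i 0, b i 0[).
  by rewrite predeqE => x; split => [ab i _|ab i] /=;
    [rewrite in_itv/=; exact: ab|have := ab i Logic.I; rewrite /= in_itv].
apply: fin_bigcap_measurable => [|i _]; first exact: finite_finset.
by rewrite -[X in measurable X]setTI; apply: measurable_coord.
Qed.

Lemma hbox_setI n (a b c d : 'cV[R]_n) : hbox a b `&` hbox c d =
  hbox (\col_i Num.max (a i 0) (c i 0)) (\col_i Num.min (b i 0) (d i 0)).
Proof.
rewrite predeqE => x; split => [[ab cd] i|h].
  rewrite !mxE ge_max lt_min.
  by have /andP[-> ->] := ab i; have /andP[-> ->] := cd i.
by split => i; have := h i; rewrite !mxE ge_max lt_min => /andP[/andP[h1 h2] /andP[h3 h4]];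
  apply/andP.
Qed.

Definition hboxes n : set (set (borelR R n)) :=
  [set A | exists a b, A = hbox a b].

Lemma hbox_setI_closed n : setI_closed (@hboxes n).
Proof.
move=> _ _ [a [b ->]] [c [d ->]]; rewrite hbox_setI.
by do 2 eexists.
Qed.

Lemma open_bigcup_hbox n (O : set 'cV[R]_n) : open O ->
  O = \bigcup_k (if @unpickle ('cV[rat]_n * 'cV[rat]_n)%type k is Some p then
    let Q := hbox (map_mx ratr p.1) (map_mx ratr p.2) in
    if `[< Q `<=` O >] then Q else set0 else set0).
Proof.
move=> oO; rewrite predeqE => x; split; last first.
  by case=> k _ /=; case: unpickle => // p; case: ifPn => // /asboolP; exact.
move=> Ox; have [e /= e0 xeO] : exists2 e : R, 0 < e & ball x e `<=` O.
  have /nbhs_ballP[e /= e0 h] := open_nbhs_nbhs (conj oO Ox).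
  by exists e.
have ratq (u v : R) : u < v -> exists q : rat, u < ratr q < v.
  by move=> /rat_in_itvoo[q]; exists q; rewrite in_itv in p.
have h1 i : exists q : rat, x i 0 - e < ratr q < x i 0 by apply: ratq; lra.
have h2 i : exists q : rat, x i 0 < ratr q < x i 0 + e by apply: ratq; lra.
have [f1 f1E] := choice h1; have [f2 f2E] := choice h2.
exists (pickle (\col_i f1 i, \col_i f2 i)) => //; rewrite pickleK /=.
case: ifPn => [_ i|/asboolP]; last first.
  move=> H; exfalso; apply: H => y yQ; apply: xeO; split => // i j.
  rewrite ord1 /ball/=; have := yQ i; rewrite !mxE.
  have /andP[a1 a2] := f1E i; have /andP[b1 b2] := f2E i => /andP[c1 c2].
  by rewrite ltr_distlC; apply/andP; split; lra.
rewrite !mxE; have /andP[_ /ltW ->] := f1E i.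
by have /andP[-> _] := f2E i.
Qed.

(** Every open set is a countable union of rational boxes. Hence measurability can be tested
    coordinatewise and measures finite on boxes are determined by boxes. *)
Lemma measurable_hboxE n :
  @measurable _ (B n) = <<s @hboxes n >>.
Proof.
apply/seteqP; split => A.
  apply: smallest_sub => [|O oO]; first exact: smallest_sigma_algebra.
  rewrite (open_bigcup_hbox oO).
  have [s0 _ sU] := smallest_sigma_algebra setT (@hboxes n).
  apply: sU => k; case: unpickle => [p|]//=; case: ifPn => // _.
  by apply: sub_sigma_algebra; do 2 eexists.
apply: smallest_sub; first exact: sigma_algebra_measurable.
by move=> _ [a [b ->]]; exact: measurable_hbox.
Qed.
End borel_cV.

Section lebesgue_cV.
Context {R : realType}.
Local Notation B n := (borelR R n).

Lemma measurable_fun_cV d (T : measurableType d) n (D : set T)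
    (f : T -> 'cV[R]_n) :
  (forall i, measurable_fun D (fun t => f t i 0)) ->
  measurable_fun D (f : T -> B n).
Proof.
move=> mf mD; move: (mD); apply: (measurability _ (@measurable_hboxE R n)).
move=> _ [_ [a [b ->]] <-].
have -> : D `&` f @^-1` hbox a b = D `&` \bigcap_(i in [set: 'I_n])
    (D `&` (fun t => f t i 0) @^-1` `[a i 0, b i 0[).
  rewrite predeqE => x; split => [[Dx h]|[Dx h]]; split=> // i.
    by split => //=; rewrite in_itv/=; exact: h.
  by have [] := h i Logic.I; rewrite /= in_itv.
apply: measurableI => //.
apply: fin_bigcap_measurable => [|i _]; first exact: finite_finset.
exact: mf.
Qed.

Lemma measure_hbox_unique n (m1 m2 : {measure set (B n) -> \bar R}) :
  (forall a b : 'cV[R]_n, m1 (hbox a b) = m2 (hbox a b)) ->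
  (forall a b : 'cV[R]_n, (m1 (hbox a b) < +oo)%E) ->
  forall A, measurable A -> m1 A = m2 A.
Proof.
move=> m12 m1oo; apply: (measure_unique (@hboxes R n)
  (fun k => hbox (const_mx (- k%:R)) (const_mx k%:R))) => //.
- exact: measurable_hboxE.
- exact: hbox_setI_closed.
- by move=> k; do 2 eexists.
- apply/seteqP; split=> // x _; near \oo => k.
  exists k => // i; rewrite !mxE.
  suff : `|(x : 'cV[R]_n) i 0| < k%:R by rewrite ltr_norml => /andP[/ltW -> ->].
  apply: le_lt_trans (coord_le_norm _ _) _.
  by near: k; exact: nbhs_infty_gtr.
- by move=> _ [a [b ->]].
Unshelve. all: by end_near. Qed.

Lemma hbox_eq0 n (a b : 'cV[R]_n) i : b i 0 <= a i 0 -> hbox a b = set0.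
Proof.
move=> ba; apply/seteqP; split => // x /(_ i) /andP[h1 h2] /=.
by have := le_lt_trans h1 h2; rewrite ltNge ba.
Qed.

Lemma measurable_col_mx n : measurable_fun setT
  (fun p : measurableTypeR R * B n => col_mx (p.1%:M : 'cV[R]_1) p.2 : B n.+1).
Proof.
apply: (@measurable_fun_cV _ (measurableTypeR R * B n)%type n.+1 setT (fun p => col_mx (p.1%:M : 'cV[R]_1) p.2)).
move=> i; have [k ->|k ->] := @split_ordP 1 n i.
  rewrite (_ : (fun _ => _) = fst); first exact: measurable_fst.
  apply/funext => p; rewrite (@col_mxEu _ 1 n 1 (p.1%:M : 'cV[R]_1) p.2).
  by rewrite mxE !ord1 eqxx mulr1n.
rewrite (_ : (fun _ => _) =
    (fun x : B n => (x : 'cV[R]_n) k 0) \o snd); last first.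
  by apply/funext => p; rewrite (@col_mxEd _ 1 n 1 (p.1%:M : 'cV[R]_1) p.2).
apply: measurableT_comp; last exact: measurable_snd.
exact: measurable_coord.
Qed.

Lemma preimage_col_mx_hbox n (a b : 'cV[R]_(1 + n)) :
  (fun p : measurableTypeR R * B n =>
     col_mx (p.1%:M : 'cV[R]_1) p.2 : B n.+1) @^-1` hbox a b =
  `[a (lshift n 0) 0, b (lshift n 0) 0[%classic `*` hbox (dsubmx a) (dsubmx b).
Proof.
apply/seteqP; split => [[t x] /= h|[t x] /= [h1 h2] i].
  split; first by have := h (lshift n 0); rewrite col_mxEu mxE eqxx mulr1n in_itv.
  by move=> i; have := h (rshift 1 i); rewrite col_mxEd !mxE.
have [k ->|k ->] := @split_ordP 1 n i.
  by rewrite col_mxEu mxE !ord1 eqxx mulr1n; move: h1; rewrite in_itv.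
by rewrite col_mxEd; have := h2 k; rewrite !mxE.
Qed.

(** [lebesgue_n] is only a set function. The induction carries a sigma-finite measure structure,
    required to form the next product, together with the volume of boxes. *)
Lemma lebesgue_n_spec n : exists mu : {sigma_finite_measure set (B n) -> \bar R},
  @lebesgue_n R n = mu :> (set _ -> \bar R) /\
  forall a b : 'cV[R]_n, (forall i, a i 0 <= b i 0) ->
    mu (hbox a b) = (\prod_i (b i 0 - a i 0))%:E.
Proof.
elim: n => [|n [mu [muE mub]]].
  exists (\d_((0 : 'cV[R]_0) : B 0)); split => // a b _.
  rewrite big_ord0 /= diracE mem_set//.
  by case.
pose phi := (fun p : measurableTypeR R * B n =>
  col_mx (p.1%:M : 'cV[R]_1) p.2 : B n.+1).
have mphi : measurable_fun setT phi by exact: measurable_col_mx.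
pose nu0 := (@lebesgue_measure R \x mu)%E.
pose nu : {measure set (B n.+1) -> \bar R} := 
  measure_function_pushforward__canonical__measure_function_Measure nu0 mphi.
have nub (a b : 'cV[R]_n.+1) : (forall i, a i 0 <= b i 0) ->
    nu (hbox a b) = (\prod_i (b i 0 - a i 0))%:E.
  move=> ab; transitivity (nu0 (phi @^-1` hbox (a : 'cV[R]_(1 + n)) b)) => //.
  rewrite preimage_col_mx_hbox /nu0 product_measure1E//; last first.
    exact: measurable_hbox.
  rewrite mub; last by move=> i; rewrite !mxE.
  rewrite [X in (X * _)%E](_ : _ = lebesgue_measure
    `[a (@lshift 1 n 0) 0, b (@lshift 1 n 0) 0[%classic)//.
  rewrite lebesgue_measure_itv/= lte_fin; rewrite big_ord_recl EFinM.
  have -> : lshift n 0 = 0 :> 'I_(1 + n) by apply/val_inj.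
  congr (_ * _)%E.
    have := ab 0; rewrite le_eqVlt => /orP[/eqP ->|->]; last by rewrite EFinB.
    by rewrite ltxx subrr.
  congr EFin; apply: eq_bigr => i _; rewrite !mxE.
  by have -> : rshift 1 i = lift 0 i by apply/val_inj.
have nusf : sigma_finite setT nu.
  exists (fun k => hbox (const_mx (- k%:R)) (const_mx k%:R)).
    apply/esym/seteqP; split=> // x _; near \oo => k.
    exists k => // i; rewrite !mxE.
    suff : `|(x : 'cV[R]_n.+1) i 0| < k%:R.
      by rewrite ltr_norml => /andP[/ltW -> ->].
    apply: le_lt_trans (coord_le_norm _ _) _.
    by near: k; exact: nbhs_infty_gtr.
  move=> k; split; first exact: measurable_hbox.
  rewrite nub ?ltry// => i; rewrite !mxE.
  by rewrite (@le_trans _ _ 0) ?oppr_le0.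
have nufin := isSigmaFinite.Build _ _ _ nu nusf.
have nusfin := isSFinite.Build _ _ _ nu (sfinite_measure_sigma_finite nusf).
pose nu' : {sigma_finite_measure set (B n.+1) -> \bar R} :=
  HB.pack (nu : set _ -> \bar R) (Measure.on nu) nusfin nufin.
exists nu'; split => //.
by rewrite /= muE.
Unshelve. all: by end_near. Qed.

End lebesgue_cV.

(** * Integration against Lebesgue measure *)

Section Leb.
Context {R : realType}.
Local Notation B n := (borelR R n).

Definition Leb n : {sigma_finite_measure set (B n) -> \bar R} :=
  projT1 (cid (@lebesgue_n_spec R n)).

Lemma lebesgue_nE n : @lebesgue_n R n = Leb n.
Proof. by rewrite /Leb; case: cid => mu []. Qed.

Lemma Leb_hbox n (a b : 'cV[R]_n) : (forall i, a i 0 <= b i 0) ->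
  Leb n (hbox a b) = (\prod_i (b i 0 - a i 0))%:E.
Proof. by rewrite /Leb; case: cid => mu [? h] /= /h. Qed.

Lemma Leb_hbox_lty n (a b : 'cV[R]_n) : (Leb n (hbox a b) < +oo)%E.
Proof.
have [[i ba]|h] := pselect (exists i, b i 0 <= a i 0).
  by rewrite (hbox_eq0 ba) measure0 ltry.
rewrite Leb_hbox ?ltry// => i; rewrite leNgt; apply/negP => ba.
by apply: h; exists i; exact: ltW.
Qed.

Definition cball n (M : R) : set (B n) := [set x : 'cV[R]_n | `|x| <= M].

Lemma ball_sub_hbox n (M : R) :
  @cball n M `<=` hbox (const_mx (- (M + 1))) (const_mx (M + 1)).
Proof.
move=> x /= xM i; rewrite !mxE.
have := le_trans (coord_le_norm x i) xM.
by rewrite ler_norml => /andP[h1 h2]; apply/andP; split; lra.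
Qed.

Lemma measurable_ball_cV n (M : R) : measurable (@cball n M).
Proof.
by apply: closed_measurable_cV; apply: compact_closed_cV; exact: compact_ball.
Qed.

Lemma Leb_ball_lty n (M : R) : (Leb n (@cball n M) < +oo)%E.
Proof.
apply: le_lt_trans (Leb_hbox_lty (const_mx (- (M + 1))) (const_mx (M + 1))).
apply: le_measure; rewrite ?inE; [exact: measurable_ball_cV|exact: measurable_hbox|].
exact: ball_sub_hbox.
Qed.

Lemma measurable_translate n (t : 'cV[R]_n) :
  measurable_fun setT (fun x : B n => (x : 'cV[R]_n) + t : B n).
Proof.
apply: measurable_fun_cV => i.
apply: (@continuous_measurable_cV R n (fun x => (x + t) i 0)).
by apply: cts_coord; apply: ctsDv; [exact: cts_id|exact: ctsCv].
Qed.

Lemma Leb_translate n (t : 'cV[R]_n) (A : set (B n)) : measurable A ->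
  Leb n ((fun x : B n => (x : 'cV[R]_n) + t : B n) @^-1` A) = Leb n A.
Proof.
have mt := measurable_translate t.
pose nu : {measure set (B n) -> \bar R} :=
  measure_function_pushforward__canonical__measure_function_Measure (Leb n) mt.
have E a b : (fun x : B n => (x : 'cV[R]_n) + t : B n) @^-1` hbox a b =
    hbox (a - t) (b - t).
  rewrite predeqE => x; split=> h i; have := h i; rewrite !mxE;
    by rewrite lerBlDr ltrBrDr.
have nuE a b : nu (hbox a b) = Leb n (hbox a b).
  transitivity (Leb n (hbox (a - t) (b - t))); first by rewrite -E.
  have [[i ba]|h] := pselect (exists i, b i 0 <= a i 0).
    by rewrite (hbox_eq0 ba) (@hbox_eq0 _ _ _ _ i)// !mxE lerD2r.
  have ab i : a i 0 <= b i 0.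
    by rewrite leNgt; apply/negP => ba; apply: h; exists i; exact: ltW.
  rewrite !Leb_hbox//; last by move=> i; rewrite !mxE lerD2r.
  by congr EFin; apply: eq_bigr => i _; rewrite !mxE; ring.
move=> mA; rewrite -[RHS](@measure_hbox_unique R n nu (Leb n) nuE)// => a b.
by rewrite nuE Leb_hbox_lty.
Qed.

Lemma Rintegral_translate n (t : 'cV[R]_n) (f : 'cV[R]_n -> R) :
  (Leb n).-integrable setT (EFin \o f) ->
  \int[Leb n]_x f (x + t) = \int[Leb n]_x f x.
Proof.
move=> intf; have mt := measurable_translate t.
have mf := measurable_int _ intf.
have key (g : B n -> \bar R) : measurable_fun [set: B n] g -> (forall x, (0 <= g x)%E) ->
    (\int[Leb n]_x g (((x : 'cV[R]_n) + t)%R : 'cV[R]_n) = \int[Leb n]_x g x)%E.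
  move=> mg g0; rewrite -[LHS](@ge0_integral_pushforward _ _ _ _ R _ mt (Leb n) setT)//.
  apply: eq_measure_integral => A mA _; exact: Leb_translate.
rewrite /Rintegral; congr fine; rewrite integralE [RHS]integralE.
congr (_ - _)%E.
  rewrite -[RHS](key _ (measurable_funepos mf)) => [|x]; last exact: funepos_ge0.
  by apply: eq_integral => x _; rewrite !funeposE.
rewrite -[RHS](key _ (measurable_funeneg mf)) => [|x]; last exact: funeneg_ge0.
by apply: eq_integral => x _; rewrite !funenegE.
Qed.

Lemma integrable_bounded_supp n (mu : {measure set (B n) -> \bar R})
    (f : 'cV[R]_n -> R) (C M : R) :
  (mu (@cball n M) < +oo)%E ->
  measurable_fun setT (f : B n -> R) ->
  (forall x, `|f x| <= C) -> (forall x : 'cV[R]_n, M < `|x| -> f x = 0) ->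
  mu.-integrable setT (EFin \o f).
Proof.
move=> muM mf fC fM; pose D := @cball n M.
have mD : measurable D by exact: measurable_ball_cV.
apply: (@le_integrable _ _ _ mu _ measurableT _ (EFin \o (fun x => C * \1_D x))).
- exact/measurable_EFinP.
- move=> x _ /=; rewrite lee_fin [leRHS]ger0_norm; last first.
    by rewrite mulr_ge0// (le_trans _ (fC x)).
  rewrite indicE; have [|xM] := boolP (x \in D); first by rewrite mulr1.
  rewrite fM ?normr0 ?mulr0//; move: xM; rewrite notin_setE /D /cball /= => /negP.
  by rewrite -ltNge.
- under [X in _.-integrable _ X]eq_fun do rewrite /= EFinM.
  apply: integrableZl => //; apply/integrableP; split.
    by apply/measurable_EFinP; exact: measurable_indic.
  under eq_integral do rewrite /= ger0_norm//.
  by rewrite integral_indic// setIT.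
Qed.

Lemma continuous_supp_bounded n (f : 'cV[R]_n -> R) (M : R) :
  continuous f -> (forall x : 'cV[R]_n, M < `|x| -> f x = 0) ->
  exists C, forall x, `|f x| <= C.
Proof.
move=> cf fM; have [C hC] := compact_norm_bounded_fun (@compact_ball R n M) cf.
exists (Num.max C 0) => x; rewrite le_max; have [xM|xM] := leP `|x| M.
  by rewrite (hC x xM).
by rewrite fM// normr0 lexx orbT.
Qed.

Lemma integrable_continuous_supp n (f : 'cV[R]_n -> R) (M : R) :
  continuous f -> (forall x : 'cV[R]_n, M < `|x| -> f x = 0) ->
  (Leb n).-integrable setT (EFin \o f).
Proof.
move=> cf fM; have [C fC] := continuous_supp_bounded cf fM.
apply: (integrable_bounded_supp _ _ fC fM); first exact: Leb_ball_lty.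
exact: continuous_measurable_cV.
Qed.

(** The derivatives are bounded by C and vanish off a fixed ball, so C times the indicator of that
    ball dominates them. *)
Lemma derive_under_integral n (f f' : R -> 'cV[R]_n -> R) (u v a C M : R) :
  a \in `]u, v[ ->
  (forall t, t \in `]u, v[ -> continuous (f t)) ->
  (forall t (x : 'cV[R]_n), t \in `]u, v[ -> M < `|x| -> f t x = 0) ->
  (forall t x, t \in `]u, v[ -> is_derive t 1 (f^~ x) (f' t x)) ->
  (forall t x, t \in `]u, v[ -> `|f' t x| <= C) ->
  (forall t (x : 'cV[R]_n), t \in `]u, v[ -> M < `|x| -> f' t x = 0) ->
  is_derive a 1 (fun t => \int[Leb n]_x f t x) (\int[Leb n]_x f' a x).
Proof.
move=> auv cf fM df f'C f'M.
have d1 t x : t \in `]u, v[ -> partial1of2 f t x = f' t x.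
  by move=> tuv; rewrite partial1of2E; have [_ ->] := df t x tuv.
pose D := @cball n M.
have C0 : 0 <= C by rewrite (le_trans _ (f'C a 0 auv)).
pose G := (fun x : B n => C * \1_D x).
have mD : measurable D by exact: measurable_ball_cV.
have intG : (Leb n).-integrable setT (EFin \o G).
  apply: (@integrable_bounded_supp n (Leb n) G C M).
  - exact: Leb_ball_lty.
  - by apply: measurable_funM => //; exact: measurable_indic.
  - move=> x; rewrite /G indicE; case: (x \in D); rewrite ?mulr1 ?mulr0 ?normr0//.
    by rewrite ger0_norm.
  - move=> x xM; rewrite /G indicE memNset ?mulr0//=.
    by apply/negP; rewrite -ltNge.
have G0 x : 0 <= G x by rewrite mulr_ge0.
have intf t : `]u, v[%classic t -> (Leb n).-integrable setT (EFin \o f t).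
  move=> tuv; apply: (@integrable_continuous_supp _ _ M) => [|x]; first exact: cf.
  exact: fM.
have der t (x : B n) : `]u, v[%classic t -> [set: B n] x -> derivable (f^~ x) t 1.
  by move=> tuv _; have [] := df t x tuv.
have ub t (x : B n) : `]u, v[%classic t -> [set: B n] x ->
    `|partial1of2 f t x| <= G x.
  move=> tuv _; rewrite d1// /G indicE; have [|xM] := boolP (x \in D).
    by rewrite mulr1 f'C.
  rewrite f'M ?normr0 ?mulr0//; move: xM; rewrite notin_setE /D /cball /= => /negP.
  by rewrite -ltNge.
apply: DeriveDef.
  exact: (@derivable_under_integral R _ _ (Leb n) f setT measurableT a u v auv intf der G G0 intG ub).
rewrite -derive1E (@differentiation_under_integral R _ _ (Leb n) f setT measurableT a u v auv intf der G G0 intG ub).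
by apply: eq_Rintegral => x _; rewrite d1.
Qed.

(** By translation invariance the integral of F(x + t e_i) does not depend on t, and its derivative
    at t = 0 is the integral of F'. *)
Lemma integral_derive0 n (i : 'I_n) (F F' : 'cV[R]_n -> R) (M : R) :
  continuous F -> continuous F' ->
  (forall x : 'cV[R]_n, M < `|x| -> F x = 0) ->
  (forall x, is_derive x (basis_vec i) F (F' x)) ->
  \int[Leb n]_x F' x = 0.
Proof.
move=> cF cF' FM dF.
have F'M x : M < `|x| -> F' x = 0.
  move=> xM; have [_ <-] := dF x.
  have -> : 'D_(basis_vec i) F x = 'D_(basis_vec i) (cst 0 : 'cV[R]_n -> R) x.
    apply: near_eq_derive.
    have : \forall y \near x, M < `|y|.
      by have /cvgr_gt := @norm_continuous R 'cV[R]_n x; apply.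
    by apply: filterS => y yM; rewrite FM.
  by rewrite derive_cst.
have [C F'C] := continuous_supp_bounded cF' F'M.
have bx (x : 'cV[R]_n) t : `|t| < 1 -> M + 1 < `|x| -> M < `|x + t *: basis_vec i|.
  move=> t1 xM; rewrite -(opprK (t *: _)).
  have b1 : `|basis_vec i : 'cV[R]_n| <= 1.
    by apply/normcV_le => // k; rewrite mxE; case: (_ && _); rewrite ?normr1 ?normr0.
  apply: lt_le_trans (lerB_dist _ _); rewrite normrN normrZ.
  have : `|t| * `|basis_vec i : 'cV[R]_n| <= 1 by rewrite mulr_ile1// ltW.
  lra.
have key : is_derive (0 : R) 1 (fun t => \int[Leb n]_x F (x + t *: basis_vec i))
    (\int[Leb n]_x F' (x + 0 *: basis_vec i)).
  apply: (@derive_under_integral _ (fun t x => F (x + t *: basis_vec i))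
     (fun t x => F' (x + t *: basis_vec i)) (-1) 1 _ C (M + 1)).
  - by rewrite in_itv/=; apply/andP; split; lra.
  - move=> t _; apply: (@cts_comp _ _ _ (fun x : 'cV[R]_n => x + t *: basis_vec i) F) => //.
    by apply: ctsDv; [exact: cts_id|exact: ctsCv].
  - move=> t x; rewrite in_itv/= -ltr_norml => t1 xM.
    by apply: FM; exact: bx.
  - move=> t x _; have [h1 h2] := dF (x + t *: basis_vec i).
    have E : (fun h => h^-1 *: (F ((x + (h *: 1 + t) *: basis_vec i)) - F (x + t *: basis_vec i))) =
      (fun h => h^-1 *: (F (h *: basis_vec i + (x + t *: basis_vec i)) - F (x + t *: basis_vec i))).
      apply/funext => h; congr (_ *: (F _ - _)).
      by rewrite [h *: 1]mulr1 scalerDl addrCA.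
    apply: DeriveDef.
      by rewrite /derivable/= E.
    by rewrite /derive/= E.
  - by move=> t x _; exact: F'C.
  - move=> t x; rewrite in_itv/= -ltr_norml => t1 xM.
    by apply: F'M; exact: bx.
have [_ <-] : is_derive (0 : R) 1 (fun t => \int[Leb n]_x F (x + t *: basis_vec i))
    (\int[Leb n]_x F' x).
  move: key; rewrite (_ : (fun x => F' (x + _)) = F')//.
  by apply/funext => x; rewrite scale0r addr0.
rewrite (_ : (fun t : R => _) = cst (\int[Leb n]_x F x)).
  by rewrite derive_cst.
apply/funext => t; rewrite Rintegral_translate//.
exact: integrable_continuous_supp cF FM.
Qed.
End Leb.

(** * Directional derivatives and the chain rule *)

Section calculus.
Context {R : realType}.

Lemma cvg_bigsum (T I : Type) (F : set_system T) (FF : Filter F) (r : seq I)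
    (f : I -> T -> R) (l : I -> R) :
  (forall i, f i @ F --> l i) ->
  (fun t => \sum_(i <- r) f i t) @ F --> \sum_(i <- r) l i.
Proof.
move=> fl; elim: r => [|i r ih].
  by under eq_fun do rewrite big_nil; rewrite big_nil; exact: cvg_cst.
by under eq_fun do rewrite big_cons; rewrite big_cons; exact: (cvgD (fl i) ih).
Qed.

Lemma is_derive_lineE (V : normedModType R) (f : V -> R) (x v : V) (t d : R) :
  is_derive t 1 (fun s => f (x + s *: v)) d <-> is_derive (x + t *: v) v f d.
Proof.
have E : (fun h => h^-1 *: (f (x + (h *: 1 + t) *: v) - f (x + t *: v))) =
    (fun h => h^-1 *: (f (h *: v + (x + t *: v)) - f (x + t *: v))).
  apply/funext => h; congr (_ *: (f _ - _)).
  by rewrite [h *: 1]mulr1 scalerDl addrCA.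
split=> -[h1 h2]; apply: DeriveDef; move: h1 h2;
  by rewrite /derivable/= /derive/= E.
Qed.

Lemma is_derive_line0E (V : normedModType R) (f : V -> R) (x v : V) (d : R) :
  is_derive (0 : R) 1 (fun s => f (x + s *: v)) d <-> is_derive x v f d.
Proof. by rewrite is_derive_lineE scale0r addr0. Qed.

Lemma is_derive_affine (a b t : R) : is_derive t 1 (fun s : R => a + s * b) b.
Proof.
apply: is_derive_eq; rewrite /GRing.scale/=; ring.
Qed.

Lemma is_derive_mul (V : normedModType R) (f g : V -> R) (x v : V) (f' g' : R) :
  is_derive x v f f' -> is_derive x v g g' ->
  is_derive x v (fun t => f t * g t) (f' * g x + f x * g').
Proof.
move=> df dg; have := is_deriveM df dg.
by rewrite /GRing.scale/= addrC (mulrC (g x)).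
Qed.

Lemma MVT_line (V : normedModType R) (f df : V -> R) (x v : V) (h : R) :
  (forall y, is_derive y v f (df y)) ->
  exists2 th, 0 <= th <= 1 & f (x + h *: v) - f x = h * df (x + (th * h) *: v).
Proof.
move=> fdf; pose g t := f (x + (t * h) *: v).
have dg (t : R) : is_derive t 1 g (h * df (x + (t * h) *: v)).
  have -> : g = fun s => f (x + s *: (h *: v)).
    by apply/funext => s; rewrite /g scalerA.
  rewrite is_derive_lineE scalerA.
  have := fdf (x + (t * h) *: v); move: (x + _) => y.
  have [->|h0] := eqVneq h 0; first by move=> _; rewrite scale0r mul0r; exact: is_derive0.
  move=> dy; apply/is_derive_line0E; move/is_derive_line0E : dy => dy.
  have -> : (fun s => f (y + s *: (h *: v))) = (fun s => f (y + s *: v)) \o (fun s => s * h).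
    by apply/funext => s /=; rewrite scalerA.
  have dh : is_derive (0 : R) 1 (fun s => s * h) h.
    by apply: is_derive_eq; rewrite scaler0 add0r [_ *: _]mulr1.
  rewrite -(mul0r h) in dy.
  have := @is_derive1_comp _ (fun s => f (y + s *: v)) (fun s => s * h) 0 (df y) h dy dh.
  by rewrite (mulrC (df y)).
have [c c01 e] := @MVT_segment _ g _ 0 1 ler01 (fun t _ => dg t)
  (derivable_within_continuous (fun t _ => @ex_derive _ _ _ _ _ _ _ (dg t))).
exists c; first by move: c01; rewrite in_itv.
by move: e; rewrite /g mul1r mul0r scale0r addr0 subr0 mulr1.
Qed.

(** Only partial derivatives are available, not a differential. The increment of f along g is
    telescoped by changing one coordinate at a time; the mean value theorem handles each change, and
    continuity of the partials gives the limit. *)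
Lemma is_derive_chain n (f : 'cV[R]_n -> R) (f_ : 'I_n -> 'cV[R]_n -> R)
    (g : R -> 'cV[R]_n) (g' : 'I_n -> R) (s : R) :
  (forall i x, is_derive x (basis_vec i) f (f_ i x)) ->
  (forall i, continuous (f_ i)) ->
  (forall i, is_derive s 1 (fun t => g t i 0) (g' i)) ->
  is_derive s 1 (fun t => f (g t)) (\sum_i f_ i (g s) * g' i).
Proof.
move=> df cf dg.
(* The first k coordinates are already those of g(t), the others still those of g(s). *)
pose p (k : nat) (t : R) : 'cV[R]_n := \col_i (if (i < k)%N then g t i 0 else g s i 0).
pose D k t : R := g t k 0 - g s k 0.
have pS (k : 'I_n) t : p k.+1 t = p k t + D k t *: basis_vec k.
  apply/colP => i; rewrite !mxE ltnS leq_eqVlt eqxx andbT.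
  have [->|ik] := eqVneq i k; first by rewrite eqxx ltnn mulr1 /D addrC subrK.
  by rewrite (negbTE (ik : nat_of_ord i != nat_of_ord k)) mulr0 addr0.
have mvt (k : 'I_n) t : exists xi : 'cV[R]_n, `|xi - g s| <= `|g t - g s| /\
    f (p k.+1 t) - f (p k t) = D k t * f_ k xi.
  have [th /andP[th0 th1] e] := MVT_line (p k t) (D k t) (df k).
  rewrite pS e; eexists; split; last by [].
  apply/normcV_le => // i; rewrite !mxE eqxx andbT.
  have [->|ik] := eqVneq i k.
    rewrite ltnn mulr1 addrC addKr normrM ger0_norm//.
    rewrite (le_trans _ (coord_le_norm _ k))// !mxE -/(D k t).
    by rewrite ler_piMl.
  rewrite mulr0 addr0; case: ifPn => _; last by rewrite subrr normr0.
  by rewrite (le_trans _ (coord_le_norm _ i))// !mxE.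
pose xi k t := projT1 (cid (mvt k t)).
have xi1 k t : `|xi k t - g s| <= `|g t - g s| by rewrite /xi; case: cid => y [].
have xi2 (k : 'I_n) t : f (p k.+1 t) - f (p k t) = D k t * f_ k (xi k t).
  by rewrite /xi; case: cid => y [].
have gE t : f (g t) - f (g s) = \sum_(k < n) D k t * f_ k (xi k t).
  have -> : g t = p n t by apply/colP => i; rewrite mxE ltn_ord.
  have -> : g s = p 0%N t by apply/colP => i; rewrite mxE ltn0.
  rewrite -(telescope_sumr (fun k => f (p k t)) (leq0n n)) big_mkord.
  by apply: eq_bigr => k _; rewrite xi2.
have gcts : g (h *: 1 + s) @[h --> 0^'] --> g s.
  apply/cvg_cVP => i.
  have ci : {for s, continuous (fun t => g t i 0)}.
    apply: differentiable_continuous; apply/derivable1_diffP.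
    exact: (@ex_derive _ _ _ _ _ _ _ (dg i)).
  have hs : (h *: 1 + s : R) @[h --> (0 : R)^'] --> s.
    apply: cvg_within_filter.
    have : (fun h : R => h *: 1 + s) @ 0 --> (0 : R) *: 1 + s.
      by apply: cvgD; [apply: cvgZr_tmp; exact: cvg_id|exact: cvg_cst].
    by rewrite scale0r add0r.
  exact: (@cvg_comp _ _ _ (fun h : R => h *: 1 + s) (fun t => g t i 0) _ _ _ hs ci).
have xicts k : f_ k (xi k (h *: 1 + s)) @[h --> 0^'] --> f_ k (g s).
  apply: (@cvg_comp _ _ _ (fun h => xi k (h *: 1 + s)) (f_ k) _ (nbhs (g s))); last exact: cf.
  apply/cvgrPdist_lt => e e0; move/cvgrPdist_lt : gcts => /(_ e e0).
  apply: filterS => h; rewrite distrC => he; rewrite distrC.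
  exact: le_lt_trans (xi1 _ _) he.
have key : h^-1 *: (f (g (h *: 1 + s)) - f (g s)) @[h --> 0^'] -->
    \sum_i f_ i (g s) * g' i.
  under eq_fun do rewrite gE scaler_sumr.
  apply: cvg_bigsum => k.
  under eq_fun do rewrite [_ *: _]mulrA mulrC.
  apply: cvgM; first exact: xicts.
  have [h1 h2] := dg k; rewrite -h2; exact: h1.
apply: DeriveDef; first by apply/cvg_ex; eexists; exact: key.
exact/cvg_lim.
Qed.

End calculus.

(** * Functions of class C^k *)

Section Ck.
Context {R : realType} {n : nat}.
Implicit Types (f g v w : 'cV[R]_n -> R) (x y : 'cV[R]_n).
Local Notation e_ i := (basis_vec i).

Lemma is_Ck_cts k f : is_Ck k f -> continuous f.
Proof. by case: k => [|k] []. Qed.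

(** Allows any explicit candidates for the partial derivatives, so that the closure lemmas below go
    by induction without computing 'D_(e_ i). *)
Lemma is_CkSP k f : is_Ck k.+1 f <-> continuous f /\
  exists f_ : 'I_n -> 'cV[R]_n -> R, forall i,
    (forall x, is_derive x (e_ i) f (f_ i x)) /\ is_Ck k (f_ i).
Proof.
split=> [[cf h]|[cf [f_ h]]].
  split => //; exists (fun i => 'D_(e_ i) f) => i; have [h1 h2] := h i.
  by split => // x; apply: derivableP.
split => // i; have [h1 h2] := h i; split => [x|]; first by have [] := h1 x.
have -> : 'D_(e_ i) f = f_ i by apply/funext => x; have [] := h1 x.
exact: h2.
Qed.

Lemma is_Ck_derive k f i x : is_Ck k.+1 f -> is_derive x (e_ i) f ('D_(e_ i) f x).
Proof. by case=> _ /(_ i)[h _]; exact: derivableP. Qed.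

Lemma is_Ck_D k f i : is_Ck k.+1 f -> is_Ck k ('D_(e_ i) f).
Proof. by case=> _ /(_ i)[]. Qed.

Lemma is_Ck_le k l f : (k <= l)%N -> is_Ck l f -> is_Ck k f.
Proof.
elim: k l f => [|k ih] [|l] f //; first by move=> _ [].
rewrite ltnS => kl /is_CkSP[cf [f_ h]]; apply/is_CkSP; split => //.
by exists f_ => i; have [h1 h2] := h i; split => //; exact: ih h2.
Qed.

Lemma is_Ck_cst k (c : R) : is_Ck k (fun _ : 'cV[R]_n => c).
Proof.
elim: k c => [|k ih] c; first by split => //; exact: ctsC.
apply/is_CkSP; split; first exact: ctsC.
by exists (fun _ _ => 0) => i; split => // x; exact: is_derive_cst.
Qed.

Lemma is_derive_coord i j x :
  is_derive x (e_ i) (fun y => y j 0) ((j == i)%:R : R).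
Proof.
apply/is_derive_line0E.
have -> : (fun s : R => (x + s *: e_ i) j 0) = (fun s => x j 0 + s * (j == i)%:R).
  by apply/funext => s; rewrite !mxE eqxx andbT.
exact: is_derive_affine.
Qed.

Lemma is_Ck_coord k j : is_Ck k (fun x => x j 0).
Proof.
case: k => [|k]; first by split => //; exact: continuous_coord.
apply/is_CkSP; split; first exact: continuous_coord.
exists (fun i _ => (j == i)%:R) => i; split; last exact: is_Ck_cst.
exact: is_derive_coord.
Qed.

Lemma is_CkDr k f g : is_Ck k f -> is_Ck k g -> is_Ck k (fun x => f x + g x).
Proof.
elim: k f g => [|k ih] f g; first by case=> cf _ [cg _]; split => //; exact: ctsD.
move=> /is_CkSP[cf [f_ h]] /is_CkSP[cg [g_ h']]; apply/is_CkSP.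
split; first exact: ctsD.
exists (fun i x => f_ i x + g_ i x) => i.
have [h1 h2] := h i; have [h3 h4] := h' i; split; last exact: ih.
by move=> x; exact: is_deriveD.
Qed.

Lemma is_CkM k f g : is_Ck k f -> is_Ck k g -> is_Ck k (fun x => f x * g x).
Proof.
elim: k f g => [|k ih] f g; first by case=> cf _ [cg _]; split => //; exact: ctsM.
move=> Cf Cg; move: (Cf) (Cg).
move=> /is_CkSP[cf [f_ h]] /is_CkSP[cg [g_ h']]; apply/is_CkSP.
split; first exact: ctsM.
exists (fun i x => f x * g_ i x + g x * f_ i x) => i.
have [h1 h2] := h i; have [h3 h4] := h' i; split.
  by move=> x; exact: is_deriveM.
by apply: is_CkDr; apply: ih => //; exact: is_Ck_le (leqnSn _) _.
Qed.

Lemma is_CkZ k c f : is_Ck k f -> is_Ck k (fun x => c * f x).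
Proof. by apply: is_CkM; exact: is_Ck_cst. Qed.

Lemma is_CkB k f g : is_Ck k f -> is_Ck k g -> is_Ck k (fun x => f x - g x).
Proof.
move=> Cf Cg; have := is_CkDr Cf (is_CkZ (-1) Cg).
by under eq_fun do rewrite mulN1r.
Qed.

Lemma is_Ck_sum k (I : Type) (r : seq I) (F : I -> 'cV[R]_n -> R) :
  (forall i, is_Ck k (F i)) -> is_Ck k (fun x => \sum_(i <- r) F i x).
Proof.
move=> CF; elim: r => [|i r ih].
  by under eq_fun do rewrite big_nil; exact: is_Ck_cst.
by under eq_fun do rewrite big_cons; exact: is_CkDr.
Qed.

Lemma hessianE f x i j : hessian f x i j = 'D_(e_ j) ('D_(e_ i) f) x.
Proof. by rewrite mxE. Qed.

(** Applying the mean value theorem twice to the second difference over a square of side h, in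
    either order of the directions, gives h^2 times a mixed derivative at a point near x. The two
    values agree, and continuity transfers this to x. *)
Lemma clairaut f i j x : is_Ck 2 f ->
  'D_(e_ j) ('D_(e_ i) f) x = 'D_(e_ i) ('D_(e_ j) f) x.
Proof.
move=> C2.
have r1 (a b c d : R) : a - b - (c - d) = a - c - (b - d) by ring.
have r2 (a b c : R) : (a - c) - (b - c) = a - b by ring.
have r3 (a b c : R) : a <= b + c -> b < a / 2 -> c < a / 2 -> False by move=> *; lra.
have r4 (a : R) : 0 < a -> 2 * (a / 4) < a by move=> *; lra.
have r5 (a b h : R) : a <= h -> b <= h -> a + b <= 2 * h by move=> *; lra.
have [G GE] : exists G : 'I_n -> 'I_n -> 'cV[R]_n -> R,
    forall a b y, 'D_(e_ b) ('D_(e_ a) f) y = G a b y.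
  by exists (fun a b => 'D_(e_ b) ('D_(e_ a) f)).
have mvt a b h : exists2 y : 'cV[R]_n, `|y - x| <= 2 * `|h| &
    f (x + h *: e_ a + h *: e_ b) - f (x + h *: e_ a) - (f (x + h *: e_ b) - f x) =
    h * (h * G a b y).
  pose phi y := f (y + h *: e_ b) - f y.
  have dphi y : is_derive y (e_ a) phi ('D_(e_ a) f (y + h *: e_ b) - 'D_(e_ a) f y).
    apply: is_deriveB; last exact: is_Ck_derive C2.
    apply/is_derive_line0E.
    have -> : (fun s => f (y + s *: e_ a + h *: e_ b)) =
        (fun s => f ((y + h *: e_ b) + s *: e_ a)).
      by apply/funext => s; rewrite addrAC.
    by apply/is_derive_line0E; exact: is_Ck_derive C2.
  have [t /andP[t0 t1] e1] := MVT_line x h dphi.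
  have dD y : is_derive y (e_ b) ('D_(e_ a) f) (G a b y).
    by rewrite -GE; exact: is_Ck_derive (is_Ck_D a C2).
  have [s /andP[s0 s1] e2] := MVT_line (x + (t * h) *: e_ a) h dD.
  exists (x + (t * h) *: e_ a + (s * h) *: e_ b).
    rewrite -(addrA x) (addrC x) addrK; apply: le_trans (ler_normD _ _) _.
    rewrite !normrZ ?normrM (ger0_norm t0) (ger0_norm s0).
    have b1 k : `|e_ k : 'cV[R]_n| <= 1.
      by apply/normcV_le => // l; rewrite mxE; case: (_ && _); rewrite ?normr1 ?normr0.
    have /= := b1 a; have /= := b1 b.
    have := normr_ge0 h; have := normr_ge0 (e_ a : 'cV[R]_n).
    have := normr_ge0 (e_ b : 'cV[R]_n).
    set A := `|_|; set B := `|e_ a|; set H := `|h| => A0 B0 H0 A1 B1.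
    have q1 : t * H * B <= H by apply: (@le_trans _ _ (H * B)); rewrite -?mulrA ?ler_piMl ?mulr_ge0// ler_piMr.
    have q2 : s * H * A <= H by apply: (@le_trans _ _ (H * A)); rewrite -?mulrA ?ler_piMl ?mulr_ge0// ler_piMr.
    exact: r5.
  by rewrite -e2 -e1 /phi.
rewrite !GE; apply/eqP; rewrite -subr_eq0; apply/eqP.
have cG a b : continuous (G a b).
  have := is_Ck_cts (is_Ck_D b (is_Ck_D a C2)).
  by rewrite (_ : 'D_(e_ b) _ = G a b)//; apply/funext => y; rewrite GE.
apply: contrapT => /eqP d0; have {}d0 : 0 < `|G i j x - G j i x| / 2.
  by rewrite divr_gt0// normr_gt0.
have nearG a b : \forall y \near x, `|G a b x - G a b y| < `|G i j x - G j i x| / 2.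
  by have /cvgrPdist_lt/(_ _ d0) := cG a b x.
have : \forall y \near x, `|G i j x - G i j y| < `|G i j x - G j i x| / 2 /\
  `|G j i x - G j i y| < `|G i j x - G j i x| / 2.
  by apply: filterI; exact: nearG.
move=> /nbhs_normP[e /= e0 he].
pose h := e / 4.
have h0 : 0 < h by rewrite divr_gt0.
have [y1 y1x E1] := mvt i j h; have [y2 y2x E2] := mvt j i h.
have yb (y : 'cV[R]_n) : `|y - x| <= 2 * `|h| -> ball_ Num.norm x e y.
  move=> yx; by rewrite /ball_/= distrC (le_lt_trans yx)// gtr0_norm// r4.
have [hy1 _] := he _ (yb _ y1x); have [_ hy2] := he _ (yb _ y2x).
have Gy : G i j y1 = G j i y2.
  have : h * (h * G i j y1) = h * (h * G j i y2).
    by apply: etrans (esym E1) _; apply: etrans E2; rewrite (addrAC x) r1.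
  by move=> /(mulfI (lt0r_neq0 h0))/(mulfI (lt0r_neq0 h0)).
have : `|G i j x - G j i x| <= `|G i j x - G i j y1| + `|G j i x - G j i y2|.
  by have := ler_normB (G i j x - G i j y1) (G j i x - G j i y2); rewrite {1}Gy r2.
by move/r3; apply; [have [] := he _ (yb _ y1x)|have [] := he _ (yb _ y2x)].
Qed.

Lemma hessian_sym f x : is_Ck 2 f -> (hessian f x)^T = hessian f x.
Proof. by move=> C2; apply/matrixP => i j; rewrite !mxE clairaut. Qed.

Lemma is_derive_comp_grad k f (g : 'cV[R]_n -> 'cV[R]_n) (g' : 'I_n -> R) x (v : 'cV[R]_n) :
  is_Ck k.+1 f ->
  (forall i, is_derive x v (fun y => g y i 0) (g' i)) ->
  is_derive x v (fun y => f (g y)) (\sum_i 'D_(e_ i) f (g x) * g' i).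
Proof.
move=> Cf dg; apply/is_derive_line0E.
have := @is_derive_chain R n f (fun i => 'D_(e_ i) f) (fun s => g (x + s *: v)) g' 0.
rewrite scale0r addr0; apply.
- by move=> i y; exact: is_Ck_derive Cf.
- by move=> i; exact: is_Ck_cts (is_Ck_D i Cf).
- by move=> i; apply/is_derive_line0E; exact: dg.
Qed.

Lemma is_derive_grad k f x (v : 'cV[R]_n) : is_Ck k.+1 f ->
  is_derive x v f (\sum_i 'D_(e_ i) f x * v i 0).
Proof.
move=> Cf; apply: (is_derive_comp_grad (g := id) Cf) => i.
apply/is_derive_line0E.
have -> : (fun s : R => (x + s *: v) i 0) = (fun s => x i 0 + s * v i 0).
  by apply/funext => s; rewrite !mxE.
exact: is_derive_affine.
Qed.

End Ck.

(** * Derivatives of determinants and the Piola identity *)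

Section determinants.
Context {R : realType}.

Lemma cts_det (T : topologicalType) m (M : T -> 'M[R]_m) :
  (forall i j, continuous (fun t => M t i j)) -> continuous (fun t => \det (M t)).
Proof.
move=> cM; apply: continuous_sum => s; apply: ctsM; first exact: ctsC.
exact: continuous_prod.
Qed.

Lemma cts_cofactor (T : topologicalType) m (M : T -> 'M[R]_m) i j :
  (forall i j, continuous (fun t => M t i j)) ->
  continuous (fun t => cofactor (M t) i j).
Proof.
move=> cM; apply: ctsM; first exact: ctsC.
by apply: cts_det => k l; under eq_fun do rewrite !mxE; exact: cM.
Qed.

Lemma det_add_delta m (A : 'M[R]_m) (t : R) i j :
  \det (A + t *: delta_mx i j) = \det A + t * cofactor A i j.
Proof.
rewrite !(expand_det_row _ i).
have cofE k : cofactor (A + t *: delta_mx i j) i k = cofactor A i k.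
  rewrite /cofactor; congr (_ * \det _); apply/matrixP => a b; rewrite !mxE.
  by rewrite eq_sym (negbTE (neq_lift _ _)) mulr0 addr0.
under eq_bigr do rewrite cofE !mxE eqxx mulrDl.
rewrite big_split/=; congr (_ + _); rewrite (bigD1 j)//= eqxx mulr1.
by rewrite big1 ?addr0// => k /negbTE ->; rewrite mulr0 mul0r.
Qed.

(** Jacobi's formula. As a function of the m * m entries the determinant is affine in each entry
    with slope the cofactor ([det_add_delta]), so the chain rule applies. *)
Lemma is_derive_det1 m (M : R -> 'M[R]_m) (M' : 'M[R]_m) (s : R) :
  (forall i j, is_derive s 1 (fun t => M t i j) (M' i j)) ->
  is_derive s 1 (fun t => \det (M t)) (\sum_i \sum_j M' i j * cofactor (M s) i j).
Proof.
move=> dM.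
pose f (y : 'cV[R]_(m * m)) := \det (vec_mx y^T : 'M[R]_m).
pose f_ k (y : 'cV[R]_(m * m)) :=
  mxvec (\matrix_(i, j) cofactor (vec_mx y^T : 'M[R]_m) i j) 0 k.
pose g t : 'cV[R]_(m * m) := (mxvec (M t))^T.
pose g' k := mxvec M' 0 k.
have fgE : (fun t => \det (M t)) = (fun t => f (g t)).
  by apply/funext => t; rewrite /f /g trmxK mxvecK.
have -> : \sum_i \sum_j M' i j * cofactor (M s) i j = \sum_k f_ k (g s) * g' k.
  rewrite [RHS](reindex _ (curry_mxvec_bij m m))/=.
  rewrite pair_bigA/=; apply: eq_bigr => -[i j] _ /=.
  by rewrite /f_ /g' /g !mxvecE mxE trmxK mxvecK mulrC.
rewrite fgE; apply: is_derive_chain => [k y|k|k].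
- case/mxvec_indexP: k => i j; rewrite /f_ mxvecE mxE; apply/is_derive_line0E.
  have -> : (fun t => f (y + t *: basis_vec (mxvec_index i j))) =
      (fun t => f y + t * cofactor (vec_mx y^T : 'M[R]_m) i j).
    apply/funext => t; rewrite /f -det_add_delta linearD linearZ/=.
    by rewrite /basis_vec trmx_delta linearD linearZ/= vec_mx_delta.
  exact: is_derive_affine.
- case/mxvec_indexP: k => i j; rewrite /f_.
  under eq_fun do rewrite mxvecE mxE; apply: cts_cofactor => a b.
  by under eq_fun do rewrite !mxE; exact: continuous_coord.
- case/mxvec_indexP: k => i j; rewrite /g' mxvecE /g.
  by under eq_fun do rewrite mxE mxvecE; exact: dM.
Qed.

Lemma is_derive_det (V : normedModType R) m (M : V -> 'M[R]_m) (M' : 'M[R]_m) (x v : V) :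
  (forall i j, is_derive x v (fun t => M t i j) (M' i j)) ->
  is_derive x v (fun t => \det (M t)) (\sum_i \sum_j M' i j * cofactor (M x) i j).
Proof.
move=> dM; apply/is_derive_line0E.
have := @is_derive_det1 m (fun s => M (x + s *: v)) M' 0.
by rewrite scale0r addr0; apply => i j; apply/is_derive_line0E; exact: dM.
Qed.

Lemma derivable_adj (V : normedModType R) m (M : V -> 'M[R]_m) (M' : 'M[R]_m) (x v : V) :
  (forall i j, is_derive x v (fun t => M t i j) (M' i j)) ->
  forall a b, derivable (fun t => \adj (M t) a b) x v.
Proof.
move=> dM a b; under eq_fun do rewrite mxE /cofactor.
apply: derivableM; first exact: derivable_cst.
apply: (@ex_derive _ _ _ _ _ _ _ (@is_derive_det V m.-1 (fun t => row' b (col' a (M t)))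
   (row' b (col' a M')) x v _)) => i j.
by under eq_fun do rewrite !mxE; rewrite !mxE; exact: dM.
Qed.

Lemma is_derive_bigsum (V : normedModType R) (I : Type) (r : seq I) (F : I -> V -> R)
   (F' : I -> R) (x v : V) :
  (forall i, is_derive x v (F i) (F' i)) ->
  is_derive x v (fun t => \sum_(i <- r) F i t) (\sum_(i <- r) F' i).
Proof.
move=> dF; elim: r => [|i r ih].
  by under eq_fun do rewrite big_nil; rewrite big_nil; exact: is_derive_cst.
by under eq_fun do rewrite big_cons; rewrite big_cons; exact: is_deriveD.
Qed.

(** Differentiate M adj(M) = det(M) 1, then multiply by adj(M) on the left; no invertibility of M is
    involved. *)
Lemma derive_adjE (V : normedModType R) m (M : V -> 'M[R]_m) (M' : 'M[R]_m) (x v : V) :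
  (forall i j, is_derive x v (fun t => M t i j) (M' i j)) ->
  \det (M x) *: (\matrix_(a, b) 'D_v (fun t => \adj (M t) a b) x) =
  (\sum_i \sum_j M' i j * cofactor (M x) i j) *: \adj (M x) -
  \adj (M x) *m M' *m \adj (M x).
Proof.
move=> dM; set D := \matrix_(a, b) _; set tr := \sum_i _.
have dadj := derivable_adj dM.
have key : M' *m \adj (M x) + M x *m D = tr%:M.
  apply/matrixP => i j.
  have d1 : is_derive x v (fun t => (M t *m \adj (M t)) i j)
      ((M' *m \adj (M x) + M x *m D) i j).
    rewrite mxE [(M' *m _) i j]mxE [(M x *m _) i j]mxE -big_split/=.
    under eq_fun do rewrite mxE.
    apply: is_derive_bigsum => k.
    rewrite [D k j]mxE; apply: (is_derive_mul (dM i k)).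
    exact: (derivableP (dadj k j)).
  have d2 : is_derive x v (fun t => (M t *m \adj (M t)) i j) (tr%:M i j).
    under eq_fun do rewrite mul_mx_adj mxE; rewrite mxE.
    case: (i == j); rewrite ?mulr1n ?mulr0n; first exact: is_derive_det.
    exact: is_derive_cst.
  by have [_ <-] := d1; have [_ <-] := d2.
rewrite -mul_scalar_mx -mul_adj_mx -(mulmxA _ (M x)).
have -> : M x *m D = tr%:M - M' *m \adj (M x) by rewrite -key addrAC subrr add0r.
by rewrite mulmxBr scalar_mxC mul_scalar_mx mulmxA.
Qed.

(* Multiplied by the determinant, the divergence of the cofactor matrix is a  *)
(* difference of two sums that agree when the derivatives are fully symmetric; *)
(* the determinant is then removed by perturbing N with a multiple of 1.       *)
Lemma piola_det n (N : 'cV[R]_n -> 'M[R]_n) (u : 'I_n -> 'M[R]_n) (x : 'cV[R]_n) :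
  (forall a k l, is_derive x (basis_vec a) (fun y => N y k l) (u a k l)) ->
  (forall a k l, u a k l = u k a l) -> (forall a k l, u a k l = u a l k) ->
  forall b, \det (N x) * (\sum_a 'D_(basis_vec a) (fun y => \adj (N y) a b) x) = 0.
Proof.
move=> dN u1 u2 b; rewrite mulr_sumr.
have E a : \det (N x) * 'D_(basis_vec a) (fun y => \adj (N y) a b) x =
    \sum_k \sum_l (u a k l * \adj (N x) l k) * \adj (N x) a b -
    \sum_l \sum_k (\adj (N x) a k * u a k l) * \adj (N x) l b.
  have /matrixP/(_ a b) := derive_adjE (dN a).
  rewrite !mxE => ->; congr (_ - _).
    rewrite mulr_suml; apply: eq_bigr => k _; rewrite mulr_suml.
    by apply: eq_bigr => l _; rewrite [\adj _ l k]mxE.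
  by apply: eq_bigr => l _; rewrite mxE mulr_suml.
under eq_bigr do rewrite E; rewrite sumrB; apply/eqP; rewrite subr_eq0; apply/eqP.
under [LHS]eq_bigr do rewrite exchange_big/=.
rewrite [LHS]exchange_big/=; apply: eq_bigr => a _.
apply: eq_bigr => l _; apply: eq_bigr => k _.
by rewrite u1 u2 u1 (mulrC (u _ _ _)).
Qed.

Lemma near0_root_eq0 (p : {poly R}) :
  (\forall t \near (0 : R), p.[t] = 0) -> p = 0.
Proof.
move=> /nbhs_normP[e /= e0 he]; apply/eqP/negP => /negP p0.
pose rs := [seq e / k.+2%:R | k <- iota 0 (size p)].
have := @max_poly_roots _ p rs p0; rewrite size_map size_iota ltnn => H.
suff : false by []; apply: H.
  apply/allP => _ /mapP[k _ ->]; apply/rootP/he.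
  rewrite /ball_/= sub0r normrN gtr0_norm ?divr_gt0//.
  by rewrite ltr_pdivrMr// ltr_pMr// ltr1n.
rewrite map_inj_uniq ?iota_uniq// => k l /(mulfI (lt0r_neq0 e0))/invr_inj/eqP.
by rewrite eqr_nat => /eqP[].
Qed.

(** Let S(t) be the divergence for N + t. If S(0) were nonzero, continuity would keep S(t) nonzero
    near 0, and [piola_det] would force det(N + t) = 0 there. But this is the characteristic
    polynomial of -N, which is monic. *)
Lemma piola n (N : 'cV[R]_n -> 'M[R]_n) (u : 'I_n -> 'M[R]_n) (x : 'cV[R]_n) :
  (forall a k l, is_derive x (basis_vec a) (fun y => N y k l) (u a k l)) ->
  (forall a k l, u a k l = u k a l) -> (forall a k l, u a k l = u a l k) ->
  forall b, \sum_a 'D_(basis_vec a) (fun y => \adj (N y) a b) x = 0.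
Proof.
move=> dN u1 u2 b.
pose Nt t y := N y + t%:M.
have dNt t a k l : is_derive x (basis_vec a) (fun y => Nt t y k l) (u a k l).
  rewrite /Nt; under eq_fun do rewrite mxE.
  by rewrite -(addr0 (u a k l)); apply: is_deriveD; exact: is_derive_cst.
pose mi a (A : 'M[R]_n) := row' b (col' a A).
have D a t : 'D_(basis_vec a) (fun y => \adj (Nt t y) a b) x =
    (-1) ^+ (b + a) * \sum_i \sum_j mi a (u a) i j * cofactor (mi a (Nt t x)) i j.
  have dm : is_derive x (basis_vec a) (fun y => \det (mi a (Nt t y)))
      (\sum_i \sum_j mi a (u a) i j * cofactor (mi a (Nt t x)) i j).
    apply: (@is_derive_det _ _ (fun y => mi a (Nt t y))) => i j.
    by rewrite /mi; under eq_fun do rewrite 2!mxE; rewrite !mxE; exact: dNt.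
  under eq_fun do rewrite mxE /cofactor.
  have := is_derive_mul (is_derive_cst ((-1) ^+ (b + a) : R) x (basis_vec a)) dm.
  by rewrite mul0r add0r => -[_ <-].
pose S t := \sum_a 'D_(basis_vec a) (fun y => \adj (Nt t y) a b) x.
have cS : continuous S.
  rewrite /S; under eq_fun do under eq_bigr do rewrite D.
  apply: continuous_sum => a; apply: ctsM; first exact: ctsC.
  apply: continuous_sum => i; apply: continuous_sum => j.
  apply: ctsM; first exact: ctsC.
  apply: cts_cofactor => k l; rewrite /mi /Nt.
  under eq_fun do rewrite !mxE; apply: ctsD; first exact: ctsC.
  by case: (_ == _); [under eq_fun do rewrite mulr1n; exact: cts_id|exact: ctsC].
have S0 : S 0 = 0.
  apply: contrapT => /eqP SN0.
  have : \forall t \near (0 : R), S t != 0.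
    by have /cvgr_neq0 := cS 0; apply.
  move=> nS; have : char_poly (- N x) = 0.
    apply: near0_root_eq0; apply: filterS nS => t St0.
    have := piola_det (dNt t) u1 u2 b; rewrite -/(S t) => /eqP.
    rewrite mulf_eq0 (negbTE St0) orbF => /eqP <-.
    rewrite /char_poly -horner_evalE -det_map_mx; congr (\det _).
    apply/matrixP => i j; rewrite !mxE.
    rewrite [LHS](_ : _ = ('X *+ (i == j) - (- N x i j)%:P).[t])//.
    rewrite hornerD hornerN hornerMn.
    by rewrite hornerX hornerC opprK addrC.
  by apply/eqP; rewrite monic_neq0// char_poly_monic.
transitivity (S 0); last exact: S0.
apply: eq_bigr => a _.
have -> : (fun y => \adj (N y) a b) = (fun y => \adj (Nt 0 y) a b); last by [].
by apply/funext => y; rewrite /Nt raddf0 addr0.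
Qed.

End determinants.

(** * Dyadic cubes and comparison of outer measures *)

Section dyadic_cubes.
Context {R : realType} {n : nat}.
Local Notation B := (borelR R n).
Implicit Types (k l : nat) (z : 'cV[int]_n) (x : 'cV[R]_n).

Definition dcube k z : set B :=
  [set x : 'cV[R]_n | forall i, (z i 0)%:~R <= 2 ^+ k * x i 0 < (z i 0 + 1)%:~R].

Definition dcorner k z : 'cV[R]_n := \col_i ((z i 0)%:~R / 2 ^+ k).

Lemma pow2_gt0 k : 0 < 2 ^+ k :> R. Proof. by rewrite exprn_gt0. Qed.

Lemma dcube_hbox k z :
  dcube k z = hbox (dcorner k z) (dcorner k z + const_mx (2 ^- k)).
Proof.
have p := pow2_gt0 k.
rewrite predeqE => x; split => h i; have := h i; rewrite !mxE.
  rewrite ler_pdivrMr// mulrC => /andP[-> /=].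
  by rewrite intrD -{2}[2 ^- k]mul1r -mulrDl ltr_pdivlMr// mulrC.
rewrite ler_pdivrMr// mulrC => /andP[-> /=].
by rewrite intrD -{2}[2 ^- k]mul1r -mulrDl ltr_pdivlMr// mulrC.
Qed.

Lemma measurable_dcube k z : measurable (dcube k z).
Proof. by rewrite dcube_hbox; exact: measurable_hbox. Qed.

Lemma Leb_dcube k z : Leb n (dcube k z) = ((2 ^- k) ^+ n)%:E.
Proof.
have p := pow2_gt0 k.
rewrite dcube_hbox Leb_hbox => [|i]; last first.
  by rewrite !mxE lerDl invr_ge0 ltW.
congr EFin; rewrite (eq_bigr (fun=> 2 ^- k)) ?prodr_const ?card_ord// => i _.
by rewrite !mxE addrAC subrr add0r.
Qed.

Lemma dcube_cover k x : exists z, dcube k z x.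
Proof.
exists (\col_i Num.floor (2 ^+ k * x i 0)) => i; rewrite mxE.
exact: floor_itv.
Qed.

Lemma dcube_nested k l z z' x : (k <= l)%N ->
  dcube k z x -> dcube l z' x -> dcube l z' `<=` dcube k z.
Proof.
move=> kl kx lx y ly i; have := kx i; have := lx i; have := ly i.
rewrite -(subnK kl); set d := (l - k)%N; rewrite exprD -!mulrA.
set X := 2 ^+ k * x i 0; set Y := 2 ^+ k * y i 0; set D : R := 2 ^+ d.
have D0 : 0 < D by exact: pow2_gt0.
have DE : D = (2 ^+ d : int)%:~R by rewrite rmorphXn.
move=> /andP[y1 y2] /andP[x1 x2] /andP[k1 k2].
have h1 : (2 ^+ d : int) * z i 0 <= z' i 0.
  rewrite -ltzD1 -(ltr_int R) intrM -DE; apply: le_lt_trans x2.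
  by rewrite ler_pM2l.
have h2 : z' i 0 + 1 <= (2 ^+ d : int) * (z i 0 + 1).
  rewrite lezD1 -(ltr_int R) intrM -DE; apply: le_lt_trans x1 _.
  by rewrite ltr_pM2l.
apply/andP; split.
  rewrite -(ler_pM2l D0); apply: le_trans y1; rewrite DE -intrM ler_int//.
rewrite -(ltr_pM2l D0); apply: lt_le_trans y2 _; rewrite DE -intrM ler_int//.
Qed.

Lemma dcube_inj k z z' x : dcube k z x -> dcube k z' x -> z = z'.
Proof.
move=> h h'; apply/colP => i; have /andP[a b] := h i; have /andP[c d] := h' i.
apply/eqP; rewrite eq_le -!ltzD1 -!(ltr_int R).
by rewrite (le_lt_trans a d) (le_lt_trans c b).
Qed.

Lemma dcube_dist k z x y : dcube k z x -> dcube k z y -> `|x - y| <= 2 ^- k.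
Proof.
move=> h h'; have p := pow2_gt0 k.
apply/normcV_le => [|i]; first by rewrite invr_ge0 ltW.
rewrite !mxE -(ler_pM2l p) divff ?gt_eqF//.
rewrite -{1}(gtr0_norm p) -normrM mulrBr ler_norml.
have /andP[a b] := h i; have /andP[c d] := h' i.
move: b d; rewrite intrD; lra.
Qed.

Variables (h : set B -> \bar R) (c : R) (k0 : nat).
Hypothesis h0 : h set0 = 0%E.
Hypothesis hpos : forall A, (0 <= h A)%E.
Hypothesis hsub : forall A : nat -> set B, (h (\bigcup_i A i) <= \sum_(i <oo) h (A i))%E.
Hypothesis hcube : forall k z, (k0 <= k)%N -> (h (dcube k z) <= c%:E * Leb n (dcube k z))%E.

(** S is the disjoint union of the maximal dyadic cubes of generation at least k0 that it contains.
    On this countable family h is subadditive and Lebesgue measure is additive, so the bound on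
    cubes sums up. *)
Lemma dcube_outer_le (S : set B) : measurable S ->
  (forall x, S x -> exists k z, [/\ (k0 <= k)%N, dcube k z x & dcube k z `<=` S]) ->
  (h S <= c%:E * Leb n S)%E.
Proof.
move=> mS Sk.
pose good k z := (k0 <= k)%N /\ dcube k z `<=` S.
pose maximal k z := good k z /\
  forall k' z', (k' < k)%N -> good k' z' -> dcube k z `&` dcube k' z' = set0.
pose D (p : nat * 'cV[int]_n) := if `[< maximal p.1 p.2 >] then dcube p.1 p.2 else set0.
pose F i := if @pickle_inv (nat * 'cV[int]_n)%type i is Some p then D p else set0.
have mF i : measurable (F i).
  rewrite /F; case: pickle_inv => [p|]//; rewrite /D; case: ifP => // _.
  exact: measurable_dcube.
have Dtriv p q x : D p x -> D q x -> p = q.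
  rewrite /D; case: asboolP => // -[[p0 gp] mp] xp; case: asboolP => // -[[q0 gq] mq] xq.
  have [pq|qp|pq] := ltngtP p.1 q.1.
  - by have /seteqP[/(_ x) h1 _] := mq _ _ pq (conj p0 gp); exfalso; apply: h1.
  - by have /seteqP[/(_ x) h1 _] := mp _ _ qp (conj q0 gq); exfalso; apply: h1.
  - move: xq; rewrite -pq => xq; have := dcube_inj xp xq.
    by case: p q pq {p0 gp mp xp q0 gq mq xq} => [a b] [a' b'] /= -> ->.
have Ftriv : trivIset setT F.
  apply/trivIsetP => i j _ _ ij; apply/seteqP; split => // x [].
  rewrite /F; case Ei : (pickle_inv i) => [p|]//; case Ej : (pickle_inv j) => [q|]//.
  move=> xp xq; have pq := Dtriv _ _ _ xp xq; move/eqP : ij; apply.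
  have := @pickle_invK (nat * 'cV[int]_n)%type i; rewrite Ei /= => <-.
  have := @pickle_invK (nat * 'cV[int]_n)%type j; rewrite Ej /= => <-.
  by rewrite pq.
have SF : S = \bigcup_i F i.
  rewrite predeqE => x; split => [Sx|[i _]]; last first.
    rewrite /F; case: pickle_inv => [p|]//; rewrite /D; case: asboolP => // -[[_ +] _].
    exact.
  (* The coarsest good cube around x is maximal: a coarser good cube meeting it would contain it,
     hence contain x. *)
  have ex : exists k, `[< exists z, good k z /\ dcube k z x >].
    by have [k [z [a b d]]] := Sk x Sx; exists k; apply/asboolP; exists z.
  have [k /asboolP[z [gkz xz]] kmin] := ex_minnP ex.
  exists (pickle (k, z)) => //; rewrite /F pickleK_inv /D/=; case: asboolP => //.
  move=> H; exfalso; apply: H; split => // k' z' k'k g'.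
  apply/seteqP; split => // y [yk yk'].
  have : (k <= k')%N.
    apply: kmin; apply/asboolP; exists z'; split => //.
    exact: (dcube_nested (ltnW k'k) yk' yk).
  by rewrite leqNgt k'k.
rewrite {1}SF; apply: le_trans (hsub F) _.
rewrite SF measure_bigcup//.
rewrite [X in (_ <= _ * X)%E](eq_eseriesl (Q := xpredT)); last by move=> i; rewrite in_setT.
rewrite -nneseriesZl//.
apply: lee_nneseries => i; first by move=> _ _; exact: hpos.
move=> _; rewrite /F; case: pickle_inv => [p|]; last by rewrite h0 measure0 mule0.
rewrite /D; case: asboolP => [[[a _] _]|_]; first exact: hcube.
by rewrite h0 measure0 mule0.
Qed.

End dyadic_cubes.

(** * Hausdorff outer measure *)

Lemma nneseries_finite (R : realType) (u : nat -> \bar R) N :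
  (forall k, (0 <= u k)%E) -> (forall k, (N <= k)%N -> u k = 0%E) ->
  (\sum_(k <oo) u k = \sum_(0 <= k < N) u k)%E.
Proof.
by move=> u0 uN; rewrite (nneseries_split _ N)// add0n eseries0 ?adde0// => k /uN.
Qed.

Section hausdorff_measure.
Context {R : realType} {n : nat}.
Hypothesis n0 : (0 < n)%N.
Local Notation B := (borelR R n).
Implicit Types (A U : set 'cV[R]_n) (d : R).
Local Open Scope ereal_scope.

Lemma ediam_ub U x y : U x -> U y -> (enorm (x - y))%:E <= ediam U.
Proof. by move=> Ux Uy; apply: ereal_sup_ubound; right; exists x, y. Qed.

Lemma ediam_ge0 U : 0 <= ediam U.
Proof. by apply: ereal_sup_ubound; left. Qed.

Lemma ediam_le U d : (0 <= d)%R ->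
  (forall x y, U x -> U y -> (enorm (x - y) <= d)%R) -> ediam U <= d%:E.
Proof.
move=> d0 h; apply: ge_ereal_sup => _ [->|[x [y [Ux Uy ->]]]].
  by rewrite lee_fin.
by rewrite lee_fin; exact: h.
Qed.

Lemma ediam_set0 : ediam (set0 : set 'cV[R]_n) = 0.
Proof. by apply/eqP; rewrite eq_le ediam_ge0 andbT; apply: ediam_le. Qed.

Lemma hausdorff_delta_ge0 d A : 0 <= hausdorff_delta d A.
Proof.
apply: le_ereal_inf_tmp => _ [U [_ _ ->]]; apply: nneseries_ge0 => k _ _.
by apply: expe_ge0; exact: ediam_ge0.
Qed.

Lemma hausdorff_delta_mono d A A' : A `<=` A' ->
  hausdorff_delta d A <= hausdorff_delta d A'.
Proof.
move=> AA'; apply: le_ereal_inf => _ [U [h1 h2 ->]]; exists U; split => //.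
exact: subset_trans h1.
Qed.

Lemma hausdorff_delta_le_diam d A : ediam A <= d%:E ->
  hausdorff_delta d A <= ediam A ^+ n.
Proof.
move=> Ad; apply: ereal_inf_lbound.
exists (fun k : nat => if k == 0%N then A else set0); split.
- by move=> x Ax; exists 0%N.
- by case=> [//|k]; rewrite ediam_set0; apply: le_trans Ad; exact: ediam_ge0.
- rewrite (@nneseries_finite _ _ 1) ?big_nat1// => k; first exact/expe_ge0/ediam_ge0.
  by case: k => // k _; rewrite ediam_set0; apply/eqP; rewrite expe_eq0 n0 eqxx.
Qed.

Lemma hausdorff_delta_set0 d : (0 <= d)%R ->
  hausdorff_delta d (set0 : set 'cV[R]_n) = 0.
Proof.
move=> d0; apply/eqP; rewrite eq_le hausdorff_delta_ge0 andbT.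
apply: le_trans (hausdorff_delta_le_diam _) _; rewrite ediam_set0 ?lee_fin//.
by rewrite le_eqVlt expe_eq0 n0 eqxx.
Qed.

(** Choose a cover of the i-th set within e / 2^(i+1) of its infimum and enumerate all these covers
    by a bijection of nat with pairs. *)
Lemma hausdorff_delta_bigcup d (F : nat -> set 'cV[R]_n) :
  hausdorff_delta d (\bigcup_i F i) <= \sum_(i <oo) hausdorff_delta d (F i).
Proof.
have [[i ioo]|] := pselect (exists i, hausdorff_delta d (F i) = +oo).
  rewrite (eseries_pinfty _ _ ioo) ?leey// => k _.
  by rewrite -ltNye (lt_le_trans _ (hausdorff_delta_ge0 _ _)).
rewrite -forallNE => Foo; apply/lee_addgt0Pr => e e0.
apply: le_trans (epsilon_trick _ (fun i => hausdorff_delta_ge0 d (F i)) (ltW e0)).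
have /choice[G GP] i : exists U : nat -> set 'cV[R]_n,
    [/\ F i `<=` \bigcup_k U k, forall k, ediam (U k) <= d%:E &
    \sum_(k <oo) ediam (U k) ^+ n <=
      hausdorff_delta d (F i) + (e / (2 ^ i.+1)%:R)%:E].
  have e'0 : (0 < e / (2 ^ i.+1)%:R)%R by rewrite divr_gt0.
  have hfin : hausdorff_delta d (F i) \is a fin_num.
    by rewrite ge0_fin_numE ?hausdorff_delta_ge0// ltey; apply/eqP/Foo.
  have [_ [U [h1 h2 ->]] h3] := lb_ereal_inf_adherent e'0 hfin.
  by exists U; split => //; exact: ltW.
have a0 i j : 0 <= ediam (G i j) ^+ n by apply: expe_ge0; exact: ediam_ge0.
apply: (@le_trans _ _ (\sum_(i <oo) \sum_(k <oo) ediam (G i k) ^+ n)); last first.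
  apply: lee_nneseries => i; first by move=> _ _; apply: nneseries_ge0.
  by move=> _; have [] := GP i.
have /card_esym/ppcard_eqP[f] := card_nat2.
apply: ereal_inf_lbound; exists (fun k => G (f k).1 (f k).2); split.
- move=> x [i _ Fix]; have [/(_ x Fix)[k _ Gx] _ _] := GP i.
  by exists (f^-1%FUN (i, k)) => //=; rewrite invK ?inE.
- by move=> k; have [] := GP (f k).1.
- rewrite nneseries_esumT; last by move=> i; exact: nneseries_ge0.
  under eq_esum => i _ do rewrite nneseries_esumT//.
  rewrite esum_esum// nneseries_esumT//.
  rewrite (_ : [set: nat] `*`` (fun=> [set: nat]) = [set: nat * nat]); last first.
    by rewrite predeqE => -[].
  by rewrite (@reindex_esum _ _ _ setT setT f).
Qed.

Lemma hausdorff_delta_le_pre d A : (0 < d)%R -> hausdorff_delta d A <= hausdorff_pre A.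
Proof. by move=> d0; apply: ereal_sup_ubound; exists d. Qed.

Lemma hausdorff_pre_ge0 A : 0 <= hausdorff_pre A.
Proof.
exact: le_trans (hausdorff_delta_ge0 1 A) (hausdorff_delta_le_pre A ltr01).
Qed.

Lemma hausdorff_pre_mono A A' : A `<=` A' -> hausdorff_pre A <= hausdorff_pre A'.
Proof.
move=> AA'; apply: ge_ereal_sup => _ [d /= d0 <-].
exact: le_trans (hausdorff_delta_mono d AA') (hausdorff_delta_le_pre _ d0).
Qed.

Lemma hausdorff_pre_set0 : hausdorff_pre (set0 : set 'cV[R]_n) = 0.
Proof.
apply/eqP; rewrite eq_le hausdorff_pre_ge0 andbT.
by apply: ge_ereal_sup => _ [d /= d0 <-]; rewrite hausdorff_delta_set0// ltW.
Qed.

Lemma hausdorff_pre_bigcup (F : nat -> set 'cV[R]_n) :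
  hausdorff_pre (\bigcup_i F i) <= \sum_(i <oo) hausdorff_pre (F i).
Proof.
apply: ge_ereal_sup => _ [d /= d0 <-]; apply: le_trans (hausdorff_delta_bigcup d F) _.
apply: lee_nneseries => i; first by move=> _ _; exact: hausdorff_delta_ge0.
by move=> _; exact: hausdorff_delta_le_pre.
Qed.

Lemma hausdorff_pre_setU A A' :
  hausdorff_pre (A `|` A') <= hausdorff_pre A + hausdorff_pre A'.
Proof.
have -> : A `|` A' = \bigcup_i (fun i => nth set0 [:: A; A'] i) i.
  rewrite predeqE => x; split => [[Ax|Ax]|[[|[|k]] _ /=]];
    [by exists 0%N|by exists 1%N|by left|by right|by rewrite nth_nil].
apply: le_trans (hausdorff_pre_bigcup _) _.
rewrite (@nneseries_finite _ _ 2) => [|k|[|[|k]]]//.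
- by rewrite big_nat_recl// big_nat1.
- exact: hausdorff_pre_ge0.
- by move=> _ /=; rewrite nth_nil hausdorff_pre_set0.
Qed.

Lemma ediam_affine U s d (t : 'cV[R]_n) : (0 < s)%R -> ediam U <= d%:E ->
  ediam ((fun x => s *: x + t)%R @` U) <= s%:E * ediam U.
Proof.
move=> s0 Ud; have Ufin : ediam U \is a fin_num.
  by rewrite ge0_fin_numE ?ediam_ge0// (le_lt_trans Ud) ?ltry.
rewrite -(fineK Ufin) -EFinM; apply: ediam_le.
  by rewrite mulr_ge0 ?(ltW s0)// fine_ge0// ediam_ge0.
move=> _ _ [x Ux <-] [y Uy <-].
rewrite (_ : (s *: x + t - (s *: y + t) = s *: (x - y))%R); last first.
  by rewrite scalerBr opprD addrACA subrr addr0.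
rewrite enormZ gtr0_norm// ler_pM2l// -lee_fin fineK//; exact: ediam_ub.
Qed.

(** Covers are transported by the map; a cover of mesh d / s becomes one of mesh d, and each
    diameter is multiplied by at most s. *)
Lemma hausdorff_pre_affine A s (t : 'cV[R]_n) : (0 < s)%R ->
  hausdorff_pre ((fun x => s *: x + t)%R @` A) <= (s ^+ n)%:E * hausdorff_pre A.
Proof.
move=> s0; have sn0 : (0 < s ^+ n)%R by rewrite exprn_gt0.
apply: ge_ereal_sup => _ [d /= d0 <-]; have ds0 : (0 < d / s)%R by rewrite divr_gt0.
apply: (@le_trans _ _ ((s ^+ n)%:E * hausdorff_delta (d / s) A)); last first.
  by rewrite lee_pmul2l ?fin_numE//; exact: hausdorff_delta_le_pre.
rewrite -lee_pdivrMl//; apply: le_ereal_inf_tmp => _ [U [h1 h2 ->]].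
rewrite lee_pdivrMl//.
have aU k := ediam_affine t s0 (h2 k).
apply: (@le_trans _ _ (\sum_(k <oo) ediam ((fun x => s *: x + t)%R @` U k) ^+ n)).
  apply: ereal_inf_lbound; exists (fun k => (fun x => s *: x + t)%R @` U k); split => //.
  - by move=> _ [x Ax <-]; have [k _ Ux] := h1 x Ax; exists k => //; exists x.
  - move=> k; apply: le_trans (aU k) _; rewrite -lee_pdivlMl//.
    by apply: le_trans (h2 k) _; rewrite -EFinM mulrC.
rewrite -nneseriesZl; last by move=> k _; apply: expe_ge0; exact: ediam_ge0.
apply: lee_nneseries => k; first by move=> _ _; apply: expe_ge0; exact: ediam_ge0.
move=> _; have := aU k; have := h2 k.
have := ediam_ge0 (U k); have := ediam_ge0 ((fun x => s *: x + t)%R @` U k).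
case: (ediam (U k)) => [u| |]//; case: (ediam _) => [w| |]//.
rewrite -!EFin_expe -!EFinM !lee_fin => w0 u0 _ wu.
by rewrite -exprMn lerXn2r// nnegrE// mulr_ge0// ltW.
Qed.

End hausdorff_measure.

(** * Hausdorff measure equals Lebesgue measure on compact sets *)

Section hausdorff_lebesgue.
Context {R : realType} {n : nat}.
Hypothesis n0 : (0 < n)%N.
Local Notation B := (borelR R n).
Implicit Types (A U : set 'cV[R]_n) (d : R).

Lemma exists_pow2_lt (e : R) : 0 < e -> exists k, forall l, (k <= l)%N -> 2 ^- l < e.
Proof.
move=> e0; exists (Num.bound e^-1) => l kl.
have p : 0 < 2 ^+ l :> R by rewrite exprn_gt0.
rewrite -[e]invrK ltf_pV2 ?posrE ?invr_gt0//.
have : e^-1 < (Num.bound e^-1)%:R by rewrite archi_boundP// invr_ge0 ltW.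
move/lt_le_trans; apply; rewrite -natrX ler_nat (leq_trans kl)//.
by rewrite ltnW// ltn_expl.
Qed.

Lemma open_dcube (O : set 'cV[R]_n) (k0 : nat) : open O -> forall x, O x ->
  exists k z, [/\ (k0 <= k)%N, dcube k z x & dcube k z `<=` O].
Proof.
move=> oO x Ox; have /nbhs_normP[e /= e0 he] := open_nbhs_nbhs (conj oO Ox).
have [k hk] := exists_pow2_lt e0.
have [z xz] := dcube_cover (maxn k0 k) x.
exists (maxn k0 k), z; split => //; first exact: leq_maxl.
move=> y yz; apply: he; rewrite /ball_/=.
by apply: le_lt_trans (dcube_dist xz yz) _; apply: hk; exact: leq_maxr.
Qed.

Definition ibox (a b : int) : set B := hbox (const_mx a%:~R) (const_mx b%:~R).

Lemma dcube0_ibox a b z x : ibox a b x -> dcube 0 z x -> dcube 0 z `<=` ibox a b.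
Proof.
move=> xab xz y yz i; have := xab i; have := xz i; have := yz i.
rewrite !mxE expr0 !mul1r => /andP[y1 y2] /andP[x1 x2] /andP[b1 b2].
have h1 : a <= z i 0 by rewrite -ltzD1 -(ltr_int R) (le_lt_trans b1 x2).
have h2 : z i 0 + 1 <= b by rewrite lezD1 -(ltr_int R) (le_lt_trans x1 b2).
rewrite (le_trans _ y1) ?ler_int// (lt_le_trans y2)// ler_int//.
Qed.

Lemma ibox_dcube a b (k : nat) x : ibox a b x ->
  exists z, dcube k z x /\ dcube k z `<=` ibox a b.
Proof.
move=> xab; have [z0 xz0] := dcube_cover 0 x; have [z xz] := dcube_cover k x.
exists z; split => //; apply: subset_trans (dcube0_ibox xab xz0).
exact: dcube_nested xz0 xz.
Qed.

Lemma Leb_ibox a b : a <= b -> Leb n (ibox a b) = ((b - a)%:~R ^+ n)%:E.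
Proof.
move=> ab; rewrite Leb_hbox => [|i]; last by rewrite !mxE ler_int.
congr EFin; rewrite (eq_bigr (fun=> (b - a)%:~R)) ?prodr_const ?card_ord// => i _.
by rewrite !mxE rmorphB.
Qed.

Local Notation hp := (@hausdorff_pre R n).
Local Notation Q1 := (@unit_cube R n).

(** A cube of side 2^-k has Euclidean diameter at most n 2^-k; this crude constant serves only to
    prove finiteness on the unit cube. *)
Lemma hausdorff_delta_dcube d : 0 < d -> exists k0, forall k z, (k0 <= k)%N ->
  (hausdorff_delta d (dcube k z) <= (n%:R ^+ n)%:E * Leb n (dcube k z))%E.
Proof.
move=> d0; have nR0 : (0 : R) < n%:R by rewrite ltr0n.
have [k0 hk0] := exists_pow2_lt (divr_gt0 d0 nR0).
exists k0 => k z kk.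
have p : 0 <= 2 ^- k :> R by rewrite invr_ge0 exprn_ge0.
have dz : (ediam (dcube k z : set 'cV[R]_n) <= (n%:R * 2 ^- k)%:E)%E.
  apply: ediam_le; first by rewrite mulr_ge0.
  move=> x y xz yz; apply: le_trans (enorm_le_norm _) _.
  by rewrite ler_wpM2l// (dcube_dist xz yz).
apply: le_trans (hausdorff_delta_le_diam n0 _) _.
  apply: le_trans dz _; rewrite lee_fin mulrC -ler_pdivlMr//.
  exact/ltW/hk0.
rewrite Leb_dcube -EFinM -exprMn EFin_expe.
have := ediam_ge0 (dcube k z : set 'cV[R]_n); move: dz.
case: (ediam _) => [u| |]//; rewrite lee_fin => uz u0.
by rewrite -!EFin_expe lee_fin lerXn2r// nnegrE mulr_ge0.
Qed.

Lemma unit_cube_sub_ibox : Q1 `<=` ibox 0 2.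
Proof. by move=> x h i; have /andP[h1 h2] := h i; rewrite !mxE h1 (le_lt_trans h2)// ltr1n. Qed.

Lemma hausdorff_pre_unit_fin : (hp Q1 < +oo)%E.
Proof.
apply: (@le_lt_trans _ _ ((n%:R ^+ n)%:E * Leb n (ibox 0 2))%E); last first.
  by rewrite Leb_ibox// -EFinM ltry.
apply: ge_ereal_sup => _ [d /= d0 <-].
apply: le_trans (hausdorff_delta_mono d unit_cube_sub_ibox) _.
have [k0 hk0] := hausdorff_delta_dcube d0.
apply: (@dcube_outer_le R n (hausdorff_delta d : set B -> \bar R) (n%:R ^+ n) k0).
- exact: (hausdorff_delta_set0 n0 (ltW d0)).
- exact: hausdorff_delta_ge0.
- exact: hausdorff_delta_bigcup.
- exact: hk0.
- exact: measurable_hbox.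
- by move=> x /(ibox_dcube k0)[z [h1 h2]]; exists k0, z.
Qed.

Lemma Leb_cball d : 0 <= d -> (Leb n (@cball R n d) <= ((3 * d) ^+ n)%:E)%E.
Proof.
move=> d0; have sub (e : R) : 0 < e ->
    (Leb n (@cball R n d) <= ((2 * d + e) ^+ n)%:E)%E.
  move=> e0; have -> : ((2 * d + e) ^+ n)%:E =
      Leb n (hbox (const_mx (- d)) (const_mx (d + e))).
    rewrite Leb_hbox => [|i]; last by rewrite !mxE; lra.
    congr EFin; rewrite (eq_bigr (fun=> 2 * d + e)) ?prodr_const ?card_ord// => i _.
    by rewrite !mxE; ring.
  apply: le_measure; rewrite ?inE; [exact: measurable_ball_cV|exact: measurable_hbox|].
  move=> y /= yd i; rewrite !mxE; have := le_trans (coord_le_norm y i) yd.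
  by rewrite ler_norml => /andP[a b]; apply/andP; split; lra.
move: d0; rewrite le_eqVlt => /orP[/eqP d0|d0].
  rewrite -d0 mulr0 expr0n gtn_eqF//; apply/lee_addgt0Pr => e e0; rewrite add0e.
  have m0 : 0 < Num.min 1 e by rewrite lt_min ltr01 e0.
  rewrite d0; apply: le_trans (sub _ m0) _; rewrite -d0 mulr0 add0r lee_fin.
  rewrite -(prednK n0) exprS.
  apply: (@le_trans _ _ (Num.min 1 e)); last by rewrite ge_min lexx orbT.
  apply: ler_piMr; first exact: ltW.
  by apply: exprn_ile1; [exact: ltW|rewrite ge_min lexx].
by have := sub d d0; rewrite (_ : 2 * d + d = 3 * d)//; ring.
Qed.

(** A set of diameter d lies in a max-norm ball of radius d, of volume at most (3 d)^n. So in any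
    cover of the unit cube the sum of the d^n is at least 3^-n. *)
Lemma hausdorff_pre_unit_gt0 : (0 < hp Q1)%E.
Proof.
have c0 : 0 < (3 ^+ n)^-1 :> R by rewrite invr_gt0 exprn_gt0.
apply: (@lt_le_trans _ _ ((3 ^+ n)^-1)%:E); first by rewrite lte_fin.
apply: le_trans (hausdorff_delta_le_pre Q1 ltr01).
apply: le_ereal_inf_tmp => _ [U [h1 h2 ->]].
rewrite -[leLHS]mule1 lee_pdivrMl ?exprn_gt0//.
have e0 k := ediam_ge0 (U k).
have efin k : ediam (U k) \is a fin_num.
  by rewrite ge0_fin_numE// (le_lt_trans (h2 k)) ?ltry.
pose dd k := fine (ediam (U k)).
have dd0 k : 0 <= dd k by exact: fine_ge0.
have /choice[V hV] k : exists V : set B, [/\ measurable V, U k `<=` V &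
    (Leb n V <= ((3 * dd k) ^+ n)%:E)%E].
  have [U0|/set0P[x Ux]] := eqVneq (U k) set0.
    by exists set0; split => //; rewrite ?U0// measure0 lee_fin exprn_ge0// mulr_ge0.
  have mt := measurable_translate (- x).
  exists ((fun y : B => (y : 'cV[R]_n) - x : B) @^-1` @cball R n (dd k)); split.
  - by rewrite -[X in measurable X]setTI; apply: mt => //; exact: measurable_ball_cV.
  - move=> y Uy; rewrite /cball/=; apply: le_trans (norm_le_enorm _) _.
    by rewrite -lee_fin fineK//; exact: ediam_ub.
  - by rewrite Leb_translate; [exact: Leb_cball|exact: measurable_ball_cV].
have -> : 1%E = Leb n (ibox 0 1).
  by rewrite Leb_ibox// subr0 expr1n.
apply: (@le_trans _ _ (\sum_(k <oo) Leb n (V k))%E).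
  apply: measure_sigma_subadditive => [k||].
  - by have [] := hV k.
  - exact: measurable_hbox.
  - move=> x xi; have [|k _ Ux] := h1 x.
      by move=> i; have := xi i; rewrite !mxE => /andP[-> /ltW ->].
    by exists k => //; have [_ + _] := hV k; exact.
rewrite -nneseriesZl; last by move=> k _; exact: expe_ge0.
apply: lee_nneseries => k; first by move=> _ _; exact: measure_ge0.
move=> _; have [_ _ le] := hV k; apply: le_trans le _.
by rewrite -[in leRHS](fineK (efin k)) -EFin_expe -EFinM -exprMn.
Qed.

(** The ratio between the unnormalised Hausdorff measure and Lebesgue measure; [hausdorff] divides
    by it. *)
Definition kappa : R := fine (hp Q1).

Lemma kappaE : kappa%:E = hp Q1.
Proof. by rewrite fineK// ge0_fin_numE ?hausdorff_pre_unit_fin ?hausdorff_pre_ge0. Qed.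

Lemma kappa_gt0 : 0 < kappa.
Proof. by rewrite -lte_fin kappaE; exact: hausdorff_pre_unit_gt0. Qed.

Lemma hausdorff_pre_dcube k z : (hp (dcube k z) <= kappa%:E * Leb n (dcube k z))%E.
Proof.
have p : 0 < 2 ^- k :> R by rewrite invr_gt0 exprn_gt0.
apply: (@le_trans _ _ (hp ((fun x => 2 ^- k *: x + dcorner k z) @` Q1))).
  apply: hausdorff_pre_mono => x; rewrite dcube_hbox => xz.
  exists (2 ^+ k *: (x - dcorner k z)); last first.
    by rewrite scalerA mulVf ?gt_eqF ?exprn_gt0// scale1r subrK.
  move=> i; have := xz i; rewrite !mxE => /andP[a b].
  rewrite mulr_ge0 ?subr_ge0 ?exprn_ge0//=.
  by rewrite mulrC -ler_pdivlMr ?exprn_gt0// mul1r lerBlDr addrC ltW.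
apply: le_trans (hausdorff_pre_affine Q1 (dcorner k z) p) _.
by rewrite Leb_dcube -kappaE muleC.
Qed.

Lemma hausdorff_pre_le (S : set B) : measurable S ->
  (forall x, S x -> exists k z, [/\ (0 <= k)%N, dcube k z x & dcube k z `<=` S]) ->
  (hp S <= kappa%:E * Leb n S)%E.
Proof.
apply: (@dcube_outer_le R n (hp : set B -> \bar R) kappa 0).
- exact: hausdorff_pre_set0.
- exact: hausdorff_pre_ge0.
- exact: hausdorff_pre_bigcup.
- by move=> k z _; exact: hausdorff_pre_dcube.
Qed.

(** Dilating the half-open cube by 1 + e covers the closed cube, so kappa is at most (1 + e)^n times
    its measure; let e tend to 0. *)
Lemma kappa_le_half_open : (kappa%:E <= hp (ibox 0 1))%E.
Proof.
have hfin : hp (ibox 0 1) \is a fin_num.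
  rewrite ge0_fin_numE ?hausdorff_pre_ge0//.
  apply: le_lt_trans hausdorff_pre_unit_fin; apply: hausdorff_pre_mono => x xi i.
  by have := xi i; rewrite !mxE => /andP[-> /ltW ->].
rewrite -(fineK hfin) lee_fin; set h := fine _.
rewrite leNgt; apply/negP => hk.
have ch : continuous (fun e : R => (1 + e) ^+ n * h).
  by apply: ctsM; [apply: ctsX; apply: ctsD; [exact: ctsC|exact: cts_id]|exact: ctsC].
have : \forall e \near (0 : R), (1 + e) ^+ n * h < kappa.
  by have /cvgr_lt := ch 0; apply; rewrite addr0 expr1n mul1r.
move=> /nbhs_normP[e /= e0 he].
have e20 : 0 < e / 2 by rewrite divr_gt0.
have : (1 + e / 2) ^+ n * h < kappa.
  by apply: he; rewrite /ball_/= sub0r normrN gtr0_norm// ltr_pdivrMr// ltr_pMr// ltr1n.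
have s0 : 0 < 1 + e / 2 by rewrite addr_gt0.
have := hausdorff_pre_affine (ibox 0 1) 0 s0.
have : (hp Q1 <= hp ((fun x => (1 + e / 2) *: x + 0)%R @` ibox 0 1))%E.
  apply: hausdorff_pre_mono => x xQ; exists ((1 + e / 2)^-1 *: x); last first.
    by rewrite addr0 scalerA divff ?gt_eqF// scale1r.
  move=> i; rewrite !mxE; have /andP[a b] := xQ i.
  apply/andP; split; first by apply: mulr_ge0 => //; rewrite invr_ge0 ltW.
  rewrite mulr1z [X in X < _]mulrC ltr_pdivrMr// mul1r.
  by rewrite (le_lt_trans b)// ltrDl.
move=> /le_trans h1 /h1; rewrite -kappaE -(fineK hfin) -EFinM lee_fin -/h.
by move=> h2 h3; have := le_lt_trans h2 h3; rewrite ltxx.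
Qed.

Lemma hausdorff_pre_ibox_ge (N : nat) : (0 < N)%N ->
  (kappa%:E * Leb n (ibox (- N%:Z) N%:Z) <= hp (ibox (- N%:Z) N%:Z))%E.
Proof.
move=> N0; have N0R : (0 : R) < 2 * N%:R by rewrite mulr_gt0 ?ltr0n.
have s0 : 0 < (2 * N%:R)^-1 :> R by rewrite invr_gt0.
have := hausdorff_pre_affine (ibox (- N%:Z) N%:Z) (const_mx 2^-1) s0.
have : (hp (ibox 0 1) <=
    hp ((fun x => (2 * N%:R)^-1 *: x + const_mx 2^-1)%R @` ibox (- N%:Z) N%:Z))%E.
  apply: hausdorff_pre_mono => x xQ.
  exists ((2 * N%:R) *: (x - const_mx 2^-1)); last first.
    by rewrite scalerA mulVf ?gt_eqF// scale1r subrK.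
  move=> i; have := xQ i; rewrite !mxE => /andP[a b].
  have NR : (0 : R) < N%:R by rewrite ltr0n.
  rewrite rmorphN/= -!pmulrn; apply/andP; split; move: a b; set y := x i 0.
    by rewrite mulr0z => a _; have := mulr_ge0 (ltW NR) a; lra.
  rewrite mulr1z => _ b; have : N%:R * y < N%:R * 1 by rewrite ltr_pM2l.
  by lra.
move=> /le_trans h1 /h1 /(le_trans kappa_le_half_open) h2.
rewrite Leb_ibox; last by rewrite (@le_trans _ _ 0)// oppr_le0.
have -> : (N%:Z - - N%:Z)%:~R = 2 * N%:R :> R.
  by rewrite opprK rmorphD/= -!pmulrn; ring.
by rewrite muleC -lee_pdivlMl ?exprn_gt0// -exprVn.
Qed.

(** The bound holds for the open neighbourhoods [O m], which are unions of dyadic cubes; they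
    decrease to K and have finite measure. *)
Lemma hausdorff_pre_compact_le (K : set 'cV[R]_n) : compact K ->
  (hp K <= kappa%:E * Leb n K)%E.
Proof.
move=> cK; have clK := compact_closed_cV cK.
pose O (m : nat) : set B := \bigcup_(y in K) ball (y : 'cV[R]_n) (m.+1%:R^-1 : R).
have oO m : open (O m : set 'cV[R]_n).
  by apply: bigcup_open => y _; apply: ball_open; rewrite invr_gt0.
have mO m : measurable (O m) by exact: open_measurable_cV.
have KO m : K `<=` O m.
  by move=> x Kx; exists x => //; apply: ballxx; rewrite invr_gt0.
have hO m : (hp K <= kappa%:E * Leb n (O m))%E.
  apply: le_trans (hausdorff_pre_mono (KO m)) _.
  by apply: hausdorff_pre_le => //; exact: open_dcube.
have [M KM] := compact_norm_bounded cK.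
have O0 : (Leb n (O 0%N) < +oo)%E.
  apply: le_lt_trans (Leb_ball_lty n (M + 1)).
  apply: le_measure; rewrite ?inE//; first exact: measurable_ball_cV.
  move=> x [y Ky]; rewrite -ball_normE /= invr1 => xy; rewrite /cball/=.
  rewrite -(subrK y x) (le_trans (ler_normD _ _))// addrC lerD ?KM// ltW//.
  by rewrite distrC.
have capO : \bigcap_m O m = K.
  apply/seteqP; split => [x xO|x Kx m _]; last exact: KO.
  apply: contrapT => nKx.
  have /nbhs_normP[e /= e0 he] := open_nbhs_nbhs (conj (closed_openC clK) nKx).
  have [k hk] := exists_pow2_lt e0.
  have [y Ky] := xO (2 ^ k)%N Logic.I; rewrite -ball_normE /= => yx.
  apply: (he y) => //; rewrite /ball_/= distrC; apply: lt_trans yx _.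
  apply: le_lt_trans (hk k (leqnn k)); rewrite lef_pV2 ?posrE ?exprn_gt0// -natrX ler_nat.
  exact: leqW.
have mK : measurable (\bigcap_m O m) by rewrite capO; exact: closed_measurable_cV.
have niO : nonincreasing_seq O.
  apply/nonincreasing_seqP => m; apply/subsetPset => x [y Ky yx]; exists y => //.
  by apply: le_ball yx; rewrite lef_pV2 ?posrE// ler_nat.
have cvO := nonincreasing_cvg_mu O0 mO mK niO.
rewrite capO in cvO.
have cv2 : (kappa%:E * Leb n (O m))%E @[m --> \oo] --> (kappa%:E * Leb n K)%E.
  exact: cvgeZl.
rewrite -(cvg_lim _ cv2)//; apply: lime_ge; first by apply/cvg_ex; eexists; exact: cv2.
exact: nearW.
Qed.

(** Enclose K in a large box Q. The upper bound holds for K and for Q minus K, the lower bound for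
    Q. Since the Lebesgue measures of the two pieces add up to that of Q, the bound for K must be an
    equality. *)
Lemma hausdorff_compact (K : set 'cV[R]_n) : compact K -> hausdorff K = Leb n K.
Proof.
move=> cK; suff hpK : hp K = (kappa%:E * Leb n K)%E.
  rewrite /hausdorff hpK muleA -EFinM mulVf ?mul1e// gt_eqF//.
  exact: kappa_gt0.
apply/eqP; rewrite eq_le hausdorff_pre_compact_le//=.
have clK := compact_closed_cV cK; have mK := closed_measurable_cV clK.
have [M KM] := compact_norm_bounded cK.
pose N := (Num.bound M).+1; pose Q := ibox (- N%:Z) N%:Z.
have mQ : measurable Q by exact: measurable_hbox.
have KQ : K `<=` Q.
  move=> x Kx i; rewrite !mxE; have := le_trans (coord_le_norm x i) (KM x Kx).
  have M0 : 0 <= M := le_trans (normr_ge0 _) (KM x Kx).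
  have : M < N%:R.
    by rewrite (lt_trans (archi_boundP M0))// ltr_nat.
  rewrite rmorphN/= -!pmulrn => MN; rewrite ler_norml => /andP[a b].
  by apply/andP; split; [apply: le_trans a; rewrite lerN2 ltW|apply: le_lt_trans MN].
have N0 : - N%:Z <= N%:Z by rewrite (@le_trans _ _ 0)// oppr_le0.
have QE := Leb_ibox N0; rewrite -/Q in QE.
have QKle : (hp (Q `\` K) <= kappa%:E * Leb n (Q `\` K))%E.
  apply: hausdorff_pre_le; first exact: measurableD.
  move=> x [Qx nKx].
  have [k [z [_ xz zK]]] := open_dcube 0 (closed_openC clK) nKx.
  have [z' [xz' zQ]] := ibox_dcube k Qx; rewrite -(dcube_inj xz xz') in zQ.
  by exists k, z; split => // y yz; split; [exact: zQ|exact: zK].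
have LQ : Leb n Q = (Leb n K + Leb n (Q `\` K))%E.
  rewrite -measureU//; first by rewrite setDE setUIr setUv setIT (setUidr KQ).
    exact: measurableD.
  by rewrite setDE setIA setIAC setICr set0I.
have := le_trans (hausdorff_pre_ibox_ge (ltn0Sn _ : (0 < N)%N))
  (hausdorff_pre_mono (_ : ibox (- N%:Z) N%:Z `<=` K `|` (Q `\` K))).
rewrite -/Q => /(_ _)/le_trans/(_ (hausdorff_pre_setU n0 _ _)) h.
have {}h : (kappa%:E * Leb n Q <= hp K + kappa%:E * Leb n (Q `\` K))%E.
  apply: le_trans (h _) _; first by move=> x Qx; have [Kx|nKx] := pselect (K x); [left|right].
  exact: leeD2l.
have Qfin : Leb n (Q `\` K) \is a fin_num.
  rewrite ge0_fin_numE ?measure_ge0//; apply: (@le_lt_trans _ _ (Leb n Q)).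
    apply: le_measure; rewrite ?inE//; exact: measurableD.
  by rewrite QE ltry.
move: h; rewrite LQ ge0_muleDr; [|exact: measure_ge0..].
by rewrite leeD2rE// fin_numM.
Qed.

End hausdorff_lebesgue.

(** * Convex functions, gradients and subgradients *)

Section convex.
Context {R : realType} {n : nat}.
Implicit Types (x y z : 'cV[R]_n) (v w f : 'cV[R]_n -> R).
Local Notation e_ i := (basis_vec i).

Lemma is_ConvP v : is_Conv v <-> forall (t : R) x y, 0 <= t <= 1 ->
  v (t *: x + (1 - t) *: y) <= t * v x + (1 - t) * v y.
Proof.
split => [cv t x y /andP[t0 t1]|h t x y _ _].
  by have := cv (Itv01 t0 t1) x y; rewrite !in_setT => /(_ isT isT).
by apply: h; rewrite ge0 le1.
Qed.

Lemma is_ConvD v w : is_Conv v -> is_Conv w -> is_Conv (fun x => v x + w x).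
Proof.
move=> /is_ConvP cv /is_ConvP cw; apply/is_ConvP => t x y t01.
by have := cv t x y t01; have := cw t x y t01; lra.
Qed.

Lemma is_ConvZ (c : R) v : 0 <= c -> is_Conv v -> is_Conv (fun x => c * v x).
Proof.
move=> c0 /is_ConvP cv; apply/is_ConvP => t x y t01.
rewrite mulrCA (mulrCA (1 - t)) -mulrDr ler_wpM2l//; exact: cv.
Qed.

Lemma is_Conv_sqnorm : is_Conv (fun x => dotv x x).
Proof.
apply/is_ConvP => t x y /andP[t0 t1].
have := dotv_ge0 (x - y).
rewrite dotvBl !dotvBr !dotvDl !dotvDr !dotvZl !dotvZr (dotvC y x).
set a := dotv x x; set b := dotv x y; set c := dotv y y => h.
have : 0 <= t * (1 - t) * (a - b - (b - c)) by rewrite mulr_ge0// mulr_ge0// subr_ge0.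
nra.
Qed.

Definition qnorm (e : R) x : R := Num.sqrt (dotv x x + e ^+ 2).

Lemma sqr_qnorm e x : qnorm e x ^+ 2 = dotv x x + e ^+ 2.
Proof. by rewrite sqr_sqrtr// addr_ge0 ?dotv_ge0 ?sqr_ge0. Qed.

Lemma qnorm_ge0 e x : 0 <= qnorm e x.
Proof. exact: sqrtr_ge0. Qed.

Lemma qnorm0 x : qnorm 0 x = enorm x.
Proof. by rewrite /qnorm expr0n/= addr0. Qed.

Lemma is_Conv_qnorm e : is_Conv (qnorm e).
Proof.
apply/is_ConvP => t x y /andP[t0 t1].
have q0 := qnorm_ge0 e x; have q1 := qnorm_ge0 e y.
have s0 : 0 <= 1 - t by rewrite subr_ge0.
rewrite -(ler_pXn2r (n := 2))// ?nnegrE ?qnorm_ge0 ?addr_ge0 ?mulr_ge0//.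
rewrite sqr_qnorm sqrrD !exprMn !sqr_qnorm.
rewrite dotvDl !dotvDr !dotvZl !dotvZr (dotvC y x).
have cs : dotv x y + e ^+ 2 <= qnorm e x * qnorm e y.
  apply: (@le_trans _ _ (enorm x * enorm y + e ^+ 2)).
    by rewrite lerD2r dotv_le_enorm.
  have := enorm_ge0 x; have := enorm_ge0 y => a0 b0.
  rewrite -(ler_pXn2r (n := 2))// ?nnegrE ?mulr_ge0 ?addr_ge0 ?sqr_ge0 ?mulr_ge0//.
  rewrite exprMn !sqr_qnorm -!sqr_enorm.
  have := sqr_ge0 (enorm x - enorm y); have := sqr_ge0 e.
  set a := enorm x; set b := enorm y; set c := e ^+ 2 => c0 h.
  have : 0 <= c * (a - b) ^+ 2 by rewrite mulr_ge0.
  lra.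
have : 0 <= (t * (1 - t)) * (qnorm e x * qnorm e y - (dotv x y + e ^+ 2)).
  by rewrite mulr_ge0 ?subr_ge0// mulr_ge0.
rewrite -[t * qnorm e x * _]mulrA [qnorm e x * (_ * _)]mulrCA.
lra.
Qed.

Lemma is_Conv_enorm : is_Conv (@enorm R n).
Proof.
have := is_Conv_qnorm 0; rewrite (_ : qnorm 0 = enorm)//.
by apply/funext => x; exact: qnorm0.
Qed.

(** On a cube a convex function is at most the largest vertex value, here replaced by the sum of the
    absolute values. The induction is on the number of coordinates not yet at an endpoint. *)
Lemma convex_cube_bound f (a : 'cV[R]_n) : is_Conv f ->
  exists M, forall x, `|x - a| <= 1 -> f x <= M.
Proof.
move=> /is_ConvP cf.
pose vtx (s : {ffun 'I_n -> bool}) : 'cV[R]_n :=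
  \col_i (a i 0 + (if s i then 1 else -1)).
pose M := \sum_(s : {ffun 'I_n -> bool}) `|f (vtx s)|.
exists M; suff H (k : nat) x : `|x - a| <= 1 ->
    (forall i : 'I_n, (k <= i)%N -> x i 0 = a i 0 + 1 \/ x i 0 = a i 0 - 1) -> f x <= M.
  move=> x xa; apply: (H n) => // i; by rewrite leqNgt ltn_ord.
elim: k x => [|k ih] x xa xk.
  pose s := [ffun i => x i 0 == a i 0 + 1].
  have -> : x = vtx s.
    apply/colP => i; rewrite mxE ffunE; case: eqP => // h.
    by have [] := xk i (leq0n i).
  by rewrite /M (bigD1 s)//= (le_trans (ler_norm _))// lerDl sumr_ge0.
have [kn|nk] := ltnP k n; last first.
  by apply: ih => // i ki; apply: xk; have := leq_trans nk ki; rewrite leqNgt ltn_ord.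
pose i0 := Ordinal kn.
pose p (c : R) : 'cV[R]_n := \col_i (if i == i0 then a i 0 + c else x i 0).
have hp c : `|c| <= 1 -> `|p c - a| <= 1.
  move=> c1; apply/normcV_le => // i; rewrite !mxE; case: eqP => _.
    by rewrite addrC addKr.
  by have /(normcV_le _ ler01) := xa => /(_ i); rewrite !mxE.
have hpk (c : R) : c = 1 \/ c = -1 -> f (p c) <= M.
  move=> hc; apply: ih.
    by apply: hp; case: hc => ->; rewrite ?normrN normr1.
  move=> i ki; rewrite !mxE; case: eqP => [->|/eqP ii]; first by case: hc => ->; [left|right].
  apply: xk; rewrite ltn_neqAle ki andbT; apply: contra ii => /eqP h.
  by apply/eqP/val_inj.
pose t := (x i0 0 - a i0 0 + 1) / 2.
have t01 : 0 <= t <= 1.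
  have /(normcV_le _ ler01) := xa => /(_ i0); rewrite !mxE ler_norml /t => /andP[h1 h2].
  by apply/andP; split; lra.
have -> : x = t *: p 1 + (1 - t) *: p (-1).
  apply/colP => i; rewrite !mxE; case: eqP => [->|_]; first by rewrite /t; field.
  by ring.
apply: le_trans (cf _ _ _ t01) _; have /andP[t0 t1] := t01.
have := hpk 1 (or_introl erefl); have := hpk (-1) (or_intror erefl).
by set A := f _; set C := f _; move=> h1 h2; nra.
Qed.

Lemma is_Conv_continuous f : is_Conv f -> continuous f.
Proof.
move=> cf a; have [M fM] := convex_cube_bound a cf; move/is_ConvP : cf => cf.
have M0 : f a <= M by apply: fM; rewrite subrr normr0.
(* The upper estimate is convexity on the segment from a to a + u; the lower one writes a as a
   convex combination of a - u and x. *)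
have key x : `|x - a| <= 1 -> `|f x - f a| <= `|x - a| * (M - f a).
  have [->|xa] := eqVneq x a; first by rewrite !subrr !normr0 mul0r.
  set t := `|x - a| => t1; have t0 : 0 < t by rewrite normr_gt0 subr_eq0.
  pose u := t^-1 *: (x - a).
  have u1 : `|u| = 1 by rewrite normrZ gtr0_norm ?invr_gt0// mulVf// gt_eqF.
  have xE : x = a + t *: u by rewrite scalerA divff ?gt_eqF// scale1r addrC subrK.
  have b1 : f (a + u) <= M by apply: fM; rewrite addrC addKr u1.
  have b2 : f (a - u) <= M by apply: fM; rewrite addrC addKr normrN u1.
  rewrite ler_norml; apply/andP; split.
    have := cf (t / (1 + t)) (a - u) x.
    have p1 : 0 < 1 + t by rewrite addr_gt0.
    have -> : t / (1 + t) *: (a - u) + (1 - t / (1 + t)) *: x = a.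
      rewrite {1}xE; apply/colP => i; rewrite !mxE; field; lra.
    have -> : 1 - t / (1 + t) = (1 + t)^-1 by field; lra.
    have h : 0 <= t / (1 + t) <= 1.
      apply/andP; split; first by apply: divr_ge0; exact: ltW.
      by rewrite ler_pdivrMr// mul1r lerDr.
    move=> /(_ h); rewrite -(ler_pM2r p1) mulrDl mulrAC divfK ?gt_eqF//.
    rewrite [_^-1 * _ * _]mulrAC mulVf ?gt_eqF// mul1r.
    by move: b2; set A := f _; nra.
  have := cf t (a + u) a.
  have -> : t *: (a + u) + (1 - t) *: a = x.
    by rewrite {1}xE; apply/colP => i; rewrite !mxE; ring.
  have h : 0 <= t <= 1 by rewrite (ltW t0).
  by move=> /(_ h); move: b1; set A := f _; nra.
apply/(@cvgrPdist_lt _ _ _ (nbhs a)) => e e0.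
pose d := Num.min 1 (e / (M - f a + 1)).
have p : 0 < M - f a + 1 by lra.
have d0 : 0 < d by rewrite lt_min ltr01 divr_gt0.
apply/(@nbhs_normP R 'cV[R]_n a); exists d => //= x; rewrite /ball_/= distrC => xd.
rewrite distrC; apply: le_lt_trans (key x _) _.
  by apply: ltW; apply: lt_le_trans xd _; rewrite ge_min lexx.
have : `|x - a| < e / (M - f a + 1) by apply: lt_le_trans xd _; rewrite ge_min lexx orbT.
rewrite ltr_pdivlMr//; have := normr_ge0 (x - a).
by set s := `|x - a|; nra.
Qed.

Definition grad f x : 'cV[R]_n := \col_i 'D_(e_ i) f x.

Lemma convex_grad_le f x z : is_Conv f -> is_Ck 1 f ->
  f x + dotv (grad f x) (z - x) <= f z.
Proof.
move=> /is_ConvP cf C1; set d := dotv _ _.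
have df : is_derive x (z - x) f d.
  have -> : d = \sum_i 'D_(e_ i) f x * (z - x) i 0.
    by apply: eq_bigr => i _; rewrite [grad f x i 0]mxE.
  exact: is_derive_grad C1.
have [/cvg_ex[l hl] hd] := df.
have {}hl : h^-1 *: (f (h *: (z - x) + x) - f x) @[h --> 0^'] --> d.
  by rewrite -hd; have [] := df.
apply/ler_addgt0Pr => e e0.
move/cvgrPdist_lt : hl => /(_ e e0)/nbhs_normP[r /= r0 hr].
pose t := Num.min 1 (r / 2).
have t0 : 0 < t by rewrite lt_min ltr01 divr_gt0.
have t1 : t <= 1 by rewrite ge_min lexx.
have tr : t < r.
  apply: (@le_lt_trans _ _ (r / 2)); first by rewrite ge_min lexx orbT.
  by rewrite ltr_pdivrMr// ltr_pMr// ltr1n.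
have := hr t; rewrite /ball_/= sub0r normrN gtr0_norm// => /(_ tr).
rewrite gt_eqF// => /(_ isT).
have := cf t z x; rewrite (ltW t0) t1 => /(_ isT).
have -> : t *: z + (1 - t) *: x = t *: (z - x) + x.
  by apply/colP => i; rewrite !mxE; ring.
set F := f (t *: _ + _) => h1; rewrite ltr_norml => /andP[_ h2].
have : t^-1 * (F - f x) <= f z - f x by rewrite mulrC ler_pdivrMr//; nra.
have {}h2 : d - t^-1 * (F - f x) < e by exact: h2.
move: h2; set X := t^-1 * _ => h2 h3; lra.
Qed.

(** The function t -> f(x + t e_i) - t y_i is minimal at t = 0, so its derivative vanishes there. *)
Lemma subdiff_grad f x y : is_Ck 1 f -> subdiff f x y -> y = grad f x.
Proof.
move=> C1 sy; apply/colP => i; rewrite mxE.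
have df := is_Ck_derive i x C1.
pose phi (t : R) := f (x + t *: e_ i) - t * y i 0.
have dphi : is_derive (0 : R) 1 phi ('D_(e_ i) f x - y i 0).
  apply: is_deriveB; first exact/is_derive_line0E.
  have := is_derive_affine 0 (y i 0) 0.
  by under eq_fun do rewrite add0r.
have phimin t : phi 0 <= phi t.
  rewrite /phi scale0r addr0 mul0r subr0 lerBrDr.
  have := sy (x + t *: e_ i); rewrite [x + _]addrC addrK dotvZr dotv_basisr.
  by rewrite addrC.
have dall t : derivable phi t 1.
  apply: derivableB; last first.
    have := is_derive_affine 0 (y i 0) t; under eq_fun do rewrite add0r.
    by case.
  by have [] : is_derive t 1 (fun s => f (x + s *: e_ i)) ('D_(e_ i) f (x + t *: e_ i))
    by apply/is_derive_lineE; exact: is_Ck_derive C1.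
have l1 : (-1 : R) <= 1 by lra.
have z1 : (0 : R) \in `]-1, 1[ by rewrite in_itv/=; apply/andP; split; lra.
have [_ h] := derive1_at_min l1 (fun t _ => dall t) z1 (fun t _ => phimin t).
by have [_ h2] := dphi; apply/esym/eqP; rewrite -subr_eq0 -h2 h.
Qed.

Lemma grad_subdiff f x : is_Conv f -> is_Ck 1 f -> subdiff f x (grad f x).
Proof. by move=> cf C1 z; exact: convex_grad_le. Qed.

End convex.

(** * Mollification *)

Lemma cts_abs (R : realType) (T : topologicalType) (f : T -> R) :
  continuous f -> continuous (fun t => `|f t|).
Proof. by move=> cf t; exact: (cvg_norm (cf t)). Qed.

Section convolution.
Context {R : realType} {n : nat}.
Implicit Types (x y z : 'cV[R]_n) (u k : 'cV[R]_n -> R).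
Local Notation e_ i := (basis_vec i).

Definition supp_in k (M : R) := forall y : 'cV[R]_n, M < `|y| -> k y = 0.

(** Convolution with the reflected kernel: an average of translates of u, so convexity in x is
    inherited directly. *)
Definition cnv k u x : R := \int[Leb n]_y (u (x + y) * k y).

Lemma supp_inM k u M : supp_in k M -> supp_in (fun y => u y * k y) M.
Proof. by move=> kM y My; rewrite kM// mulr0. Qed.

Lemma cts_shift u x : continuous u -> continuous (fun y => u (x + y)).
Proof.
move=> cu; apply: (@cts_comp _ _ _ (fun y : 'cV[R]_n => x + y) u) => //.
by apply: ctsDv; [exact: ctsCv|exact: cts_id].
Qed.

Lemma cts_shiftB u x : continuous u -> continuous (fun y => u (y - x)).
Proof. by move=> cu; under eq_fun do rewrite addrC; exact: cts_shift. Qed.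

Lemma supp_in_derive k M i : supp_in k M -> supp_in ('D_(e_ i) k) M.
Proof.
move=> kM x xM.
have -> : 'D_(e_ i) k x = 'D_(e_ i) (cst 0 : 'cV[R]_n -> R) x.
  apply: near_eq_derive.
  have : \forall y \near x, M < `|y|.
    by have /cvgr_gt := @norm_continuous R 'cV[R]_n x; apply.
  by apply: filterS => y yM; rewrite kM.
by rewrite derive_cst.
Qed.

Lemma integrable_cnv k u x M : continuous k -> supp_in k M -> continuous u ->
  (Leb n).-integrable setT (EFin \o (fun y => u (x + y) * k y)).
Proof.
move=> ck kM cu; apply: (@integrable_continuous_supp _ _ _ M).
  by apply: ctsM => //; exact: cts_shift.
exact: supp_inM.
Qed.

Lemma le_integral_cts (f g : 'cV[R]_n -> R) (M : R) :
  continuous f -> continuous g -> supp_in f M -> supp_in g M ->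
  (forall y, f y <= g y) -> \int[Leb n]_y f y <= \int[Leb n]_y g y.
Proof.
by move=> cf cg fM gM fg; apply: le_Rintegral => //;
  [exact: integrable_continuous_supp cf fM|exact: integrable_continuous_supp cg gM].
Qed.

Lemma cnv_bound k u M x (c h : R) : continuous k -> supp_in k M -> continuous u ->
  (forall y, 0 <= k y) -> \int[Leb n]_y k y = 1 ->
  (forall y, `|y| <= M -> `|u (x + y) - c| <= h) -> `|cnv k u x - c| <= h.
Proof.
move=> ck kM cu k0 k1 uh.
have cuk := ctsM (@cts_shift u x cu) ck.
have bnd (a : R) : \int[Leb n]_y (a * k y) = a.
  by rewrite RintegralZl ?k1 ?mulr1//; exact: integrable_continuous_supp kM.
rewrite ler_distl; apply/andP; split; [rewrite -[leLHS]bnd|rewrite -[leRHS]bnd].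
- apply: (@le_integral_cts _ _ M) => //; first by apply: ctsM => //; exact: ctsC.
  + exact: supp_inM.
  + exact: supp_inM.
  + move=> y; have [yM|yM] := leP `|y| M; last by rewrite kM// !mulr0.
    by rewrite ler_wpM2r//; have := uh y yM; rewrite ler_distl => /andP[].
- apply: (@le_integral_cts _ _ M) => //; first by apply: ctsM => //; exact: ctsC.
  + exact: supp_inM.
  + exact: supp_inM.
  + move=> y; have [yM|yM] := leP `|y| M; last by rewrite kM// !mulr0.
    by rewrite ler_wpM2r//; have := uh y yM; rewrite ler_distl => /andP[].
Qed.

Lemma near_shift_compact u x (M h : R) : continuous u -> 0 < h ->
  \forall x' \near x, forall y, `|y| <= M -> `|u (x + y) - u (x' + y)| < h.
Proof.
move=> cu h0; have /compact_near_coveringP := @compact_ball R n M.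
move=> /(_ _ (nbhs x) (fun x' y => `|u (x + y) - u (x' + y)| < h) _); apply => y _.
have h20 : 0 < h / 2 by rewrite divr_gt0.
have /cvgrPdist_lt/(_ _ h20)/nbhs_normP[d /= d0 hd] := cu (x + y).
have d20 : 0 < d / 2 by rewrite divr_gt0.
exists (ball y (d / 2), ball x (d / 2)) => /=.
  by split; apply: nbhsx_ballx.
move=> [y' x'] /= [] ; rewrite -!ball_normE /= => yy xx.
have a1 : `|u (x + y) - u (x + y')| < h / 2.
  apply: hd; rewrite /ball_/= opprD addrACA subrr add0r.
  by rewrite (lt_trans yy)// ltr_pdivrMr// ltr_pMr// ltr1n.
have a2 : `|u (x + y) - u (x' + y')| < h / 2.
  apply: hd; rewrite /ball_/= opprD addrACA (le_lt_trans (ler_normD _ _))//; lra.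
rewrite (_ : u (x + y') - _ =
  (u (x + y) - u (x' + y')) - (u (x + y) - u (x + y'))); last by ring.
by apply: le_lt_trans (ler_normB _ _) _; lra.
Qed.

Lemma cnv_continuous k u M : continuous k -> supp_in k M -> continuous u ->
  continuous (cnv k u).
Proof.
move=> ck kM cu x; apply/(@cvgrPdist_lt _ _ _ (nbhs x)) => e e0.
have cabs : continuous (fun y => `|k y|).
  exact: cts_abs.
have sabs : supp_in (fun y => `|k y|) M by move=> y /kM ->; rewrite normr0.
set I := \int[Leb n]_y `|k y|.
have I0 : 0 <= I by apply: Rintegral_ge0.
have I1 : 0 < I + 1 := ltr_wpDl I0 ltr01.
have h0 : 0 < e / (I + 1) by rewrite divr_gt0.
have := @near_shift_compact u x M _ cu h0; apply: filterS => x' hx'.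
have ik z := @integrable_cnv k u z M ck kM cu.
rewrite -RintegralB//.
have cd : continuous (fun y => u (x + y) * k y - u (x' + y) * k y).
  by apply: ctsB; apply: ctsM => //; exact: cts_shift.
have sd : supp_in (fun y => u (x + y) * k y - u (x' + y) * k y) M.
  by move=> y /kM ->; rewrite !mulr0 subrr.
apply: le_lt_trans (le_normr_Rintegral measurableT (integrable_continuous_supp cd sd)) _.
apply: (@le_lt_trans _ _ (\int[Leb n]_y (e / (I + 1) * `|k y|))).
  apply: (@le_integral_cts _ _ M).
  - exact: cts_abs.
  - by apply: ctsM => //; exact: ctsC.
  - by move=> y /sd ->; rewrite normr0.
  - exact: supp_inM.
  - move=> y; rewrite -mulrBl normrM; have [yM|yM] := leP `|y| M; last by rewrite kM// normr0 !mulr0.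
    by rewrite ler_wpM2r// ltW// hx'.
rewrite RintegralZl//; last exact: integrable_continuous_supp sabs.
by rewrite -/I mulrAC ltr_pdivrMr// ltr_pM2l// ltrDl.
Qed.

(** Moves the variable x onto the kernel, so that derivatives fall on k while u is merely
    continuous. *)
Lemma cnv_shiftE k u M x : continuous k -> supp_in k M -> continuous u ->
  cnv k u x = \int[Leb n]_y (u y * k (y - x)).
Proof.
move=> ck kM cu.
rewrite -(Rintegral_translate x) /cnv.
  by apply: eq_Rintegral => y _; rewrite addrK addrC.
apply: (@integrable_continuous_supp _ _ _ (`|x| + M)).
  by apply: ctsM => //; exact: cts_shiftB.
move=> y xM; rewrite kM ?mulr0//.
have := ler_normD x (y - x); rewrite [x + _]addrC subrK => h.
by have := lt_le_trans xM h; rewrite ltrD2l.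
Qed.

Lemma cnv_derive k u M x i : is_Ck 1 k -> supp_in k M -> continuous u ->
  is_derive x (e_ i) (cnv k u) (cnv (fun y => - 'D_(e_ i) k y) u x).
Proof.
move=> C1 kM cu; have ck := is_Ck_cts C1; have cdk := is_Ck_cts (is_Ck_D i C1).
have dkM := supp_in_derive i kM.
apply/is_derive_line0E.
have -> : cnv (fun y => - 'D_(e_ i) k y) u x =
    \int[Leb n]_y (u y * - 'D_(e_ i) k (y - (x + 0 *: e_ i))).
  rewrite (@cnv_shiftE _ _ M) ?scale0r ?addr0//; first exact: ctsN.
  by move=> y /dkM ->; rewrite oppr0.
have -> : (fun s => cnv k u (x + s *: e_ i)) =
    (fun s => \int[Leb n]_y (u y * k (y - (x + s *: e_ i)))).
  by apply/funext => s; rewrite (@cnv_shiftE _ _ M).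
have far t (y : 'cV[R]_n) : t \in `](-1), 1[ -> `|x| + M + 1 < `|y| ->
    M < `|y - (x + t *: e_ i)|.
  rewrite in_itv/= -ltr_norml => t1 yM.
  have b1 : `|e_ i : 'cV[R]_n| <= 1.
    by apply/normcV_le => // l; rewrite mxE; case: (_ && _); rewrite ?normr1 ?normr0.
  have h1 : `|t *: e_ i : 'cV[R]_n| <= 1.
    by rewrite normrZ mulr_ile1// ltW.
  have h2 := ler_normD x (t *: e_ i); have h3 := lerB_dist y (x + t *: e_ i).
  by move: h1 h2 h3 yM; move: `|t *: _| `|x| `|x + _| `|y| `|y - _| => a b c d e; lra.
have [Cu uC] := compact_norm_bounded_fun (@compact_ball R n (`|x| + M + 1)) cu.
have [Ck kC] := continuous_supp_bounded cdk dkM.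
apply: (@derive_under_integral _ _ (fun t y => u y * k (y - (x + t *: e_ i)))
   (fun t y => u y * - 'D_(e_ i) k (y - (x + t *: e_ i))) (-1) 1 0
   (Num.max 0 Cu * Num.max 0 Ck) (`|x| + M + 1)).
- by rewrite in_itv/=; apply/andP; split; lra.
- by move=> t _; apply: ctsM => //; exact: cts_shiftB.
- by move=> t y t1 yM; rewrite kM ?mulr0//; exact: far.
- move=> t y _.
  have dk : is_derive t 1 (fun s => k (y - (x + s *: e_ i)))
     (- 'D_(e_ i) k (y - (x + t *: e_ i))).
    pose Ck' s := k ((y - x) + s *: (- e_ i)).
    have -> : (fun s => k (y - (x + s *: e_ i))) = Ck'.
      by apply/funext => s; rewrite /Ck' opprD addrA scalerN.
    apply/is_derive_lineE; rewrite scalerN opprD addrA.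
    have := is_derive_grad (y - x - t *: e_ i) (- e_ i) C1.
    rewrite (bigD1 i)//= !mxE !eqxx mulrN1 big1 ?addr0//.
    by move=> l /negbTE li; rewrite !mxE li oppr0 mulr0.
  have := is_derive_mul (is_derive_cst (u y) t 1) dk.
  by rewrite mul0r add0r.
- move=> t y t1; have [yM|yM] := leP `|y| (`|x| + M + 1); last first.
    by rewrite dkM ?oppr0 ?mulr0 ?normr0 ?mulr_ge0 ?le_max ?lexx//; exact: far.
  rewrite normrM normrN ler_pM// le_max.
    by rewrite (uC y) ?orbT.
  by rewrite kC orbT.
- by move=> t y t1 yM; rewrite dkM ?oppr0 ?mulr0//; exact: far.
Qed.

Lemma is_Ck_cnv p k u M : is_Ck p k -> supp_in k M -> continuous u -> is_Ck p (cnv k u).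
Proof.
elim: p k => [|p ih] k Cp kM cu.
  by split => //; apply: cnv_continuous kM cu; exact: is_Ck_cts Cp.
apply/is_CkSP; split; first by apply: cnv_continuous kM cu; exact: is_Ck_cts Cp.
exists (fun i => cnv (fun y => - 'D_(e_ i) k y) u) => i; split.
  by move=> x; apply: cnv_derive kM cu; exact: is_Ck_le Cp.
apply: ih => //.
  have := is_CkZ (-1) (is_Ck_D i Cp).
  by under eq_fun do rewrite mulN1r.
by move=> y yM; rewrite (supp_in_derive i kM)// oppr0.
Qed.

Lemma is_Conv_cnv k u M : continuous k -> supp_in k M -> (forall y, 0 <= k y) ->
  is_Conv u -> is_Conv (cnv k u).
Proof.
move=> ck kM k0 Cu; have cu := is_Conv_continuous Cu; move/is_ConvP : Cu => Cu.
apply/is_ConvP => t x y t01; rewrite /cnv.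
have ik z := @integrable_cnv k u z M ck kM cu.
have ikZ a z : (Leb n).-integrable setT (EFin \o (fun w => a * (u (z + w) * k w))).
  apply: (@integrable_continuous_supp _ _ _ M).
    by apply: ctsM; [exact: ctsC|apply: ctsM => //; exact: cts_shift].
  by move=> w /kM ->; rewrite !mulr0.
rewrite -!RintegralZl// -RintegralD//.
apply: (@le_integral_cts _ _ M).
- by apply: ctsM => //; exact: cts_shift.
- by apply: ctsD; apply: ctsM; try exact: ctsC; apply: ctsM => //; exact: cts_shift.
- exact: supp_inM.
- by move=> z /kM ->; rewrite !mulr0 addr0.
- move=> z; rewrite !mulrA -mulrDl ler_wpM2r//.
  apply: le_trans (Cu t (x + z) (y + z) t01).
  rewrite (_ : t *: x + _ + z = t *: (x + z) + (1 - t) *: (y + z))//.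
  by apply/colP => i; rewrite !mxE; ring.
Qed.

End convolution.

Section kernel.
Context {R : realType}.

Lemma is_derive_pospow p (s : R) :
  is_derive s 1 (fun t => Num.max 0 t ^+ p.+2) (p.+2%:R * Num.max 0 s ^+ p.+1).
Proof.
have [s0|s0|->] := ltgtP s 0.
- rewrite expr0n/= mulr0.
  have : \forall t \near s, (cst 0 : R -> R) t = Num.max 0 t ^+ p.+2.
    have : \forall t \near s, t < 0 by have /cvgr_lt := @cts_id R s; apply.
    by apply: filterS => t t0; rewrite max_l ?ltW// expr0n.
  by move=> h; apply: (@near_eq_is_derive _ _ _ (cst 0) _ _ _ _ h); exact: is_derive_cst.
- have : \forall t \near s, (fun t : R => t ^+ p.+2) t = Num.max 0 t ^+ p.+2.
    have : \forall t \near s, 0 < t by have /cvgr_gt := @cts_id R s; apply.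
    by apply: filterS => t t0; rewrite max_r ?ltW.
  move=> h; apply: (@near_eq_is_derive _ _ _ (fun t : R => t ^+ p.+2) _ _ _ _ h).
  apply: DeriveDef; first exact: exprn_derivable.
  by rewrite exp_derive /= /GRing.scale/= mulr1.
- rewrite ?maxxx expr0n/= mulr0.
  have key : h^-1 *: (Num.max 0 (h *: 1 + 0 : R) ^+ p.+2 - Num.max 0 (0 : R) ^+ p.+2)
      @[h --> (0 : R)^'] --> (0 : R).
    apply/cvgrPdist_lt => e e0; apply/nbhs_normP.
    exists (Num.min 1 e); first by rewrite /= lt_min ltr01.
    move=> h; rewrite /ball_/= sub0r normrN lt_min => /andP[h1 he] hn0.
    rewrite maxxx expr0n/= subr0 sub0r normrN addr0 [h *: 1]mulr1.
    rewrite [_ *: _]/(h^-1 * _) normrM normfV normrX.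
    rewrite mulrC ltr_pdivrMr ?normr_gt0//.
    have m0 : `|Num.max 0 h| <= `|h|.
      by rewrite ger0_norm ?le_max ?lexx// ge_max normr_ge0 ler_norm.
    apply: (@le_lt_trans _ _ (`|h| ^+ p.+2)); first by rewrite lerXn2r// nnegrE.
    rewrite exprS [X in X < _]mulrC ltr_pM2r ?normr_gt0//.
    apply: le_lt_trans he; rewrite exprS ler_piMr// exprn_ile1//.
    exact: ltW.
  apply: DeriveDef; first by apply/cvg_ex; exists 0.
  exact/cvg_lim.
Qed.

Context {n : nat}.
Implicit Types (x y : 'cV[R]_n).

(** Of class C^p and supported in the ball of radius r; finite smoothness suffices, since three
    derivatives are used. *)
Definition bump (r : R) p y : R := Num.max 0 (r ^+ 2 - dotv y y) ^+ p.+1.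

Lemma cts_max0 (T : topologicalType) (f : T -> R) :
  continuous f -> continuous (fun t => Num.max 0 (f t)).
Proof.
move=> cf; have -> : (fun t => Num.max 0 (f t)) = (fun t => (f t + `|f t|) * 2^-1).
  apply/funext => t; have [f0|f0] := leP 0 (f t).
    by rewrite ger0_norm//; field.
  by rewrite ltr0_norm// subrr mul0r.
by apply: ctsM; [apply: ctsD => //; exact: cts_abs|exact: ctsC].
Qed.

Lemma continuous_bump r p : continuous (bump r p).
Proof.
apply: ctsX; apply: cts_max0; apply: ctsB; first exact: ctsC.
by apply: continuous_dotv; exact: cts_id.
Qed.

Lemma is_derive_dotv x i : is_derive x (basis_vec i) (fun y => dotv y y) (2 * x i 0).
Proof.
have -> : 2 * x i 0 = \sum_j ((j == i)%:R * x j 0 + x j 0 * (j == i)%:R).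
  rewrite (bigD1 i)//= eqxx mul1r mulr1 big1 ?addr0; first by ring.
  by move=> j /negbTE ->; rewrite mul0r mulr0 addr0.
by apply: is_derive_bigsum => j; apply: is_derive_mul; exact: is_derive_coord.
Qed.

Lemma is_Ck_bump r p : is_Ck p (bump r p).
Proof.
elim: p => [|p ih]; first by split => //; exact: continuous_bump.
apply/is_CkSP; split; first exact: continuous_bump.
exists (fun i y => (- 2 * p.+2%:R) * (y i 0 * bump r p y)) => i; split; last first.
  by apply: is_CkZ; apply: is_CkM => //; exact: is_Ck_coord.
move=> x.
have d1 : is_derive x (basis_vec i) (fun y => r ^+ 2 - dotv y y) (- (2 * x i 0)).
  rewrite -[X in is_derive _ _ _ X]add0r.
  exact: (is_deriveB (is_derive_cst (r ^+ 2) x (basis_vec i)) (is_derive_dotv x i)).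
move/is_derive_line0E : d1 => d1; apply/is_derive_line0E.
have d2 := is_derive_pospow p (r ^+ 2 - dotv x x).
pose g s := r ^+ 2 - dotv (x + s *: basis_vec i) (x + s *: basis_vec i).
have g0 : g 0 = r ^+ 2 - dotv x x by rewrite /g scale0r addr0.
have -> : (- 2 * p.+2%:R) * (x i 0 * bump r p x) =
    p.+2%:R * Num.max 0 (r ^+ 2 - dotv x x) ^+ p.+1 * - (2 * x i 0).
  by rewrite /bump; ring.
rewrite -g0 in d2 *; exact: is_derive1_comp d2 d1.
Qed.

Lemma exists_kernel (r : R) : 0 < r -> exists k : 'cV[R]_n -> R,
  [/\ is_Ck 3 k, supp_in k r, (forall y, 0 <= k y) & \int[Leb n]_y k y = 1].
Proof.
move=> r0; have b0 y : 0 <= bump r 3 y by rewrite exprn_ge0// le_max lexx.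
have bs : supp_in (bump r 3) r.
  move=> y ry; rewrite /bump max_l ?expr0n// subr_le0 -sqr_enorm.
  by rewrite lerXn2r ?nnegrE ?enorm_ge0 ?ltW// (lt_le_trans ry)// norm_le_enorm.
have cb := @continuous_bump r 3; have ib := integrable_continuous_supp cb bs.
have I0 : 0 < \int[Leb n]_y bump r 3 y.
  have bz : 0 < bump r 3 0.
    by rewrite exprn_gt0// lt_max dotv0r subr0 exprn_gt0// orbT.
  have bz2 : bump r 3 0 / 2 < bump r 3 0 by rewrite ltr_pdivrMr// ltr_pMr// ltr1n.
  have /cvgr_gt/(_ _ bz2)/nbhs_normP[d /= d0 hd] := cb 0.
  pose D := @hbox R n (const_mx (- (d / 2))) (const_mx (d / 2)).
  have mD : measurable D by exact: measurable_hbox.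
  have iD : (Leb n).-integrable setT (EFin \o (fun y => (bump r 3 0 / 2) * \1_D y)).
    apply: (@integrable_bounded_supp _ _ _ _ (bump r 3 0 / 2) (d / 2)).
    - exact: Leb_ball_lty.
    - by apply: measurable_funM => //; exact: measurable_indic.
    - move=> x; rewrite indicE; have c0 : 0 <= bump r 3 0 / 2 by rewrite divr_ge0.
      by case: (_ \in _); rewrite ?mulr1 ?mulr0 ?normr0// ger0_norm.
    - move=> y yd; rewrite indicE memNset ?mulr0// => yD.
      have : `|y| <= d / 2.
        apply/normcV_le => [|i]; first by rewrite divr_ge0// ltW.
        by have := yD i; rewrite !mxE ler_norml => /andP[-> /ltW ->].
      by rewrite leNgt yd.
  have : \int[Leb n]_y ((bump r 3 0 / 2) * \1_D y) <= \int[Leb n]_y bump r 3 y.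
    apply: le_Rintegral => // y _; rewrite indicE; case: (boolP (y \in D)) => yD; last by rewrite mulr0.
    rewrite mulr1 ltW//; apply: hd; rewrite /ball_/= sub0r normrN.
    have : `|y| <= d / 2.
      apply/normcV_le => [|i]; first by rewrite divr_ge0// ltW.
      by move: yD; rewrite inE => /(_ i); rewrite !mxE ler_norml => /andP[-> /ltW ->].
    by move/le_lt_trans; apply; rewrite ltr_pdivrMr// ltr_pMr// ltr1n.
  apply: lt_le_trans; rewrite RintegralZl//; last first.
    apply/integrableP; split; first by apply/measurable_EFinP; exact: measurable_indic.
    under eq_integral do rewrite /= ger0_norm//.
    by rewrite integral_indic// setIT; exact: Leb_hbox_lty.
  have hI : (\int[Leb n]_y (\1_D y)%:E = Leb n D)%E by rewrite integral_indic// setIT.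
  rewrite mulr_gt0 ?divr_gt0// /Rintegral hI (@Leb_hbox _ _ (const_mx (- (d / 2)))) => [|i].
    by apply: prodr_gt0 => i _; rewrite !mxE; lra.
  by rewrite !mxE; lra.
set I := \int[Leb n]_y _ in I0.
exists (fun y => I^-1 * bump r 3 y); split.
- exact/is_CkZ/is_Ck_bump.
- by move=> y /bs ->; rewrite mulr0.
- by move=> y; rewrite mulr_ge0// invr_ge0 ltW.
- by rewrite RintegralZl// mulVf// gt_eqF.
Qed.

End kernel.

(** * Divergence-free cofactors and the divergence theorem *)

Section divergence.
Context {R : realType} {n : nat}.
Implicit Types (x y : 'cV[R]_n) (w f : 'cV[R]_n -> R).
Local Notation e_ i := (basis_vec i).

Lemma is_Ck_prod k (I : Type) (r : seq I) (F : I -> 'cV[R]_n -> R) :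
  (forall i, is_Ck k (F i)) -> is_Ck k (fun x => \prod_(i <- r) F i x).
Proof.
move=> CF; elim: r => [|i r ih].
  by under eq_fun do rewrite big_nil; exact: is_Ck_cst.
by under eq_fun do rewrite big_cons; exact: is_CkM.
Qed.

Lemma is_Ck_det k m (M : 'cV[R]_n -> 'M[R]_m) :
  (forall i j, is_Ck k (fun x => M x i j)) -> is_Ck k (fun x => \det (M x)).
Proof.
move=> CM; apply: is_Ck_sum => s; apply: is_CkZ; exact: is_Ck_prod.
Qed.

Lemma is_Ck_adj k m (M : 'cV[R]_n -> 'M[R]_m) :
  (forall i j, is_Ck k (fun x => M x i j)) ->
  forall a b, is_Ck k (fun x => \adj (M x) a b).
Proof.
move=> CM a b; under eq_fun do rewrite mxE /cofactor.
apply: is_CkZ; apply: is_Ck_det => i j.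
by under eq_fun do rewrite !mxE; exact: CM.
Qed.

Lemma is_Ck1_comp f (g : 'cV[R]_n -> 'cV[R]_n) :
  is_Ck 1 f -> (forall i, is_Ck 1 (fun x => g x i 0)) -> is_Ck 1 (fun x => f (g x)).
Proof.
move=> Cf Cg; have cg : continuous g.
  by apply: continuous_cV => i; exact: is_Ck_cts (Cg i).
have cc (h : 'cV[R]_n -> R) : continuous h -> continuous (fun x => h (g x)).
  by move=> ch; exact: (@cts_comp _ _ _ g h cg ch).
apply/is_CkSP; split; first exact/cc/is_Ck_cts/Cf.
exists (fun a x => \sum_i 'D_(e_ i) f (g x) * 'D_(e_ a) (fun y => g y i 0) x) => a.
split; last first.
  split => //; apply: continuous_sum => i; apply: ctsM.
    exact: (cc _ (is_Ck_cts (is_Ck_D i Cf))).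
  exact: is_Ck_cts (is_Ck_D a (Cg i)).
move=> x; apply: is_derive_comp_grad Cf _ => i; exact: is_Ck_derive (Cg i).
Qed.

Lemma integral_divergence (X : 'I_n -> 'cV[R]_n -> R) (M : R) :
  (forall a, is_Ck 1 (X a)) -> (forall a, supp_in (X a) M) ->
  \int[Leb n]_x (\sum_a 'D_(e_ a) (X a) x) = 0.
Proof.
move=> CX XM.
have cD a : continuous ('D_(e_ a) (X a)) by exact: is_Ck_cts (is_Ck_D a (CX a)).
have sD a : supp_in ('D_(e_ a) (X a)) M by exact: supp_in_derive.
have : forall r : seq 'I_n, \int[Leb n]_x (\sum_(a <- r) 'D_(e_ a) (X a) x) = 0.
  elim=> [|a r ih].
    under eq_Rintegral do rewrite big_nil.
    by rewrite Rintegral_cst// mul0r.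
  under eq_Rintegral do rewrite big_cons.
  rewrite RintegralD//.
  - rewrite ih addr0; apply: (@integral_derive0 _ _ a (X a) _ M) => //.
    + exact: is_Ck_cts (CX a).
    + exact: XM.
    + by move=> x; exact: (is_Ck_derive a x (CX a)).
  - exact: integrable_continuous_supp (cD a) (sD a).
  - apply: (@integrable_continuous_supp _ _ _ M); first exact: continuous_sum.
    by move=> x xM; rewrite big1// => b _; exact: sD.
by move=> /(_ (index_enum _)).
Qed.

Lemma is_Ck_hessian k w i j : is_Ck k.+2 w -> is_Ck k (fun x => hessian w x i j).
Proof.
move=> Cw; under eq_fun do rewrite hessianE.
exact: is_Ck_D (is_Ck_D i Cw).
Qed.

(** The Piola identity applies because the third derivatives of w are fully symmetric, by [clairaut]
    for w and for its partial derivatives. *)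
Lemma piola_hessian (s t : R) w x b : is_Ck 3 w ->
  \sum_a 'D_(e_ a) (fun y => \adj (s%:M + t *: hessian w y) a b) x = 0.
Proof.
move=> Cw.
pose u a : 'M[R]_n := \matrix_(k, l) (t * 'D_(e_ a) ('D_(e_ l) ('D_(e_ k) w)) x).
have uE a k l : u a k l = t * 'D_(e_ a) ('D_(e_ l) ('D_(e_ k) w)) x by rewrite mxE.
have fE k l : 'D_(e_ l) ('D_(e_ k) w) = 'D_(e_ k) ('D_(e_ l) w).
  by apply/funext => y; apply: clairaut; apply: is_Ck_le Cw.
apply: (@piola R n (fun y => s%:M + t *: hessian w y) u x _ _ _ b) => a k l.
- have -> : (fun y => (s%:M + t *: hessian w y) k l) =
    (fun y => (s%:M : 'M[R]_n) k l + t * 'D_(e_ l) ('D_(e_ k) w) y).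
    by apply/funext => y; rewrite !mxE.
  have dh : is_derive x (e_ a) ('D_(e_ l) ('D_(e_ k) w)) ('D_(e_ a) ('D_(e_ l) ('D_(e_ k) w)) x).
    exact: (is_Ck_derive a x (is_Ck_D l (is_Ck_D k Cw))).
  have := is_derive_mul (is_derive_cst t x (e_ a)) dh; rewrite mul0r add0r => h.
  rewrite uE -[X in is_derive _ _ _ X]add0r.
  exact: (is_deriveD (is_derive_cst _ _ _) h).
- have h1 := congr1 (fun h => 'D_(e_ a) h x) (fE k l).
  have h2 := congr1 (fun h => 'D_(e_ k) h x) (fE a l).
  have h3 := clairaut k a x (is_Ck_D l Cw).
  have h4 := etrans h1 (etrans h3 (esym h2)).
  exact: (etrans (uE a k l) (etrans (congr1 (fun z => t * z) h4) (esym (uE k a l)))).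
- have h1 := congr1 (fun h => 'D_(e_ a) h x) (fE k l).
  exact: (etrans (uE a k l) (etrans (congr1 (fun z => t * z) h1) (esym (uE a l k)))).
Qed.

Lemma adj_sym m (A : 'M[R]_m) : A^T = A -> forall a b, \adj A a b = \adj A b a.
Proof. by move=> As a b; rewrite -{1}As -trmx_adj mxE. Qed.

Lemma abs_integral_le (f : 'cV[R]_n -> R) (C M : R) : 0 <= C ->
  continuous f -> supp_in f M -> (forall x, `|f x| <= C) ->
  `|\int[Leb n]_x f x| <= C * fine (Leb n (@cball R n M)).
Proof.
move=> C0 cf fM fC.
apply: le_trans (le_normr_Rintegral measurableT (integrable_continuous_supp cf fM)) _.
have mD := @measurable_ball_cV R n M.
have iD : (Leb n).-integrable setT (EFin \o (fun x => \1_(@cball R n M) x : R)).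
  apply/integrableP; split; first by apply/measurable_EFinP; exact: measurable_indic.
  under eq_integral do rewrite /= ger0_norm//.
  by rewrite integral_indic// setIT; exact: Leb_ball_lty.
have -> : fine (Leb n (@cball R n M)) = \int[Leb n]_x (\1_(@cball R n M) x : R).
  by rewrite /Rintegral integral_indic// setIT.
rewrite -RintegralZl//; apply: le_Rintegral => //.
- apply: (@integrable_continuous_supp _ _ _ M); first exact: cts_abs.
  by move=> x /fM ->; rewrite normr0.
- by under [X in _.-integrable _ X]eq_fun do rewrite /= EFinM; exact: integrableZl.
- move=> x _; rewrite indicE; have [xM|xM] := boolP (x \in @cball R n M).
    by rewrite mulr1.
  rewrite mulr0 fM ?normr0//; move: xM; rewrite notin_setE /cball /= => /negP.
  by rewrite -ltNge.
Qed.

End divergence.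

(** * Change of variables along the gradient of a strongly convex function *)

Section change_of_variables.
Context {R : realType} {n : nat}.
Implicit Types (x y : 'cV[R]_n) (w f : 'cV[R]_n -> R) (d s : R).
Local Notation e_ i := (basis_vec i).

(** Strong convexity with modulus d. Three derivatives are required so that the Piola identity holds
    for D^2 w. *)
Definition sconv d w := is_Ck 3 w /\ is_Conv (fun x => w x - d / 2 * dotv x x).

Lemma is_Ck_sqnorm k : is_Ck k (fun x => dotv x x).
Proof. by apply: is_Ck_sum => i; apply: is_CkM; exact: is_Ck_coord. Qed.

Lemma sconv_lower d w x z : sconv d w ->
  w x + dotv (grad w x) (z - x) + d / 2 * dotv (z - x) (z - x) <= w z.
Proof.
move=> [C3 cv]; set v := (fun x => _) in cv.
have C1 : is_Ck 1 w by exact: is_Ck_le C3.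
have Cq : is_Ck 1 (fun x => d / 2 * dotv x x) by apply: is_CkZ; exact: is_Ck_sqnorm.
have v1 : is_Ck 1 v := is_CkB C1 Cq.
have gE : grad v x = grad w x - d *: x.
  apply/colP => i; rewrite !mxE.
  have dw := is_Ck_derive i x C1.
  have dq := is_derive_mul (is_derive_cst (d / 2) x (e_ i)) (is_derive_dotv x i).
  have [_ ->] := is_deriveB dw dq.
  by rewrite mul0r add0r /cst; field.
have := convex_grad_le x z cv v1; rewrite gE /v.
have -> : d / 2 * dotv (z - x) (z - x) =
    d / 2 * dotv z z - d / 2 * dotv x x - d * dotv x (z - x).
  by rewrite !dotvBl !dotvBr (dotvC z x); field.
rewrite (dotvBl (grad w x)) dotvZl; lra.
Qed.

Lemma sconv_mono d w x y : sconv d w ->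
  d * dotv (x - y) (x - y) <= dotv (grad w x - grad w y) (x - y).
Proof.
move=> sw; have := sconv_lower x y sw; have := sconv_lower y x sw.
rewrite -(opprB x y) !dotvNr dotvNl [dotv (grad w x - _) _]dotvBl; lra.
Qed.

Lemma cts_norm_bounded2 (G : R * 'cV[R]_n -> R) (a b M : R) : continuous G ->
  exists C, forall s x, a <= s <= b -> `|x| <= M -> `|G (s, x)| <= C.
Proof.
move=> cG.
have cK : compact (`[a, b]%classic `*` [set x : 'cV[R]_n | `|x| <= M]).
  apply: compact_setX; [exact: segment_compact|exact: compact_ball].
have : compact (G @` (`[a, b]%classic `*` [set x : 'cV[R]_n | `|x| <= M])).
  apply: continuous_compact => //; exact: continuous_subspaceT.
move=> /compact_bounded[C [_ h]]; exists (C + 1) => s x sab xM.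
apply: (h (C + 1)); first by rewrite ltrDl.
by exists (s, x) => //; split => //=; rewrite in_itv.
Qed.

Lemma homotopy_time d s : 0 < d -> d <= 1 -> -1 < s -> s < 1 + d / 6 ->
  s ^+ 2 <= 1 + d / 2.
Proof.
move=> d0 d1 s1 s2.
have : 0 <= (1 + d / 6 - s) * (1 + d / 6 + s) by apply: mulr_ge0; lra.
have : d * d <= d by rewrite ler_piMl// ltW.
rewrite expr2; lra.
Qed.

(** With S = s^2 and X = |x|, strong convexity leaves the coefficient 1 - S (1 - d) in front of X^2,
    which is at least d / 2 when S <= 1 + d / 2. *)
Lemma homotopy_key d (X S D0 D1 G N : R) : 0 < d -> d <= 1 ->
  0 <= S -> S <= 1 + d / 2 -> 0 <= G -> 0 < X ->
  d * X ^+ 2 <= D1 - D0 -> - D0 <= G * X ->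
  (1 - S) * X ^+ 2 + S * D1 <= N * X -> X * (d / 2) * X <= (N + 2 * G) * X.
Proof.
move=> d0 d1 S0 S1 G0 X0 a1 a2 a3.
have b1 : 0 <= S * (D1 - D0 - d * X ^+ 2) by apply: mulr_ge0 => //; lra.
have b2 : 0 <= S * (G * X + D0) by apply: mulr_ge0 => //; lra.
have b3 : S * (G * X) <= 2 * (G * X).
  by apply: ler_wpM2r; [apply: mulr_ge0 => //; exact: ltW|lra].
have b4 : (S * (1 - d)) * X ^+ 2 <= (1 - d / 2) * X ^+ 2.
  apply: ler_wpM2r; first exact: sqr_ge0.
  have : S * (1 - d) <= (1 + d / 2) * (1 - d) by apply: ler_wpM2r => //; lra.
  have := sqr_ge0 d; rewrite expr2; lra.
move: a3 b1 b2 b3 b4; rewrite !expr2; lra.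
Qed.

Lemma homotopy_end d : d <= 1 -> 1 + d / 6 <= 2.
Proof. lra. Qed.

Lemma derive0_eq (f : R -> R) (a b : R) : a <= b ->
  (forall s, s \in `[a, b] -> is_derive s 1 f 0) -> f b = f a.
Proof.
move=> ab df.
have h1 s : s \in `]a, b[ -> is_derive s 1 f ((fun=> 0) s).
  by move=> sI; apply: df; exact: subset_itv_oo_cc sI.
have h2 : {within `[a, b], continuous f}.
  by apply: derivable_within_continuous => s /df[].
have [c _] := MVT_segment ab h1 h2.
by rewrite mul0r => /eqP; rewrite subr_eq0 => /eqP.
Qed.

Section homotopy.
Variables (d : R) (w : 'cV[R]_n -> R).
Hypotheses (d0 : 0 < d) (d1 : d <= 1) (sw : sconv d w).

(** A homotopy from the identity to grad w, with Jacobian [H]. Differentiation under the integral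
    needs an open interval around [0, 1]. The parameter s^2 keeps the weight of grad w nonnegative
    for s < 0, and up to s = 1 + d / 6 the slightly negative weight of x is absorbed by strong
    convexity ([homotopy_time]). *)
Let g s x : 'cV[R]_n := (1 - s ^+ 2) *: x + s ^+ 2 *: grad w x.
Let H s x : 'M[R]_n := (1 - s ^+ 2)%:M + s ^+ 2 *: hessian w x.
Let u x : 'cV[R]_n := grad w x - x.

Lemma homotopy_coercive (M : R) s x : 0 <= M -> s \in `]-1, 1 + d / 6[ ->
  `|g s x| <= M -> `|x| <= (n%:R * M + 2 * enorm (grad w 0)) / (d / 2).
Proof.
move=> M0; rewrite in_itv/= => /andP[s1 s2] gM.
have sq := homotopy_time d0 d1 s1 s2.
apply: le_trans (norm_le_enorm x) _.
have gx : enorm (g s x) <= n%:R * M.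
  by apply: le_trans (enorm_le_norm _) _; rewrite ler_wpM2l.
have := sconv_mono x 0 sw; rewrite subr0 dotvBl -sqr_enorm => mono.
have h1 : dotv (g s x) x = (1 - s ^+ 2) * enorm x ^+ 2 + s ^+ 2 * dotv (grad w x) x.
  by rewrite dotvDl !dotvZl sqr_enorm.
have h2 : - dotv (grad w 0) x <= enorm (grad w 0) * enorm x.
  by rewrite -dotvNl; apply: le_trans (dotv_le_enorm _ _) _; rewrite enormN.
have h3 := dotv_le_enorm (g s x) x.
have h4 : enorm (g s x) * enorm x <= n%:R * M * enorm x.
  by rewrite ler_wpM2r ?enorm_ge0.
rewrite ler_pdivlMr ?divr_gt0//.
have := enorm_ge0 x; rewrite le_eqVlt => /predU1P[<-|x0].
  by rewrite mul0r addr_ge0 ?mulr_ge0 ?enorm_ge0.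
rewrite -(ler_pM2r x0).
apply: (homotopy_key (S := s ^+ 2) d0 d1 (D0 := dotv (grad w 0) x) (D1 := dotv (grad w x) x)) => //.
- exact: sqr_ge0.
- exact: enorm_ge0.
- by rewrite -h1; exact: le_trans h3 h4.
Qed.

Let gE s x i : g s x i 0 = (1 - s ^+ 2) * x i 0 + s ^+ 2 * 'D_(e_ i) w x.
Proof. by rewrite !mxE. Qed.

Let HE s x i j : H s x i j = (1 - s ^+ 2) * (i == j)%:R + s ^+ 2 * hessian w x i j.
Proof. by rewrite !mxE mulr_natr. Qed.

Let C1 : is_Ck 1 w. Proof. by case: sw => C3 _; exact: is_Ck_le C3. Qed.

(** The s-derivative of f(g) det H, with the factor 2 s coming from s^2 taken out. *)
Let F' f s x : R := 2 * s * (\sum_i 'D_(e_ i) f (g s x) * u x i 0 * \det (H s x) +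
  f (g s x) * \sum_i \sum_j (hessian w x i j - (i == j)%:R) * cofactor (H s x) i j).

Let dg s x i : is_derive s 1 (fun t => g t x i 0) (2 * s * u x i 0).
Proof.
have -> : (fun t => g t x i 0) = (fun t => x i 0 + t ^+ 2 * u x i 0).
  by apply/funext => t; rewrite gE !mxE; ring.
by apply: is_derive_eq; rewrite /GRing.scale/= ; ring.
Qed.

Let dH s x i j : is_derive s 1 (fun t => H t x i j)
  (2 * s * (hessian w x i j - (i == j)%:R)).
Proof.
have -> : (fun t => H t x i j) =
    (fun t => (i == j)%:R + t ^+ 2 * (hessian w x i j - (i == j)%:R)).
  by apply/funext => t; rewrite HE; ring.
by apply: is_derive_eq; rewrite /GRing.scale/= ; ring.
Qed.

Let dF f s x : is_Ck 1 f ->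
  is_derive s 1 (fun t => f (g t x) * \det (H t x)) (F' f s x).
Proof.
move=> Cf.
have df i y := is_Ck_derive i y Cf.
have h1 := is_derive_chain df (fun i => is_Ck_cts (is_Ck_D i Cf)) (fun i => dg s x i).
pose M' : 'M[R]_n := \matrix_(i, j) (2 * s * (hessian w x i j - (i == j)%:R)).
have dM i j : is_derive s 1 (fun t => H t x i j) (M' i j) by rewrite mxE; exact: dH.
have h2 := is_derive_det1 dM.
have h3 := @is_derive_mul R R (fun t => f (g t x)) (fun t => \det (H t x)) s 1 _ _ h1 h2.
apply: (is_derive_eq h3); rewrite /F' mulrDr; congr (_ + _).
  rewrite mulr_suml mulr_sumr; apply: eq_bigr => i _; ring.
rewrite mulrCA; congr (_ * _); rewrite mulr_sumr; apply: eq_bigr => i _.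
by rewrite mulr_sumr; apply: eq_bigr => j _; rewrite mxE; ring.
Qed.

Let cg (T : topologicalType) (a : T -> R) (b : T -> 'cV[R]_n) :
  continuous a -> continuous b -> continuous (fun t => g (a t) (b t)).
Proof.
move=> ca cb; have ca2 := @ctsX _ _ _ 2 ca.
have c1 : continuous (fun t => 1 - a t ^+ 2) by apply: ctsB => //; exact: ctsC.
apply: continuous_cV => i; under eq_fun do rewrite gE.
apply: ctsD; apply: ctsM => //; first exact: cts_coord.
exact: (@cts_comp _ _ _ b ('D_(e_ i) w) cb (is_Ck_cts (is_Ck_D i C1))).
Qed.

Let cH (T : topologicalType) (a : T -> R) (b : T -> 'cV[R]_n) i j :
  continuous a -> continuous b -> continuous (fun t => H (a t) (b t) i j).
Proof.
move=> ca cb; have ca2 := @ctsX _ _ _ 2 ca.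
have c1 : continuous (fun t => 1 - a t ^+ 2) by apply: ctsB => //; exact: ctsC.
under eq_fun do rewrite HE.
apply: ctsD; apply: ctsM => //; first exact: ctsC.
have c2 : continuous (fun x => hessian w x i j).
  by have [C3 _] := sw; exact: is_Ck_cts (is_Ck_hessian i j C3).
exact: (@cts_comp _ _ _ b (fun x => hessian w x i j) cb c2).
Qed.

Let cF f : is_Ck 1 f -> continuous (fun t : R * 'cV[R]_n => F' f t.1 t.2).
Proof.
move=> Cf.
have cf1 : continuous (fun t : R * 'cV[R]_n => t.1) by move=> t; exact: cvg_fst.
have cf2 : continuous (fun t : R * 'cV[R]_n => t.2) by move=> t; exact: cvg_snd.
have cgt := cg cf1 cf2.
have cHt i j := @cH _ _ _ i j cf1 cf2.
have cu i : continuous (fun t : R * 'cV[R]_n => u t.2 i 0).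
  have -> : (fun t : R * 'cV[R]_n => u t.2 i 0) =
      (fun t : R * 'cV[R]_n => 'D_(e_ i) w t.2 - t.2 i 0).
    by apply/funext => t; rewrite !mxE.
  apply: ctsB; last exact: cts_coord.
  exact: (@cts_comp _ _ _ _ ('D_(e_ i) w) cf2 (is_Ck_cts (is_Ck_D i C1))).
have ch i j : continuous (fun t : R * 'cV[R]_n => hessian w t.2 i j).
  have c2 : continuous (fun x => hessian w x i j).
    by have [C3 _] := sw; exact: is_Ck_cts (is_Ck_hessian i j C3).
  exact: (@cts_comp _ _ _ _ (fun x => hessian w x i j) cf2 c2).
apply: ctsM; first by apply: ctsM => //; exact: ctsC.
apply: ctsD.
  apply: continuous_sum => i; apply: ctsM; last exact: cts_det.
  apply: ctsM => //.
  exact: (@cts_comp _ _ _ _ ('D_(e_ i) f) cgt (is_Ck_cts (is_Ck_D i Cf))).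
apply: ctsM; first exact: (@cts_comp _ _ _ _ f cgt (is_Ck_cts Cf)).
apply: continuous_sum => i; apply: continuous_sum => j; apply: ctsM.
  by apply: ctsB => //; exact: ctsC.
exact: cts_cofactor.
Qed.

Let C2 i : is_Ck 2 ('D_(e_ i) w). Proof. by have [C3 _] := sw; exact: is_Ck_D. Qed.

Let CH s a b : is_Ck 1 (fun y => \adj (H s y) a b).
Proof.
apply: is_Ck_adj => i j; under eq_fun do rewrite HE.
apply: is_CkDr; first exact: is_Ck_cst.
by apply: is_CkZ; apply: is_Ck_hessian; case: sw.
Qed.

(** The vector field f(g) adj(H) u, where 2 s u is the velocity of g in s. *)
Let X f s a y := f (g s y) * \sum_b \adj (H s y) a b * u y b 0.

Let CX f s a : is_Ck 1 f -> is_Ck 1 (X f s a).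
Proof.
move=> Cf; apply: is_CkM.
  apply: is_Ck1_comp => // i; under eq_fun do rewrite gE.
  apply: is_CkDr; apply: is_CkZ; first exact: is_Ck_coord.
  exact: is_Ck_le (C2 i).
apply: is_Ck_sum => b; apply: is_CkM => //.
have -> : (fun y => u y b 0) = (fun y => 'D_(e_ b) w y - y b 0).
  by apply/funext => y; rewrite !mxE.
by apply: is_CkB; [exact: is_Ck_le (C2 b)|exact: is_Ck_coord].
Qed.

(** H is the Jacobian of g. Its adjugate is divergence free by the Piola identity, H adj(H) = det(H)
    1 turns the gradient of f(g) into the first sum, and the remaining trace of adj(H) Du is
    Jacobi's formula for det H. *)
Let divF f s x : is_Ck 1 f -> F' f s x = 2 * s * \sum_a 'D_(e_ a) (X f s a) x.
Proof.
move=> Cf; rewrite /F'; congr (_ * _).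
have C3 : is_Ck 3 w by case: sw.
have dgf a : is_derive x (e_ a) (fun y => f (g s y)) (\sum_i 'D_(e_ i) f (g s x) * H s x i a).
  apply: is_derive_comp_grad Cf _ => i.
  have -> : (fun y => g s y i 0) = (fun y => (1 - s ^+ 2) * y i 0 + s ^+ 2 * 'D_(e_ i) w y).
    by apply/funext => y; rewrite gE.
  have h1 := is_derive_mul (is_derive_cst (1 - s ^+ 2) x (e_ a)) (is_derive_coord a i x).
  have d2 := @is_Ck_derive _ _ 1 _ a x (C2 i).
  have h2 := is_derive_mul (is_derive_cst (s ^+ 2) x (e_ a)) d2.
  apply: (is_derive_eq (is_deriveD h1 h2)).
  by rewrite !mul0r !add0r HE hessianE.
have du a b : is_derive x (e_ a) (fun y => u y b 0) (hessian w x b a - (b == a)%:R).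
  have -> : (fun y => u y b 0) = (fun y => 'D_(e_ b) w y - y b 0).
    by apply/funext => y; rewrite !mxE.
  have d2 := @is_Ck_derive _ _ 1 _ a x (C2 b).
  apply: (is_derive_eq (is_deriveB d2 (is_derive_coord a b x))).
  by rewrite hessianE.
have dX a : 'D_(e_ a) (X f s a) x =
   (\sum_i 'D_(e_ i) f (g s x) * H s x i a) * (\sum_b \adj (H s x) a b * u x b 0) +
   f (g s x) * \sum_b ('D_(e_ a) (fun y => \adj (H s y) a b) x * u x b 0 +
     \adj (H s x) a b * (hessian w x b a - (b == a)%:R)).
  have h1 : is_derive x (e_ a) (fun y => \sum_b \adj (H s y) a b * u y b 0)
      (\sum_b ('D_(e_ a) (fun y => \adj (H s y) a b) x * u x b 0 +
       \adj (H s x) a b * (hessian w x b a - (b == a)%:R))).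
    apply: is_derive_bigsum => b.
    exact: (is_derive_mul (is_Ck_derive a x (CH s a b)) (du a b)).
  by have [_ ->] := is_derive_mul (dgf a) h1.
under [RHS]eq_bigr do rewrite dX.
rewrite big_split/= -mulr_sumr; congr (_ + _ * _).
  under [RHS]eq_bigr do rewrite mulr_suml.
  rewrite exchange_big/=; apply: eq_bigr => i _.
  under eq_bigr do rewrite -mulrA.
  rewrite -mulr_sumr -mulrA; congr (_ * _).
  under eq_bigr do rewrite mulr_sumr.
  rewrite exchange_big/= (bigD1 i)//= [X in _ + X]big1 ?addr0.
    under eq_bigr do rewrite mulrA.
    have -> : u x i 0 * \det (H s x) = (H s x *m \adj (H s x)) i i * u x i 0.
      by rewrite mul_mx_adj !mxE eqxx mulr1n mulrC.
    by rewrite mxE mulr_suml.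
  move=> b bi; under eq_bigr do rewrite mulrA.
  have : (H s x *m \adj (H s x)) i b * u x b 0 = 0.
    by rewrite mul_mx_adj !mxE eq_sym (negbTE bi) mulr0n mul0r.
  by rewrite mxE mulr_suml.
under [RHS]eq_bigr do rewrite big_split/=.
rewrite big_split/= [X in X + _]exchange_big/= [X in X + _]big1 ?add0r => [|b _].
  rewrite exchange_big/=; apply: eq_bigr => a _; apply: eq_bigr => b _.
  by rewrite [\adj _ a b]mxE mulrC.
rewrite -mulr_suml (_ : \sum_a _ = 0) ?mul0r//.
exact: (piola_hessian (1 - s ^+ 2) (s ^+ 2) x b C3).
Qed.

(** The integral of f(g_s) det H_s has derivative zero in s, being the integral of a divergence of
    compact support; the values at s = 1 and s = 0 are the two sides. *)
Lemma change_of_variables_C1 f (M : R) : 0 <= M -> is_Ck 1 f -> supp_in f M ->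
  \int[Leb n]_x (f (grad w x) * \det (hessian w x)) = \int[Leb n]_x f x.
Proof.
move=> M0 Cf fM.
pose M' := (n%:R * M + 2 * enorm (grad w 0)) / (d / 2).
have [C hC] := cts_norm_bounded2 (-1) 2 M' (cF Cf).
have uv : 1 + d / 6 <= 2 by apply: homotopy_end.
have gM s x : s \in `]-1, 1 + d / 6[ -> M' < `|x| -> M < `|g s x|.
  move=> sI xM; rewrite ltNge; apply/negP => /(homotopy_coercive M0 sI).
  by rewrite leNgt xM.
have fg0 s x : s \in `]-1, 1 + d / 6[ -> M' < `|x| -> f (g s x) = 0.
  by move=> sI xM; apply: fM; exact: gM.
have F0 s x : s \in `]-1, 1 + d / 6[ -> M' < `|x| -> F' f s x = 0.
  move=> sI xM; rewrite /F' fg0// mul0r addr0 big1 ?mulr0// => i _.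
  by rewrite (supp_in_derive i fM (gM _ _ sI xM)) !mul0r.
have c2 : continuous (fun x : 'cV[R]_n => x) by exact: cts_id.
pose I s := \int[Leb n]_x (f (g s x) * \det (H s x)).
have dI s : s \in `]-1, 1 + d / 6[ -> is_derive s 1 I 0.
  move=> sI; have X0 a : supp_in (X f s a) M' by move=> x xM; rewrite /X fg0// mul0r.
  have -> : 0 = \int[Leb n]_x F' f s x.
    under eq_Rintegral do rewrite divF//.
    rewrite RintegralZl//; first by rewrite (integral_divergence (CX s^~ Cf) X0) mulr0.
    apply: (@integrable_continuous_supp _ _ _ M').
      by apply: continuous_sum => a; exact: is_Ck_cts (is_Ck_D a (CX s a Cf)).
    by move=> x xM; rewrite big1// => a _; exact: supp_in_derive (X0 a) _ xM.
  apply: (@derive_under_integral R n _ _ (-1) (1 + d / 6) s C M') => //.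
  - move=> t tI; have c1 : continuous (fun _ : 'cV[R]_n => t) by exact: ctsC.
    have cgt := cg c1 c2; have cHt i j := @cH _ _ _ i j c1 c2.
    apply: ctsM; last exact: cts_det.
    exact: (@cts_comp _ _ _ _ f cgt (is_Ck_cts Cf)).
  - by move=> t x tI xM; rewrite fg0// mul0r.
  - by move=> t x _; exact: dF.
  - move=> t x tI; have [xM|xM] := leP `|x| M'; last first.
      (* Off the support only C >= 0 is at stake; it is read off from the bound at s = 0 and x =
         0. *)
      rewrite F0// normr0; apply: le_trans (hC 0 0 _ _); first exact: normr_ge0.
        by apply/andP; split; lra.
      by rewrite normr0 divr_ge0 ?divr_ge0 ?addr_ge0 ?mulr_ge0 ?enorm_ge0// ltW.
    apply: (hC t x) xM; move: tI; rewrite in_itv/= => /andP[t1 t2].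
    by rewrite (ltW t1)/= (le_trans (ltW t2)).
have I10 : I 1 = I 0.
  have dIs s : s \in `[0, 1] -> is_derive s 1 I 0.
    rewrite in_itv/= => /andP[s0 s1]; apply: dI; rewrite in_itv/=.
    by rewrite (lt_le_trans _ s0)// (le_lt_trans s1)// ltrDl divr_gt0.
  exact: derive0_eq ler01 dIs.
move: I10; rewrite /I => h.
rewrite -[LHS](_ : \int[Leb n]_x (f (g 1 x) * \det (H 1 x)) = _).
  rewrite h; apply: eq_Rintegral => x _.
  by rewrite /g /H expr0n/= subr0 scale1r !scale0r !addr0 det1 mulr1.
apply: eq_Rintegral => x _.
by rewrite /g /H expr1n subrr scale0r raddf0 !scale1r !add0r.
Qed.

End homotopy.
Lemma uniform_continuity_ball (f : 'cV[R]_n -> R) (M h : R) : continuous f -> 0 < h ->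
  exists r, [/\ 0 < r, r <= 1 &
    forall x y, `|x| <= M -> `|y| <= r -> `|f (x + y) - f x| <= h].
Proof.
move=> cf h0.
have /compact_near_coveringP nc := @compact_ball R n M.
have near x : `|x| <= M ->
    \forall x' \near x & y \near (0 : 'cV[R]_n), `|f (x' + y) - f x'| < h.
  move=> _; have h2 : 0 < h / 2 by rewrite divr_gt0.
  have /cvgrPdist_lt/(_ _ h2)/nbhs_normP[d /= d0 hd] := cf x.
  have d20 : 0 < d / 2 by rewrite divr_gt0.
  exists (ball x (d / 2), ball (0 : 'cV[R]_n) (d / 2)) => /=.
    by split; apply: nbhsx_ballx.
  move=> [x' y] /= [] ; rewrite -!ball_normE /= sub0r normrN => xx yy.
  have a1 : `|f x - f x'| < h / 2 by apply: hd; rewrite /ball_/=; lra.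
  have a2 : `|f x - f (x' + y)| < h / 2.
    by apply: hd; rewrite /ball_/= opprD addrA (le_lt_trans (ler_normB _ _))//; lra.
  rewrite (_ : f (x' + y) - _ = (f x - f x') - (f x - f (x' + y))); last by ring.
  by apply: le_lt_trans (ler_normB _ _) _; lra.
have : \forall y \near (0 : 'cV[R]_n), [set x : 'cV[R]_n | `|x| <= M] `<=`
    (fun x => `|f (x + y) - f x| < h).
  exact: (nc _ (nbhs (0 : 'cV[R]_n)) (fun y x => `|f (x + y) - f x| < h) _ near).
move=> /nbhs_normP[r0 /= r00 hr].
pose r := Num.min 1 (r0 / 2).
have r1 : r <= 1 by rewrite ge_min lexx.
have rr : r < r0.
  by apply: (@le_lt_trans _ _ (r0 / 2)); [rewrite ge_min lexx orbT|lra].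
exists r; split => //; first by rewrite lt_min ltr01 divr_gt0.
move=> x y xM yr.
by apply/ltW; apply: (hr y) => //; rewrite /ball_/= sub0r normrN (le_lt_trans yr).
Qed.

Lemma uniform_continuity (f : 'cV[R]_n -> R) (M h : R) : continuous f -> supp_in f M -> 0 < h ->
  exists r, [/\ 0 < r, r <= 1 & forall x y, `|y| <= r -> `|f (x + y) - f x| <= h].
Proof.
move=> cf fM h0; have [r [r0 r1 hr]] := uniform_continuity_ball (M + 1) cf h0.
exists r; split => // x y yr; have [xM|xM] := leP `|x| (M + 1); first exact: hr.
have xyM : M < `|x + y|.
  by have := lerB_dist x (- y); rewrite normrN opprK; lra.
rewrite !fM ?subrr ?normr0 ?ltW//; lra.
Qed.

Lemma dist_le_aux (A B C p q X : R) :
  `|B - A| <= p -> `|B - C| <= q -> 0 < X -> `|A - C| <= p + q + X.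
Proof.
move=> a1 a2 X0; rewrite distrC in a1; have -> : A - C = (A - B) + (B - C) by ring.
by apply: le_trans (ler_normD _ _) _; lra.
Qed.

(** * The inverse gradient *)

Section strongly_convex.
Variables (d : R) (w : 'cV[R]_n -> R).
Hypotheses (d0 : 0 < d) (d1 : d <= 1) (sw : sconv d w).

Lemma grad_coercive (M : R) x : 0 <= M -> `|grad w x| <= M ->
  `|x| <= (n%:R * M + enorm (grad w 0)) / d.
Proof.
move=> M0 gM; apply: le_trans (norm_le_enorm x) _; rewrite ler_pdivlMr//.
have := sconv_mono x 0 sw; rewrite subr0 -sqr_enorm => h1.
have h2 := dotv_le_enorm (grad w x - grad w 0) x.
have h3 : enorm (grad w x - grad w 0) <= n%:R * M + enorm (grad w 0).
  apply: le_trans (enormD _ _) _; rewrite enormN lerD2r.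
  by apply: le_trans (enorm_le_norm _) _; rewrite ler_wpM2l.
have := enorm_ge0 x; rewrite le_eqVlt => /predU1P[<-|x0].
  by rewrite mul0r addr_ge0 ?mulr_ge0 ?enorm_ge0.
rewrite -(ler_pM2r x0) mulrAC -expr2 mulrC; apply: le_trans h1 _.
by apply: le_trans h2 _; rewrite ler_pM2r.
Qed.

Let C1 : is_Ck 1 w. Proof. by case: sw => C3 _; exact: is_Ck_le C3. Qed.

Lemma continuous_grad : continuous (grad w).
Proof.
apply: continuous_cV => i; under eq_fun do rewrite mxE.
exact: is_Ck_cts (is_Ck_D i C1).
Qed.

(** Minimise w - <y, .> over a ball. Strong convexity at 0 shows that for |z| >= 2 A / d the value
    is at least that at 0, so the minimum is global and y is a subgradient at the minimiser. *)
Lemma grad_surj y : exists x, grad w x = y.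
Proof.
pose A := enorm (grad w 0 - y); pose p x := w x - dotv y x.
have cp : continuous p.
  apply: ctsB; first exact: is_Ck_cts C1.
  by apply: continuous_dotv; [exact: ctsCv|exact: cts_id].
have A0 : 0 <= 2 * A / d by rewrite divr_ge0 ?mulr_ge0 ?enorm_ge0// ltW.
have [x [xA xmin]] : exists x, `|x| <= 2 * A / d /\ forall z, `|z| <= 2 * A / d -> p x <= p z.
  have ne : [set x : 'cV[R]_n | `|x| <= 2 * A / d] !=set0 by exists 0; rewrite /= normr0.
  have [x xA xmin] := compact_EVT_min ne (@compact_ball R n (2 * A / d))
    (continuous_subspaceT cp).
  by exists x; split => [|z zA]; [exact: set_mem xA|apply: xmin; exact: mem_set].
exists x; apply/esym/(subdiff_grad C1) => z.
suff : p x <= p z by rewrite /p dotvBr; lra.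
have [zA|zA] := leP `|z| (2 * A / d); first exact: xmin.
have : p x <= p 0 by apply: xmin; rewrite normr0.
move=> /le_trans; apply.
have := sconv_lower 0 z sw; rewrite subr0 -sqr_enorm /p dotv0r subr0.
have : - dotv (grad w 0 - y) z <= A * enorm z.
  by rewrite -dotvNl; apply: le_trans (dotv_le_enorm _ _) _; rewrite enormN.
have : A * enorm z <= d / 2 * enorm z ^+ 2.
  rewrite expr2 mulrA ler_wpM2r ?enorm_ge0//.
  move: zA => /lt_le_trans/(_ (norm_le_enorm z)); rewrite ltr_pdivrMr//.
  by move=> zA; rewrite mulrAC ler_pdivlMr// mulrC (mulrC d) ltW.
rewrite dotvBl; lra.
Qed.

Definition gradI y := projT1 (cid (grad_surj y)).

Lemma gradK y : grad w (gradI y) = y.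
Proof. by rewrite /gradI; case: cid. Qed.

Lemma gradI_lip y z : d * enorm (gradI y - gradI z) <= enorm (y - z).
Proof.
have := sconv_mono (gradI y) (gradI z) sw; rewrite !gradK -sqr_enorm => h1.
have := enorm_ge0 (gradI y - gradI z); rewrite le_eqVlt => /predU1P[<-|x0].
  by rewrite mulr0 enorm_ge0.
rewrite -(ler_pM2r x0) -mulrA -expr2; apply: le_trans h1 _; exact: dotv_le_enorm.
Qed.

Lemma gradIK x : gradI (grad w x) = x.
Proof.
apply/eqP; rewrite -subr_eq0 -enorm_eq0 eq_le enorm_ge0 andbT.
have h1 := sconv_mono (gradI (grad w x)) x sw.
rewrite gradK subrr dotvC dotv0r -sqr_enorm in h1.
rewrite pmulr_rle0// in h1; rewrite leNgt; apply/negP => /(@exprn_gt0 _ 2).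
by rewrite ltNge h1.
Qed.

Lemma continuous_gradI : continuous gradI.
Proof.
move=> y; apply/(@cvgrPdist_lt _ _ _ (nbhs y)) => e e0.
have p0 : 0 < d * e / (n%:R + 1) by rewrite divr_gt0 ?mulr_gt0 ?ltr_wpDl.
apply/(@nbhs_normP R 'cV[R]_n y); exists (d * e / (n%:R + 1)) => //= z; rewrite /ball_/=.
rewrite ltr_pdivlMr ?ltr_wpDl// => yz.
apply: le_lt_trans (norm_le_enorm _) _; rewrite -(ltr_pM2l d0).
apply: le_lt_trans (gradI_lip _ _) _; apply: le_lt_trans (enorm_le_norm _) _.
apply: le_lt_trans yz; rewrite mulrC ler_wpM2l//; lra.
Qed.

Lemma subdiff_gradI x y : subdiff w x y <-> x = gradI y.
Proof.
split => [/(subdiff_grad C1) ->|->]; first by rewrite gradIK.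
have [_ Cv] := sw; move=> z; have := sconv_lower (gradI y) z sw; rewrite gradK.
have : 0 <= d / 2 * dotv (z - gradI y) (z - gradI y).
  by rewrite mulr_ge0 ?dotv_ge0// divr_ge0// ltW.
lra.
Qed.

(** The C^1 case applied to a mollification of f, which is uniformly close to f with support in a
    fixed ball. *)
Lemma change_of_variables f (M : R) : 0 <= M -> continuous f -> supp_in f M ->
  \int[Leb n]_x (f (grad w x) * \det (hessian w x)) = \int[Leb n]_x f x.
Proof.
move=> M0 cf fM.
have cdet : continuous (fun x => \det (hessian w x)).
  apply: cts_det => i j; have [C3 _] := sw; exact: is_Ck_cts (is_Ck_hessian i j C3).
pose M' := (n%:R * (M + 1) + enorm (grad w 0)) / d.
have M10 : 0 <= M + 1 by rewrite addr_ge0.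
have gM x : M' < `|x| -> M + 1 < `|grad w x|.
  by move=> xM; rewrite ltNge; apply/negP => /(grad_coercive M10); rewrite leNgt xM.
have [D hD] := compact_norm_bounded_fun (@compact_ball R n M') cdet.
have M'0 : 0 <= M' by rewrite divr_ge0 ?addr_ge0 ?mulr_ge0 ?enorm_ge0// ltW.
have D0 : 0 <= D by apply: le_trans (hD 0 _); rewrite ?normr_ge0//= normr0.
have cfg (u : 'cV[R]_n -> R) : continuous u -> continuous (fun x => u (grad w x) * \det (hessian w x)).
  move=> cu; apply: ctsM => //.
  exact: (@cts_comp _ _ _ (grad w) u continuous_grad cu).
have sfg (u : 'cV[R]_n -> R) : supp_in u (M + 1) ->
    supp_in (fun x => u (grad w x) * \det (hessian w x)) M'.
  by move=> uM x xM; rewrite uM ?mul0r//; exact: gM.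
(* If the mollified f is within e / E of f, the left integral moves by at most e / E times the first
   summand and the right one by e / E times the second. *)
pose E := D * fine (Leb n (@cball R n M')) + fine (Leb n (@cball R n (M + 1))) + 1.
have E0 : 0 < E by rewrite ltr_wpDl// addr_ge0 ?mulr_ge0 ?fine_ge0.
have fM1 : supp_in f (M + 1) by move=> x xM; apply: fM; lra.
apply/eqP; rewrite -subr_eq0 -normr_le0; apply/ler_addgt0Pr => e e0; rewrite add0r.
have h0 : 0 < e / E by rewrite divr_gt0.
have [r [r0 r1 hr]] := uniform_continuity cf fM h0.
have [k [k3 kr kp k1]] := @exists_kernel R n r r0.
pose fr := cnv k f.
have frf x : `|fr x - f x| <= e / E.
  exact: (cnv_bound (is_Ck_cts k3) kr cf kp k1 (hr x)).
have frM : supp_in fr (M + 1).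
  move=> x xM; apply/eqP; rewrite -normr_le0 -(subr0 (fr x)).
  apply: (cnv_bound (is_Ck_cts k3) kr cf kp k1) => y yr.
  have xyM : M < `|x + y|.
    by have := lerB_dist x (- y); rewrite normrN opprK; lra.
  by rewrite fM// subr0 normr0.
have C3 : is_Ck 3 fr by exact: is_Ck_cnv k3 kr cf.
have cfr := is_Ck_cts C3.
have := change_of_variables_C1 d0 d1 sw M10 (is_Ck_le _ C3) frM => /(_ isT) eqr.
have a1 : `|\int[Leb n]_x (fr (grad w x) * \det (hessian w x)) -
    \int[Leb n]_x (f (grad w x) * \det (hessian w x))| <=
    e / E * D * fine (Leb n (@cball R n M')).
  rewrite -RintegralB//; last 2 first.
  - exact: integrable_continuous_supp (cfg _ cfr) (sfg _ frM).
  - exact: integrable_continuous_supp (cfg _ cf) (sfg _ fM1).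
  apply: abs_integral_le.
  - by rewrite mulr_ge0// ltW.
  - by apply: ctsB; exact: cfg.
  - by move=> x xM; rewrite (sfg _ frM)// (sfg _ fM1)// subrr.
  - move=> x; rewrite -mulrBl normrM; have [xM|xM] := leP `|x| M'.
      by apply: ler_pM => //; exact: hD.
    by rewrite frM ?gM// fM1 ?gM// subrr normr0 mul0r mulr_ge0// ltW.
have a2 : `|\int[Leb n]_x fr x - \int[Leb n]_x f x| <=
    e / E * fine (Leb n (@cball R n (M + 1))).
  rewrite -RintegralB//; last 2 first.
  - exact: integrable_continuous_supp cfr frM.
  - exact: integrable_continuous_supp cf fM1.
  apply: abs_integral_le; [exact: ltW|exact: ctsB| |by []].
  by move=> x xM; rewrite frM// fM1// subrr.
move: a1 a2; rewrite eqr => a1 a2.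
apply: le_trans (_ : e / E * E <= e); last by rewrite divfK ?gt_eqF.
have -> : e / E * E = e / E * D * fine (Leb n (@cball R n M')) +
   e / E * fine (Leb n (@cball R n (M + 1))) + e / E by rewrite {2}/E; ring.
exact: dist_le_aux a1 a2 h0.
Qed.

(** Change of variables applied to f composed with the inverse gradient, whose support is bounded
    because grad w is bounded on balls. *)
Lemma integral_gradI f (M : R) : 0 <= M -> continuous f -> supp_in f M ->
  \int[Leb n]_x (f x * \det (hessian w x)) = \int[Leb n]_y f (gradI y).
Proof.
move=> M0 cf fM.
have : exists2 G, 0 <= G & forall x, `|x| <= M -> `|grad w x| <= G.
  have : compact (grad w @` [set x : 'cV[R]_n | `|x| <= M]).
    apply: continuous_compact; last exact: compact_ball.
    exact: continuous_subspaceT continuous_grad.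
  move=> /compact_norm_bounded[G' hG']; exists `|G'| => // x xM.
  by apply: le_trans (ler_norm _); apply: hG'; exists x.
move=> [G' G'0 hG'].
rewrite -(@change_of_variables (fun y => f (gradI y)) G')//.
- by apply: eq_Rintegral => x _; rewrite gradIK.
- exact: (@cts_comp _ _ _ gradI f continuous_gradI cf).
- move=> y yG; apply: fM; rewrite ltNge; apply/negP => /hG'.
  by rewrite gradK leNgt yG.
Qed.

End strongly_convex.
End change_of_variables.

(** * Images of compact sets under the subdifferential *)

Section subdifferential.
Context {R : realType} {n : nat}.
Implicit Types (x y z : 'cV[R]_n) (w : 'cV[R]_n -> R).

Definition subim w (K : set 'cV[R]_n) : set 'cV[R]_n := \bigcup_(x in K) subdiff w x.

Lemma subimU w A B : subim w (A `|` B) = subim w A `|` subim w B.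
Proof. exact: bigcup_setU. Qed.

(** Test the subgradient inequality at the point x + y / |y|. *)
Lemma subdiff_norm_le w (C M : R) x y : (forall z, `|z| <= M + 1 -> `|w z| <= C) ->
  `|x| <= M -> subdiff w x y -> enorm y <= 2 * C.
Proof.
move=> wC xM sy.
have hx : `|w x| <= C by apply: wC; lra.
have [->|y0] := eqVneq y 0.
  have /eqP -> : enorm (0 : 'cV[R]_n) == 0 by rewrite enorm_eq0.
  by rewrite mulr_ge0// (le_trans _ hx).
have e0 : 0 < enorm y by rewrite enorm_gt0.
pose z := x + (enorm y)^-1 *: y.
have hz : `|w z| <= C.
  apply: wC; apply: le_trans (ler_normD _ _) _; rewrite lerD// normrZ.
  by rewrite gtr0_norm ?invr_gt0// mulrC ler_pdivrMr// mul1r norm_le_enorm.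
have := sy z; have -> : z - x = (enorm y)^-1 *: y by rewrite /z addrC addKr.
rewrite dotvZr -sqr_enorm expr2 mulKf ?gt_eqF//.
move: hx hz; rewrite !ler_norml => /andP[a1 a2] /andP[b1 b2]; lra.
Qed.

(** If y is not a subgradient at x, a single z violates the inequality, and by continuity it does so
    for nearby pairs; compactness of K makes the neighbourhood of y uniform. *)
Lemma subim_closed w K : continuous w -> compact K -> closed (subim w K).
Proof.
move=> cw /compact_near_coveringP nc; rewrite -[X in closed X]setCK; apply: open_closedC.
rewrite openE => y yN; rewrite /interior.
have : \forall y' \near y, K `<=` (fun x => ~ subdiff w x y').
  apply: (nc _ (nbhs y) (fun y' x => ~ subdiff w x y') _) => x Kx.
  have : ~ subdiff w x y by move=> sy; apply: yN; exists x.
  move=> /existsNP[z /negP]; rewrite -ltNge dotvBr => zlt.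
  have c1 : continuous (fun p : 'cV[R]_n * 'cV[R]_n => p.1) by move=> p; exact: cvg_fst.
  have c2 : continuous (fun p : 'cV[R]_n * 'cV[R]_n => p.2) by move=> p; exact: cvg_snd.
  have cf : continuous (fun p : 'cV[R]_n * 'cV[R]_n => w p.1 + (dotv p.2 z - dotv p.2 p.1)).
    apply: ctsD; first exact: (@cts_comp _ _ _ _ w c1 cw).
    by apply: ctsB; [exact: continuous_dotv c2 (@ctsCv _ _ _ z)|exact: continuous_dotv c2 c1].
  have [[A B] /= [nA nB] hAB] := @cvgr_gt _ _ _ _ _ _ (cf (x, y)) _ zlt.
  exists (A, B) => //= -[x' y'] AB sy.
  by have := hAB (x', y') AB; have := sy z; rewrite /= dotvBr; lra.
by apply: filterS => y' h [x Kx sy]; exact: (h x Kx).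
Qed.

Lemma subim_compact w K : continuous w -> compact K -> compact (subim w K).
Proof.
move=> cw cK; have [M KM] := compact_norm_bounded cK.
have [C wC] := compact_norm_bounded_fun (@compact_ball R n (M + 1)) cw.
apply: (@closed_norm_compact _ _ _ (2 * C)); first exact: subim_closed.
move=> y [x Kx sy]; apply: le_trans (norm_le_enorm _) _.
by apply: (subdiff_norm_le wC (KM x Kx) sy).
Qed.

End subdifferential.

(** * Limits of inverse gradients *)

Lemma segment_contradiction (R : realDomainType) (t wz wx wX yX yx h wkz wkx : R) :
  wkz <= t * wX + (1 - t) * wkx ->
  wX - yX <= wkx - yx ->
  wx - yx + 3 * h <= wz - (t * yX + (1 - t) * yx) ->
  0 < h -> 0 <= t -> `|wkx - wx| <= h -> `|wkz - wz| <= h -> False.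
Proof.
rewrite !ler_norml => a1 a2 a3 h0 t0 /andP[b1 b2] /andP[c1 c2].
have : 0 <= t * (wkx - yx - (wX - yX)) by apply: mulr_ge0 => //; rewrite subr_ge0.
lra.
Qed.

Section gradI_limit.
Context {R : realType} {n : nat}.
Implicit Types (x y z : 'cV[R]_n).

(** Locally uniform convergence. *)
Definition lucvg (wk : nat -> 'cV[R]_n -> R) (w : 'cV[R]_n -> R) := forall M h : R, 0 < h ->
  \forall k \near \oo, forall x, `|x| <= M -> `|wk k x - w x| <= h.

Lemma sconv_conv (d : R) (w : 'cV[R]_n -> R) : 0 < d -> sconv d w -> is_Conv w.
Proof.
move=> d0 [_ cv]; have d2 : 0 <= d / 2 by rewrite divr_ge0// ltW.
have := is_ConvD cv (is_ConvZ d2 (@is_Conv_sqnorm R n)).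
by under eq_fun do rewrite subrK.
Qed.

Variables (wk : nat -> 'cV[R]_n -> R) (w : 'cV[R]_n -> R) (d : nat -> R).
Hypotheses (d0 : forall k, 0 < d k) (sw : forall k, sconv (d k) (wk k)).
Hypotheses (lu : lucvg wk w) (cw : continuous w).

Let X k y := gradI (d0 k) (sw k) y.

Let Xmin k y z : wk k (X k y) - dotv y (X k y) <= wk k z - dotv y z.
Proof.
have /subdiff_gradI/(_ z) : X k y = gradI (d0 k) (sw k) y by [].
rewrite dotvBr; lra.
Qed.

(** The inverse gradient of w_k at y minimises w_k - <y, .>, and x is the only minimiser of w - <y,
    .>. On the sphere of radius e about x the latter exceeds its minimum by 3 h. If the k-th
    minimiser were outside, convexity on the segment to x would contradict this gap at the sphere
    once w_k is h-close to w. *)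
Lemma gradI_cvg y x : subdiff w x y -> (forall x', subdiff w x' y -> x' = x) ->
  (fun k => gradI (d0 k) (sw k) y) @ \oo --> x.
Proof.
move=> sx ux; pose p z := w z - dotv y z.
have cp : continuous p.
  by apply: ctsB => //; exact: continuous_dotv (@ctsCv _ _ _ y) (@cts_id _).
have pmin z : p x <= p z by have := sx z; rewrite /p dotvBr; lra.
have pmin' z : z != x -> p x < p z.
  move=> zx; rewrite lt_neqAle pmin andbT; apply: contraNneq zx => xz; apply/eqP/ux => z'.
  by have := pmin z'; rewrite xz /p dotvBr; lra.
apply/(@cvgrPdist_le _ _ _ \oo) => e e0.
have [h h0 hS] : exists2 h, 0 < h & forall z, `|z - x| = e -> p x + 3 * h <= p z.
  pose S := [set z : 'cV[R]_n | `|z| <= `|x| + e] `&` [set z | e <= `|z - x|].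
  have [[z0 Sz0]|S0] := pselect (S !=set0); last first.
    exists 1 => // z ze; exfalso; apply: S0; exists z; split => /=; last by rewrite ze.
    by rewrite -[z](subrK x); apply: le_trans (ler_normD _ _) _; rewrite ze addrC.
  have cS : compact S.
    apply: compact_closedI; first exact: compact_ball.
    have cn : continuous (fun z : 'cV[R]_n => `|z - x|).
      have c1 : continuous (fun z : 'cV[R]_n => z - x).
        by apply: ctsDv; [exact: cts_id|exact: ctsCv].
      exact: (@cts_comp _ _ _ _ (fun z : 'cV[R]_n => `|z|) c1 (@norm_continuous R 'cV[R]_n)).
    exact: (closed_comp (fun z _ => cn z) (@closed_ge R e)).
  have [z1 /set_mem[_ /= z1e] z1min] :=
    compact_EVT_min (ex_intro _ z0 Sz0) cS (continuous_subspaceT cp).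
  have z1x : z1 != x by apply: contraTneq z1e => ->; rewrite subrr normr0 -ltNge.
  exists ((p z1 - p x) / 3) => [|z ze].
    by have := pmin' _ z1x; lra.
  rewrite mulrC divfK// addrC subrK; apply: z1min; apply/mem_set; split => /=.
    by rewrite -[z](subrK x); apply: le_trans (ler_normD _ _) _; rewrite ze addrC.
  by rewrite ze.
have := lu (`|x| + e) h0; apply: filterS => k hk; rewrite leNgt; apply/negP => ke.
have {}ke : e < `|X k y - x| by rewrite distrC.
set N := `|X k y - x| in ke; have N0 : 0 < N by exact: lt_trans ke.
pose t := e / N; have t0 : 0 < t by rewrite divr_gt0.
have t1 : t <= 1 by rewrite ler_pdivrMr// mul1r ltW.
pose z := t *: X k y + (1 - t) *: x.
have zx : `|z - x| = e.
  have -> : z - x = t *: (X k y - x) by apply/colP => i; rewrite !mxE; ring.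
  by rewrite normrZ gtr0_norm// -/N /t divfK ?gt_eqF.
have zb : `|z| <= `|x| + e.
  by rewrite -[z](subrK x); apply: le_trans (ler_normD _ _) _; rewrite zx addrC.
have xb : `|x| <= `|x| + e by rewrite lerDl ltW.
have := hk _ zb; have := hk _ xb; have := hS _ zx; rewrite /p.
have := Xmin k y x.
have /is_ConvP/(_ t (X k y) x) := sconv_conv (d0 k) (sw k).
rewrite (ltW t0) t1 => /(_ isT); rewrite -/z.
have -> : dotv y z = t * dotv y (X k y) + (1 - t) * dotv y x by rewrite dotvDr !dotvZr.
move=> a1 a2 a3 a4 a5; exact: segment_contradiction a1 a2 a3 h0 (ltW t0) a4 a5.
Qed.

(** If y is nowhere a subgradient, each x is beaten by some z for w - <y, .>, hence also for w_k,
    near x and for large k. Compactness of the ball excludes all its points at once. *)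
Lemma gradI_escape y (M : R) : (forall x, ~ subdiff w x y) ->
  \forall k \near \oo, M < `|gradI (d0 k) (sw k) y|.
Proof.
move=> ny; pose p z := w z - dotv y z.
have cp : continuous p.
  by apply: ctsB => //; exact: continuous_dotv (@ctsCv _ _ _ y) (@cts_id _).
have /compact_near_coveringP nc := @compact_ball R n M.
have : \forall k \near \oo, [set x : 'cV[R]_n | `|x| <= M] `<=` (fun x => X k y <> x).
  apply: (nc _ _ (fun k x => X k y <> x) _) => x _.
  have /existsNP[z /negP] := ny x; rewrite -ltNge => zlt.
  have pz : p z < p x by move: zlt; rewrite /p dotvBr; lra.
  have h0 : 0 < (p x - p z) / 4 by lra.
  have /cvgrPdist_lt/(_ _ h0) near1 := cp x.
  have near2 : \forall x' \near x, `|x'| <= `|x| + 1.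
    have h : `|x| < `|x| + 1 by rewrite ltrDl.
    have /cvgr_lt/(_ _ h) := @norm_continuous R 'cV[R]_n x.
    by apply: filterS => x' /ltW.
  have near3 := lu (`|x| + 1 + `|z|) h0.
  exists ([set x' | `|p x - p x'| < (p x - p z) / 4] `&` [set x' | `|x'| <= `|x| + 1],
     [set k | forall x', `|x'| <= `|x| + 1 + `|z| -> `|wk k x' - w x'| <= (p x - p z) / 4]).
    by split => //=; exact: filterI.
  move=> [x' k] /= [[a1 a2] a3] xk.
  have b1 : `|x'| <= `|x| + 1 + `|z| by have := normr_ge0 z; lra.
  have b2 : `|z| <= `|x| + 1 + `|z| by have := normr_ge0 x; lra.
  have := a3 _ b1; have := a3 _ b2; have := Xmin k y z; rewrite xk.
  move: a1; rewrite /p ltr_norml !ler_norml => /andP[? ?] ? /andP[? ?] /andP[? ?]; lra.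
apply: filterS => k hk; rewrite ltNge; apply/negP => /hk; exact.
Qed.

(** Subgradients taken on a ball are bounded by the oscillation of w_k on a larger ball, which is
    controlled uniformly in k. *)
Lemma gradI_bounded (M : R) : exists G, 0 <= G /\ \forall k \near \oo,
  forall y, `|gradI (d0 k) (sw k) y| <= M -> `|y| <= G.
Proof.
have [C wC] := compact_norm_bounded_fun (@compact_ball R n (M + 1)) cw.
exists (2 * `|C| + 2); split; first by rewrite addr_ge0// mulr_ge0.
have := lu (M + 1) (@ltr01 R); apply: filterS => k hk y yM.
have wkC z : `|z| <= M + 1 -> `|wk k z| <= `|C| + 1.
  move=> zM; have := hk z zM; have := wC z zM; have := ler_norm C.
  by have := ler_normD (wk k z - w z) (w z); rewrite subrK; lra.
have sy : subdiff (wk k) (X k y) y by apply/(subdiff_gradI (d0 k) (sw k)).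
apply: le_trans (norm_le_enorm _) _.
by have := subdiff_norm_le wkC yM sy; lra.
Qed.

End gradI_limit.

(** * The Monge-Ampere measure as an image of Lebesgue measure *)

Section weak_convergence.
Context {R : realType} {n : nat}.
Implicit Types (x y z : 'cV[R]_n) (f : 'cV[R]_n -> R).
Variables (n0 : (0 < n)%N) (w : 'cV[R]_n -> R) (cvw : is_Conv w).
Variables (mu : {measure set (borelR R n) -> \bar R}).
Hypothesis muE : forall B : set (borelR R n), measurable B -> MA w B = mu B.

Let cw : continuous w := is_Conv_continuous cvw.

Let msub (K : set 'cV[R]_n) : compact K -> measurable (subim w K : set (borelR R n)).
Proof. by move=> cK; apply: closed_measurable_cV; exact: subim_closed. Qed.

Let mcompact (K : set 'cV[R]_n) : compact K -> measurable (K : set (borelR R n)).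
Proof. by move=> cK; apply: closed_measurable_cV; exact: compact_closed_cV. Qed.

Lemma mu_compact (K : set 'cV[R]_n) : compact K -> mu K = Leb n (subim w K).
Proof.
move=> cK; rewrite -muE; last exact: mcompact.
by rewrite /MA (hausdorff_compact n0)//; exact: subim_compact.
Qed.

Lemma Leb_compact_lty (K : set 'cV[R]_n) : compact K -> (Leb n (K : set (borelR R n)) < +oo)%E.
Proof.
move=> cK; have [M KM] := compact_norm_bounded cK.
apply: le_lt_trans (@Leb_ball_lty R n M); apply: le_measure; rewrite ?inE.
- exact: mcompact.
- exact: measurable_ball_cV.
- by move=> x /KM.
Qed.

Lemma mu_ball_lty (M : R) : (mu (@cball R n M) < +oo)%E.
Proof.
rewrite mu_compact; last exact: compact_ball.
by apply: Leb_compact_lty; apply: subim_compact => //; exact: compact_ball.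
Qed.

(** [MA w] agrees with a measure, so it is additive on K1 and K2; comparing with inclusion-exclusion
    for the images leaves no mass for their overlap. *)
Lemma Leb_subim_setI (K1 K2 : set 'cV[R]_n) : compact K1 -> compact K2 ->
  K1 `&` K2 = set0 -> Leb n (subim w K1 `&` subim w K2) = 0%E.
Proof.
move=> c1 c2 K12; have c12 := compactU c1 c2.
have : mu (K1 `|` K2) = (mu K1 + mu K2)%E.
  by apply: measureU => //; exact: mcompact.
rewrite (mu_compact c12) (mu_compact c1) (mu_compact c2) subimU.
have fin K : compact K -> (Leb n (subim w K) < +oo)%E.
  by move=> cK; apply: Leb_compact_lty; exact: subim_compact.
set A : set (borelR R n) := subim w K1; set B : set (borelR R n) := subim w K2.
have mA : measurable A by exact: msub.
have mB : measurable B by exact: msub.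
have -> : Leb n (A `|` B) = (Leb n A + Leb n B - Leb n (A `&` B))%E.
  by apply: measureUfinr => //; exact: fin.
have fA : Leb n A \is a fin_num by rewrite ge0_fin_numE//; exact: fin.
have fB : Leb n B \is a fin_num by rewrite ge0_fin_numE//; exact: fin.
have fAB : Leb n (A `&` B) \is a fin_num.
  rewrite ge0_fin_numE//; apply: le_lt_trans (fin _ c1).
  by apply: measureIl.
move: fA fB fAB; move: (Leb n A) (Leb n B) (Leb n (A `&` B)).
move=> [a| |] [b| |] [c| |] //= _ _ _ [].
by rewrite -[RHS]addr0 => /addrI/eqP; rewrite oppr_eq0 => /eqP ->.
Qed.

Let half1 (i : 'I_n) (q : rat) (m : nat) := [set x : 'cV[R]_n | `|x| <= m%:R] `&` [set x | x i 0 <= ratr q].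
Let half2 (i : 'I_n) (p : rat) (m : nat) := [set x : 'cV[R]_n | `|x| <= m%:R] `&` [set x | ratr p <= x i 0].

Let chalf1 i q m : compact (half1 i q m).
Proof.
apply: compact_closedI; first exact: compact_ball.
exact: (closed_comp (fun x _ => @continuous_coord R n i x) (@closed_le R (ratr q))).
Qed.

Let chalf2 i q m : compact (half2 i q m).
Proof.
apply: compact_closedI; first exact: compact_ball.
exact: (closed_comp (fun x _ => @continuous_coord R n i x) (@closed_ge R (ratr q))).
Qed.

(** Slopes attained on both sides of a rational slab q < x_i < p, within a ball of radius m. Two
    distinct points are separated by such a slab, so these countably many null sets catch every
    slope attained twice. *)
Let A_ (t : 'I_n * rat * rat * nat) : set (borelR R n) :=
  let: (i, q, p, m) := t in
  if q < p then subim w (half1 i q m) `&` subim w (half2 i p m) else set0.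

Let mA_ t : measurable (A_ t).
Proof.
case: t => -[[i q] p] m; rewrite /A_; case: ifP => // _.
by apply: measurableI; apply: msub.
Qed.

Let A_0 t : Leb n (A_ t) = 0%E.
Proof.
case: t => -[[i q] p] m; rewrite /A_; case: ifPn => [qp|_]; last exact: measure0.
apply: Leb_subim_setI => //; rewrite -subset0 => x [[_ /= h1] [_ /= h2]].
by have := le_trans h2 h1; rewrite ler_rat leNgt qp.
Qed.

Let S_ (k : nat) : set (borelR R n) := if unpickle k is Some t then A_ t else set0.

Let mS_ k : measurable (S_ k).
Proof. by rewrite /S_; case: unpickle. Qed.

Definition sing_val : set (borelR R n) := \bigcup_k S_ k.

Lemma measurable_sing_val : measurable sing_val.
Proof. exact: bigcup_measurable. Qed.

Lemma Leb_sing_val : Leb n sing_val = 0%E.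
Proof.
apply/eqP; rewrite -measure_le0.
have := @measure_sigma_subadditive _ _ _ (Leb n) sing_val S_ mS_ measurable_sing_val
  (@subset_refl _ _).
by rewrite eseries0// => k _ _; rewrite /S_; case: unpickle => [t|]; [exact: A_0|exact: measure0].
Qed.

Lemma subdiff_uniq y x1 x2 : ~ sing_val y -> subdiff w x1 y -> subdiff w x2 y -> x1 = x2.
Proof.
move=> yN.
suff key x x' i : x i 0 < x' i 0 -> subdiff w x y -> subdiff w x' y -> False.
  move=> s1 s2; apply/colP => i; have [h|h|//] := ltgtP (x1 i 0) (x2 i 0).
    by case: (key _ _ _ h s1 s2).
  by case: (key _ _ _ h s2 s1).
move=> xx' s1 s2; apply: yN.
have [q] := rat_in_itvoo xx'; rewrite in_itv/= => /andP[q1 q2].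
have [p] := rat_in_itvoo q2; rewrite in_itv/= => /andP[p1 p2].
pose m := Num.bound (`|x| + `|x'|).
have mb : `|x| + `|x'| < m%:R by apply: archi_boundP; rewrite addr_ge0.
exists (pickle (i, q, p, m)); first exact: Logic.I.
rewrite /S_ pickleK /A_.
rewrite ltr_rat in p1; rewrite p1; split.
  exists x => //; split => /=; last exact: ltW.
  by have := normr_ge0 x'; lra.
exists x' => //; split => /=; last exact: ltW.
by have := normr_ge0 x; lra.
Qed.

Definition reg_val : set (borelR R n) :=
  (\bigcup_m subim w [set x : 'cV[R]_n | `|x| <= m%:R]) `\` sing_val.

Lemma measurable_reg_val : measurable reg_val.
Proof.
apply: measurableD; last exact: measurable_sing_val.
by apply: bigcup_measurable => m _; apply: msub; exact: compact_ball.
Qed.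

(** On [reg_val], the slopes attained exactly once, the unique point of attainment; the default 0 is
    used elsewhere. *)
Definition inv_subdiff y : 'cV[R]_n :=
  if `[< reg_val y >] then xget 0 [set x | subdiff w x y] else 0.

Lemma inv_subdiffP y x : reg_val y -> (subdiff w x y <-> x = inv_subdiff y).
Proof.
move=> ry; have [[m _ [x0 _ s0]] yN] := ry.
have sI : subdiff w (inv_subdiff y) y.
  by rewrite /inv_subdiff asboolT//; case: xgetP => [x1 -> //|/(_ x0)].
by split => [sx|->//]; exact: subdiff_uniq sI.
Qed.

Lemma reg_valP y : ~ sing_val y -> ~ reg_val y -> forall x, ~ subdiff w x y.
Proof.
move=> yN yr x sx; apply: yr; split => //.
have h : `|x| < (Num.bound `|x|)%:R by exact: archi_boundP.
by exists (Num.bound `|x|) => //; exists x => //=; exact: ltW.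
Qed.

(** Expresses preimages of closed sets through subdifferential images of compact sets, which are
    closed; this is the source of measurability. *)
Lemma inv_subdiff_closed (C : set 'cV[R]_n) : closed C ->
  reg_val `&` inv_subdiff @^-1` C =
  reg_val `&` \bigcup_m subim w ([set x : 'cV[R]_n | `|x| <= m%:R] `&` C).
Proof.
move=> cC; apply/seteqP; split => y [ry h]; split => //.
  have /(inv_subdiffP _ ry) sI := erefl (inv_subdiff y).
  have hx : `|inv_subdiff y| < (Num.bound `|inv_subdiff y|)%:R.
    by exact: archi_boundP.
  exists (Num.bound `|inv_subdiff y|) => //; exists (inv_subdiff y) => //.
  by split => //=; exact: ltW.
by have [m _ [x [_ Cx] /(inv_subdiffP _ ry) xE]] := h; rewrite /preimage/= -xE.
Qed.

Lemma measurable_inv_subdiff : measurable_fun setT (inv_subdiff : borelR R n -> borelR R n).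
Proof.
have mC (C : set 'cV[R]_n) : closed C -> measurable (inv_subdiff @^-1` C : set (borelR R n)).
  move=> cC; rewrite -(setUIDK (inv_subdiff @^-1` C) reg_val); apply: measurableU.
    rewrite setIC inv_subdiff_closed//; apply: measurableI; first exact: measurable_reg_val.
    apply: bigcup_measurable => m _; apply: msub; apply: compact_closedI => //.
    exact: compact_ball.
  have h y : ~ reg_val y -> inv_subdiff y = 0.
    by move=> /asboolPn; rewrite /inv_subdiff => /negbTE ->.
  have mR : measurable (~` reg_val) by apply: measurableC; exact: measurable_reg_val.
  have [C0|C0] := pselect (C 0).
    rewrite (_ : _ `\` _ = ~` reg_val)//; apply/seteqP; split => y; first by case.
    by move=> ry; split => //=; rewrite h.
  rewrite (_ : _ `\` _ = set0)//; rewrite -subset0 => y [/= + ry].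
  by rewrite h.
have mE : @measurable _ (borelR R n) = <<s (@open 'cV[R]_n : set (set (borelR R n))) >> by [].
move=> mT; move: (mT); apply: (measurability _ mE); move=> _ [U oU <-]; rewrite setTI -[U]setCK -preimage_setC.
by apply: measurableC; apply: mC; exact: open_closedC.
Qed.

Let nu := pushforward (mrestr (Leb n) measurable_reg_val)
  (inv_subdiff : borelR R n -> borelR R n).

Let nuM : {measure set (borelR R n) -> \bar R} :=
  measure_function_pushforward__canonical__measure_function_Measure
    (mrestr (Leb n) measurable_reg_val) measurable_inv_subdiff.

Lemma compact_sigma_algebra :
  @measurable _ (borelR R n) = <<s (@compact 'cV[R]_n : set (set (borelR R n))) >>.
Proof.
apply/seteqP; split.
  apply: smallest_sub; first exact: smallest_sigma_algebra.
  have sC (C : set 'cV[R]_n) : closed C ->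
      (<<s (@compact 'cV[R]_n : set (set (borelR R n))) >>) C.
    move=> cC; have -> : C = \bigcup_m ([set x : 'cV[R]_n | `|x| <= m%:R] `&` C).
      apply/seteqP; split => x; last by case=> m _ [].
      have : `|x| < (Num.bound `|x|)%:R by exact: archi_boundP.
      by move=> /ltW h Cx; exists (Num.bound `|x|).
    apply: sigma_algebra_bigcup => m; apply: sub_sigma_algebra.
    by apply: compact_closedI => //; exact: compact_ball.
  move=> U oU; rewrite -[U]setCK -setTD; apply: sigma_algebraCD.
  by apply: sC; exact: open_closedC.
apply: smallest_sub; first exact: sigma_algebra_measurable.
by move=> K cK; exact: mcompact.
Qed.

(** Both measures agree on compact sets, a generating pi-system: for compact K they are the Lebesgue
    measures of [subim w K] with and without the null set [sing_val]. *)
Lemma mu_pushforward (A : set (borelR R n)) : measurable A -> mu A = nuM A.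
Proof.
pose G : set (set (borelR R n)) := @compact 'cV[R]_n.
have h1 : setI_closed G.
  by move=> K1 K2 c1 c2; apply: compact_closedI => //; exact: compact_closed_cV.
have h2 k : G (@cball R n k%:R) by exact: compact_ball.
have h3 : \bigcup_k @cball R n k%:R = setT.
  apply/seteqP; split => // x _; exists (Num.bound `|x|) => //=.
  by rewrite /cball /= ltW//; exact: archi_boundP.
have h4 K : G K -> mu K = nuM K.
  move=> cK; rewrite mu_compact//.
  have -> : nuM K = Leb n (reg_val `&` inv_subdiff @^-1` K) by rewrite setIC.
  have mS := msub cK; have mN := measurable_sing_val.
  have -> : reg_val `&` inv_subdiff @^-1` K = (subim w K : set (borelR R n)) `\` sing_val.
    apply/seteqP; split => y.
      move=> [ry /= Ky]; split; last by case: ry.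
      by exists (inv_subdiff y) => //; exact/inv_subdiffP.
    move=> [[x Kx sx] yN].
    have ry : reg_val y by apply: contrapT => /(reg_valP yN)/(_ x); exact.
    by split => //; have /(inv_subdiffP _ ry) xE := sx; rewrite /preimage/= -xE.
  have e : Leb n (subim w K) = (Leb n ((subim w K : set (borelR R n)) `\` sing_val) +
      Leb n ((subim w K : set (borelR R n)) `&` sing_val))%E by apply: measureDI.
  have e0 : Leb n ((subim w K : set (borelR R n)) `&` sing_val) = 0%E.
    apply/eqP; rewrite -measure_le0 -Leb_sing_val; exact: (measureIr (Leb n) mS mN).
  by move: e; rewrite e0 adde0.
have h5 k : (mu (@cball R n k%:R) < +oo)%E by exact: mu_ball_lty.
move=> mA; exact: (measure_unique G _ compact_sigma_algebra h1 h2 h3 _ _ h4 h5 _ mA).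
Qed.

Lemma integral_inv_subdiff f (M : R) : continuous f -> supp_in f M ->
  mu.-integrable setT (EFin \o f) /\
  (\int[mu]_x (f x)%:E = \int[Leb n]_(y in reg_val) (f (inv_subdiff y))%:E)%E.
Proof.
move=> cf fM; have mf := continuous_measurable_cV cf.
have [C fC] := continuous_supp_bounded cf fM.
have i1 : mu.-integrable setT (EFin \o f).
  by apply: (integrable_bounded_supp _ mf fC fM); exact: mu_ball_lty.
split => //.
have i2 : nuM.-integrable setT (EFin \o f).
  apply: (integrable_bounded_supp _ mf fC fM).
  by rewrite -mu_pushforward; [exact: mu_ball_lty|exact: measurable_ball_cV].
pose rest : {measure set (borelR R n) -> \bar R} := [the measure _ _ of mrestr (Leb n) measurable_reg_val].
pose T : borelR R n -> borelR R n := inv_subdiff.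
pose F : borelR R n -> \bar R := fun x => (f x)%:E.
have mT : measurable_fun setT T := measurable_inv_subdiff.
have mF : measurable_fun setT F by exact/measurable_EFinP.
have mFT : measurable_fun setT (F \o T) by exact: measurableT_comp.
have i3 : rest.-integrable setT (F \o T).
  apply/integrableP; split => //.
  have /integrableP[_] := i2; apply: le_lt_trans.
  have := @ge0_integral_pushforward _ _ _ _ _ _ mT rest setT (fun x => `|F x|%E) measurableT.
  by rewrite preimage_setT => -> //; exact: measurableT_comp.
have -> : (\int[mu]_x F x = \int[nuM]_x F x)%E.
  by apply: eq_measure_integral => A mA _; exact: mu_pushforward.
have -> : (\int[nuM]_x F x = \int[rest]_x (F \o T) x)%E.
  exact: (integral_pushforward mT mF i3 measurableT).
have mC : measurable (~` reg_val) by apply: measurableC; exact: measurable_reg_val.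
have r0 : rest (~` reg_val) = 0%E.
  by rewrite /rest /= /mrestr setICl measure0.
rewrite (negligible_integral mC measurableT i3 r0) setTD setCK.
by apply: eq_measure_integral => A mA Ar; rewrite /rest /= /mrestr setIidl.
Qed.

(** By [integral_gradI] the left side integrates f along the inverse gradients. At slopes in
    [reg_val] these converge to [inv_subdiff]; at slopes attained nowhere they leave the support of
    f; other slopes are negligible. [gradI_bounded] provides a common bounded support, hence
    domination. *)
Theorem weak_convergence (wk : nat -> 'cV[R]_n -> R) (d : nat -> R) f (M : R) :
  (forall k, 0 < d k) -> (forall k, d k <= 1) -> (forall k, sconv (d k) (wk k)) ->
  lucvg wk w -> 0 <= M -> continuous f -> supp_in f M ->
  mu.-integrable setT (EFin \o f) /\
  (fun k => \int[Leb n]_x (f x * \det (hessian (wk k) x))) @ \oo --> \int[mu]_x f x.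
Proof.
move=> d0 d1 sw lu M0 cf fM.
have [i1 iE] := integral_inv_subdiff cf fM; split => //.
have [G [G0 [K _ hK]]] := gradI_bounded d0 sw lu cw M.
have [C fC] := continuous_supp_bounded cf fM.
have C0 : 0 <= C by apply: le_trans (fC 0); exact: normr_ge0.
(* The support bound G holds only from index K on; the shift makes it hold for all terms. *)
pose fk k (y : 'cV[R]_n) := f (gradI (d0 (k + K)%N) (sw (k + K)%N) y).
have cfk k : continuous (fk k).
  exact: (@cts_comp _ _ _ (gradI (d0 (k + K)%N) (sw (k + K)%N)) f (@continuous_gradI _ _ _ _ (d0 (k + K)%N) (sw (k + K)%N)) cf).
have fkG k : supp_in (fk k) G.
  move=> y yG; apply: fM; rewrite ltNge; apply/negP => /(hK (k + K)%N (leq_addl _ _)).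
  by rewrite leNgt yG.
pose D := @cball R n G; have mD : measurable D by exact: measurable_ball_cV.
have iD : (Leb n).-integrable setT (EFin \o (fun x => C * (\1_D x : R))).
  apply: (@integrable_bounded_supp R n (Leb n) _ C G).
  - exact: Leb_ball_lty.
  - by apply: measurable_funM => //; exact: measurable_indic.
  - move=> x; rewrite indicE; case: (x \in D); rewrite ?mulr1 ?mulr0 ?normr0//.
    by rewrite ger0_norm.
  - move=> x xM; rewrite indicE memNset ?mulr0//=.
    by apply/negP; rewrite -ltNge.
pose fl := (fun y : borelR R n => (f (inv_subdiff y))%:E) \_ reg_val.
have mfk k : measurable_fun setT (fun y : borelR R n => (fk k y)%:E).
  by apply/measurable_EFinP; exact: continuous_measurable_cV.
have mfl : measurable_fun setT fl.
  apply/(measurable_restrictT _ measurable_reg_val).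
  have mf : measurable_fun setT (fun x : borelR R n => (f x)%:E).
    by apply/measurable_EFinP; exact: continuous_measurable_cV.
  have mT : measurable_fun reg_val (inv_subdiff : borelR R n -> borelR R n).
    exact: measurable_funS measurable_inv_subdiff.
  exact: (measurableT_comp mf mT).
have cae : {ae Leb n, forall y, setT y -> (fun k => (fk k y)%:E) @ \oo --> fl y}.
  exists sing_val; split; [exact: measurable_sing_val|exact: Leb_sing_val|].
  move=> y /= ncv; apply: contrapT => yN; apply: ncv => _.
  have cE (r : R) : (fun k => fk k y) @ \oo --> r -> (fun k => (fk k y)%:E) @ \oo --> r%:E.
    by move=> hr; apply/fine_cvgP; split => //; exact: nearW.
  have [ry|ry] := pselect (reg_val y).
    rewrite /fl patchE mem_set//=.
    have /(inv_subdiffP _ ry) sI := erefl (inv_subdiff y).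
    have uI x' : subdiff w x' y -> x' = inv_subdiff y by move=> /(inv_subdiffP _ ry).
    have c1 := gradI_cvg d0 sw lu cw sI uI.
    have c2 : (fun k => f (gradI (d0 k) (sw k) y)) @ \oo --> f (inv_subdiff y).
      by apply: (cvg_comp _ f c1); exact: cf.
    by apply: cE; move: c2; rewrite -(@cvg_shiftn K).
  rewrite /fl patchE memNset//=; apply: cE.
  have [K' _ hK'] := gradI_escape d0 sw lu cw M (reg_valP yN ry).
  apply: cvg_near_cst; exists K' => // k /= K'k; rewrite /fk fM//.
  by apply: hK' => /=; rewrite (leq_trans K'k)// leq_addr.
have bae : {ae Leb n, forall y k, setT y -> (`|(fk k y)%:E| <= (C * \1_D y)%:E)%E}.
  apply: aeW => y k _; rewrite lee_fin indicE.
  have [yD|yD] := boolP (y \in D); first by rewrite mulr1; exact: fC.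
  rewrite mulr0 fkG ?normr0//; move: yD; rewrite notin_setE /D /cball /= => /negP.
  by rewrite -ltNge.
have [_ _] := dominated_convergence measurableT mfk mfl cae iD bae.
have -> : (\int[Leb n]_x fl x = (\int[mu]_x f x)%:E)%E.
  rewrite /fl -integral_mkcond -iE /Rintegral fineK//; exact: integrable_fin_num.
move=> /fine_cvg h; rewrite -(@cvg_shiftn K).
apply: cvg_trans h; apply: near_eq_cvg; apply: nearW => k /=.
by rewrite (@integral_gradI _ _ _ _ (d0 (k + K)%N) (d1 _) (sw (k + K)%N) f M).
Qed.

End weak_convergence.

From mathcomp Require Import spectral sesquilinear complex.

(** * Elementary symmetric functions of eigenvalues *)

Section symmetric_eigenvalues.
Context {R : realType} {n : nat}.
Local Notation toC := (real_complex R).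

(** Over R[i] the matrix is Hermitian, hence unitarily diagonalisable with real eigenvalues; the
    factorisation descends to R because polynomials over R embed injectively. *)
Lemma char_poly_symmetric (A : 'M[R]_n) : A^T = A ->
  exists s : n.-tuple R, char_poly A = \prod_(a <- s) ('X - a%:P).
Proof.
move=> As; pose AC : 'M[R[i]]_n := map_mx toC A.
have ACh : AC \is hermsymmx.
  apply/is_hermitianmxP; rewrite expr0 scale1r -map_trmx; apply/matrixP => i j.
  rewrite !mxE -{1}As mxE; apply/esym/conj_Creal/complex_realP.
  by exists (A j i).
have /orthomx_spectralP AE := hermitian_normalmx ACh.
have /mxOverP Dr := hermitian_spectral_diag_real ACh.
set P := spectralmx AC in AE; set D := spectral_diag AC in AE Dr.
have PU : P \in unitmx by exact: spectral_unit.
exists [tuple complex.Re (D 0 i) | i < n].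
apply: (map_poly_inj toC); rewrite map_char_poly rmorph_prod -/AC.
have -> : char_poly AC = char_poly (diag_mx D).
  have PE : map_mx polyC (invmx P) *m map_mx polyC P = 1%:M.
    by rewrite -map_mxM mulVmx// map_mx1.
  have -> : char_poly AC = \det (map_mx polyC (invmx P) *m char_poly_mx (diag_mx D) *m map_mx polyC P).
    congr (\det _); rewrite /char_poly_mx {1}AE !map_mxM mulmxBr mulmxBl; congr (_ - _).
    by rewrite -scalemx1 -scalemxAr mulmx1 -scalemxAl PE.
  by rewrite !det_mulmx mulrAC -det_mulmx PE det1 mul1r.
rewrite char_poly_trig ?diag_mx_is_trig// big_map big_enum /=.
apply: eq_bigr => i _; rewrite rmorphB /= map_polyX map_polyC /= mxE eqxx mulr1n.
by rewrite RRe_real//; exact: Dr.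
Qed.

Lemma coef_prod_XaddC (I : finType) (a : I -> R) k : (k <= #|I|)%N ->
  (\prod_i ('X + (a i)%:P))`_k = \sum_(J : {set I} | #|J| == (#|I| - k)%N) \prod_(i in J) a i.
Proof.
move=> kI; under eq_bigr do rewrite addrC.
rewrite bigA_distr coef_sum [RHS]big_mkcond/=; apply: eq_bigr => J _.
rewrite (bigID (mem J))/= (eq_bigr (fun i => (a i)%:P)); last by move=> i ->.
rewrite [X in _ * X](eq_bigr (fun=> 'X)); last by move=> i /negbTE ->.
rewrite prodr_const -rmorph_prod coefCM coefXn.
have -> : #|[predC J]| = (#|I| - #|J|)%N by rewrite -(cardC (mem J)) addKn.
have JI := max_card (mem J).
have -> : (k == (#|I| - #|J|)%N) = (#|J| == (#|I| - k)%N).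
  by apply/eqP/eqP => ->; rewrite subKn.
by case: ifP; rewrite ?mulr1 ?mulr0.
Qed.

Lemma poly_eq_horner (p q : {poly R}) : (forall r, p.[r] = q.[r]) -> p = q.
Proof.
move=> pq; apply/eqP; rewrite -subr_eq0; apply/eqP; apply: near0_root_eq0.
by apply/nbhs_normP; exists 1 => //= r _; rewrite hornerD hornerN pq subrr.
Qed.

Lemma horner_det m (M : 'M[{poly R}]_m) r :
  (\det M).[r] = \det (map_mx (fun p => p.[r]) M).
Proof. by rewrite -[LHS]/(horner_eval r _) -det_map_mx. Qed.

(** For a symmetric matrix the characteristic polynomial splits, so [eigenvalues] are genuine.
    Substituting -r gives det(r + A) as the product of the r + a_i, whose coefficients are the
    elementary symmetric functions. *)
Lemma elem_symE j (A : 'M[R]_n) : (j <= n)%N -> A^T = A ->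
  elem_sym j A = (\det (map_mx polyC A + 'X *: map_mx polyC 1%:M))`_(n - j).
Proof.
rewrite map_scalar_mx scale_scalar_mx mulr1 addrC => jn As; have [s0 cs] := char_poly_symmetric As.
have : char_poly A = \prod_(a <- eigenvalues A) ('X - a%:P) 
  by rewrite /eigenvalues; case: xgetP => [x _ //|/(_ s0)/(_ cs)].
rewrite /elem_sym; set e := eigenvalues A => cE.
have -> : \det ('X%:M + map_mx polyC A) = \prod_i ('X + (tnth e i)%:P).
  apply: poly_eq_horner => r; rewrite horner_det horner_prod.
  have := congr1 (fun p => (-1) ^+ n * p.[- r]) cE.
  rewrite horner_det horner_prod big_tuple => h.
  transitivity ((-1) ^+ n * \det (map_mx (fun p => p.[- r]) (char_poly_mx A))).
    rewrite -detZ; congr (\det _); apply/matrixP => a b; rewrite !mxE !hornerE.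
    by case: (a == b); rewrite ?mulr1n ?mulr0n !hornerE; ring.
  rewrite h -[X in (-1) ^+ X](card_ord n) -prodr_const -big_split/=.
  by apply: eq_bigr => a _; rewrite !hornerE; ring.
rewrite coef_prod_XaddC ?card_ord ?leq_subr//; by rewrite subKn.
Qed.

End symmetric_eigenvalues.

(** * Coefficients from values *)

Section interpolation.
Context {R : realType}.

(** The Vandermonde matrix of the nodes 0, ..., d - 1 is invertible, so coefficients are fixed
    linear combinations of values at these nodes. *)
Lemma coef_interpolation d : exists c : 'I_d -> 'I_d -> R, forall (p : {poly R}) (l : 'I_d),
  (size p <= d)%N -> p`_l = \sum_i c l i * p.[i%:R].
Proof.
pose V := Vandermonde d (\row_(i < d) (i%:R : R)).
have VU : V^T \in unitmx.
  rewrite unitmx_tr unitmxE det_Vandermonde unitfE; apply/prodf_neq0 => i _.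
  apply/prodf_neq0 => k ik; rewrite !mxE subr_eq0 eqr_nat.
  by rewrite gtn_eqF.
exists (fun l i => invmx V^T l i) => p l pd.
pose a : 'cV[R]_d := \col_i p`_i.
have VE : V^T *m a = \col_(i < d) p.[i%:R].
  apply/colP => i; rewrite !mxE (horner_coef_wide _ pd); apply: eq_bigr => k _.
  by rewrite !mxE mulrC.
have := congr1 (fun b => (invmx V^T *m b) l 0) VE; rewrite mulKmx// mxE => ->.
by rewrite mxE; apply: eq_bigr => i _; rewrite !mxE.
Qed.

Lemma cvg_coef d (pk : nat -> {poly R}) (p : {poly R}) :
  (forall k, size (pk k) <= d)%N -> (size p <= d)%N ->
  (forall i : nat, (fun k => (pk k).[i%:R]) @ \oo --> p.[i%:R]) ->
  forall l, (fun k => (pk k)`_l) @ \oo --> p`_l.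
Proof.
move=> sk s cv l; have [ld|dl] := ltnP l d; last first.
  rewrite nth_default ?(leq_trans s)//; apply: cvg_near_cst; apply: nearW => k.
  by rewrite nth_default// (leq_trans (sk k)).
have [c cE] := coef_interpolation d.
have -> : (fun k => (pk k)`_l) = (fun k => \sum_i c (Ordinal ld) i * (pk k).[i%:R]).
  by apply/funext => k; rewrite -cE.
rewrite -[l]/(val (Ordinal ld)) (cE p)//; apply: cvg_bigsum => i.
by apply: cvgM; [exact: cvg_cst|exact: cv].
Qed.

End interpolation.

(** * Determinants and adjugates of matrix pencils *)

Section pencil.
Context {R : realType}.
Implicit Types n : nat.

Definition pencil n (A B : 'M[R]_n) : 'M[{poly R}]_n := map_mx polyC A + 'X *: map_mx polyC B.

Lemma horner_pencil n (A B : 'M[R]_n) r : map_mx (fun p => p.[r]) (pencil A B) = A + r *: B.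
Proof. by apply/matrixP => i j; rewrite !mxE !hornerE mulrC. Qed.

Lemma horner_det_pencil n (A B : 'M[R]_n) r : (\det (pencil A B)).[r] = \det (A + r *: B).
Proof. by rewrite horner_det horner_pencil. Qed.

Lemma size_det_pencil n (A B : 'M[R]_n) : (size (\det (pencil A B)) <= n.+1)%N.
Proof.
apply: leq_trans (size_sum _ _ _) _; apply/bigmax_leqP => s _.
rewrite size_Msign; apply: leq_trans (size_poly_prod_leq _ _) _.
have h (f : 'I_n -> 'I_n) : (\sum_i size (pencil A B i (f i)) <= n * 2)%N.
  rewrite -[X in (_ <= X * _)%N](card_ord n) -sum_nat_const; apply: leq_sum => i _.
  rewrite !mxE; apply: leq_trans (size_polyD _ _) _.
  rewrite geq_max (leq_trans (size_polyC_leq1 _))//= mulrC.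
  by apply: leq_trans (size_polyMleq _ _) _; rewrite size_polyX addn2 /= ltnS size_polyC_leq1.
rewrite card_ord leq_subLR; apply: leq_trans (_ : (n * 2).+1 <= _)%N; first by rewrite ltnS.
by rewrite muln2 -addnn addnS.
Qed.

(* Rank one update formula, first where the matrix is invertible. *)
Lemma det_rank1_unit n (M : 'M[R]_n) (u : 'cV[R]_n) (v : 'rV[R]_n) : M \in unitmx ->
  \det (M + u *m v) = \det M + (v *m \adj M *m u) 0 0.
Proof.
move=> MU.
have det1D (a : 'cV[R]_n) (b : 'rV[R]_n) : \det (1%:M + a *m b) = 1 + (b *m a) 0 0.
  have E : block_mx 1%:M 0 b (1%:M : 'M[R]_1) *m block_mx (1%:M + a *m b) a 0 1%:M =
      block_mx 1%:M a 0 (1%:M + b *m a) *m block_mx 1%:M 0 b (1%:M : 'M[R]_1).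
    rewrite !mulmx_block !mul1mx !mulmx1 !mul0mx !addr0 !add0r.
    by rewrite mulmxDr mulmxDl mulmx1 mul1mx mulmxA [b *m a + _]addrC.
  have := congr1 determinant E; rewrite !det_mulmx !det_lblock !det_ublock !det1 !mulr1 !mul1r.
  by move=> ->; rewrite det_mx11 !mxE eqxx.
have -> : M + u *m v = M *m (1%:M + (invmx M *m u) *m v).
  by rewrite mulmxDr mulmx1 !mulmxA mulmxV// mul1mx.
rewrite det_mulmx det1D mulrDr mulr1; congr (_ + _).
have -> : \adj M = \det M *: invmx M.
  by rewrite /invmx MU scalerA mulfV ?scale1r// -unitfE -unitmxE.
by rewrite -scalemxAr -scalemxAl mulmxA [RHS]mxE.
Qed.

Definition dpoly n (A : 'M[R]_n) : {poly R} := \det (pencil A 1%:M).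

Definition apoly n (A : 'M[R]_n) : 'M[{poly R}]_n := \adj (pencil A 1%:M).

(** The quadratic form x^T adj(A + X) x as a polynomial in X. *)
Definition qpoly n (A : 'M[R]_n) (x : 'cV[R]_n) : {poly R} :=
  \sum_a \sum_b (x a 0 * x b 0) *: apoly A a b.

Lemma horner_dpoly n (A : 'M[R]_n) r : (dpoly A).[r] = \det (r%:M + A).
Proof. by rewrite horner_det_pencil scalemx1 addrC. Qed.

Lemma horner_apoly n (A : 'M[R]_n) r a b : (apoly A a b).[r] = \adj (r%:M + A) a b.
Proof.
have -> : r%:M + A = map_mx (horner_eval r) (pencil A 1%:M).
  by rewrite /horner_eval horner_pencil scalemx1 addrC.
by rewrite -map_mx_adj [RHS]mxE.
Qed.

Lemma horner_qpoly n (A : 'M[R]_n) (x : 'cV[R]_n) r :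
  (qpoly A x).[r] = (x^T *m \adj (r%:M + A) *m x) 0 0.
Proof.
rewrite /qpoly exchange_big horner_sum mxE/=; apply: eq_bigr => b _.
rewrite horner_sum mxE mulr_suml; apply: eq_bigr => a _.
by rewrite hornerZ horner_apoly [x^T _ _]mxE mulrAC.
Qed.

Lemma dpoly_neq0 n (A : 'M[R]_n) : dpoly A != 0.
Proof.
have -> : dpoly A = char_poly (- A).
  rewrite /dpoly /pencil map_scalar_mx scale_scalar_mx mulr1 /char_poly /char_poly_mx.
  by rewrite map_mxN opprK addrC.
exact: monic_neq0 (char_poly_monic _).
Qed.

(** Multiplying both sides by the nonzero polynomial [dpoly A] makes the identity trivial at its
    roots; at every other r the matrix r + A is invertible and the rank one formula applies. *)
Lemma det_pencil_rank1 n (A : 'M[R]_n) (x : 'cV[R]_n) s :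
  \det (pencil A (1%:M - s *: (x *m x^T))) = dpoly A - s *: ('X * qpoly A x).
Proof.
apply: (mulfI (dpoly_neq0 A)); apply: poly_eq_horner => r; rewrite !hornerM horner_dpoly.
have [->|d0] := eqVneq (\det (r%:M + A)) 0; first by rewrite !mul0r.
congr (_ * _); rewrite horner_det_pencil hornerD hornerN hornerZ hornerM hornerX.
rewrite horner_dpoly horner_qpoly.
have -> : A + r *: (1%:M - s *: (x *m x^T)) = (r%:M + A) + (- (r * s) *: x) *m x^T.
  rewrite scalerBr scalemx1 scalerA -scalemxAl scaleNr addrA.
  by rewrite [A + _]addrC.
rewrite det_rank1_unit ?unitmxE ?unitfE//; congr (_ + _).
by rewrite -scalemxAr mxE; ring.
Qed.

Lemma coef_horner_scale (p q : {poly R}) t l : (forall r, p.[r] = q.[t * r]) ->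
  p`_l = t ^+ l * q`_l.
Proof.
move=> pq; have -> : p = \poly_(i < size q) (t ^+ i * q`_i).
  apply: poly_eq_horner => r; rewrite pq horner_poly horner_coef; apply: eq_bigr => i _.
  by rewrite exprMn; ring.
rewrite coef_poly; case: ltnP => // h; by rewrite [q`_l]nth_default// mulr0.
Qed.

(** Applied with t = 1 / q_e and s = 1 / q_e^2, where the second matrix of the pencil is D^2 q_e.
    The factor (m != 0) discards the junk value [m.-1] at m = 0, since X Q(X) has no constant
    term. *)
Lemma coef_pencil_rank1 n (A : 'M[R]_n) (x : 'cV[R]_n) t s m :
  (\det (pencil A (t *: (1%:M - s *: (x *m x^T)))))`_m =
  t ^+ m * ((dpoly A)`_m - s * ((m != 0)%:R * (qpoly A x)`_m.-1)).
Proof.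
rewrite [LHS](coef_horner_scale (q := \det (pencil A (1%:M - s *: (x *m x^T)))) (t := t)).
  rewrite det_pencil_rank1 coefB coefZ coefXM.
  by case: m => [|m]; rewrite /= ?mulr0n ?mulr1n ?mul0r ?mul1r.
by move=> r; rewrite !horner_det_pencil scalerA mulrC.
Qed.

(** Jacobi's formula; it makes the coefficients of the trace of the adjugate proportional to those
    of the determinant, one degree up. *)
Lemma deriv_dpoly n (A : 'M[R]_n) : (dpoly A)^`() = \sum_a apoly A a a.
Proof.
apply: poly_eq_horner => r; rewrite derivE horner_sum.
have -> : horner (dpoly A) = (fun r => \det (r%:M + A)).
  by apply/funext => t; exact: horner_dpoly.
have dM i j : is_derive r 1 (fun t : R => (t%:M + A) i j) ((1%:M : 'M[R]_n) i j).
  have -> : (fun t : R => (t%:M + A) i j) = (fun t : R => A i j + t * (i == j)%:R).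
    by apply/funext => t; rewrite !mxE addrC mulr_natr.
  by rewrite mxE; exact: is_derive_affine.
have [_ dE] := is_derive_det1 dM; rewrite derive1E dE.
apply: eq_bigr => i _; rewrite horner_apoly mxE (bigD1 i)//= big1 => [|j ji].
  by rewrite mxE eqxx mul1r addr0.
by rewrite mxE eq_sym (negbTE ji) mul0r.
Qed.

Lemma coef_trace_apoly n (A : 'M[R]_n) m : (\sum_a apoly A a a)`_m = m.+1%:R * (dpoly A)`_m.+1.
Proof. by rewrite -deriv_dpoly coef_deriv mulr_natl. Qed.

Lemma size_dpoly n (A : 'M[R]_n) : (size (dpoly A) <= n.+1)%N.
Proof. exact: size_det_pencil. Qed.

Lemma size_apoly n (A : 'M[R]_n) a b : (size (apoly A a b) <= n.+1)%N.
Proof.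
rewrite /apoly mxE /cofactor size_Msign.
have -> : row' b (col' a (pencil A 1%:M)) = pencil (row' b (col' a A)) (row' b (col' a 1%:M)).
  by apply/matrixP => i j; rewrite !mxE.
by apply: leq_trans (size_det_pencil _ _) _; rewrite ltnS leq_pred.
Qed.

Section continuity.
Context {T : topologicalType}.

Definition cts_coefs (p : T -> {poly R}) := forall l, continuous (fun t => (p t)`_l).

Lemma cts_coefsM p q : cts_coefs p -> cts_coefs q -> cts_coefs (fun t => p t * q t).
Proof.
move=> cp cq l; under eq_fun do rewrite coefM.
by apply: continuous_sum => i; apply: ctsM; [exact: cp|exact: cq].
Qed.

Lemma cts_coefsC p : cts_coefs (fun=> p).
Proof. by move=> l; exact: ctsC. Qed.

Lemma cts_coefs_sum (I : Type) (r : seq I) (p : I -> T -> {poly R}) :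
  (forall i, cts_coefs (p i)) -> cts_coefs (fun t => \sum_(i <- r) p i t).
Proof.
move=> cp l; under eq_fun do rewrite coef_sum.
by apply: continuous_sum => i; exact: cp.
Qed.

Lemma cts_coefs_prod (I : Type) (r : seq I) (p : I -> T -> {poly R}) :
  (forall i, cts_coefs (p i)) -> cts_coefs (fun t => \prod_(i <- r) p i t).
Proof.
move=> cp; elim: r => [|i r ih].
  by under eq_fun do rewrite big_nil; exact: cts_coefsC.
by under eq_fun do rewrite big_cons; exact: cts_coefsM.
Qed.

Lemma cts_coefs_det m (M : T -> 'M[{poly R}]_m) :
  (forall i j, cts_coefs (fun t => M t i j)) -> cts_coefs (fun t => \det (M t)).
Proof.
move=> cM; apply: cts_coefs_sum => s; apply: cts_coefsM; first exact: cts_coefsC.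
by apply: cts_coefs_prod => i; exact: cM.
Qed.

Lemma cts_coefs_pencil n (A B : T -> 'M[R]_n) :
  (forall i j, continuous (fun t => A t i j)) -> (forall i j, continuous (fun t => B t i j)) ->
  forall i j, cts_coefs (fun t => pencil (A t) (B t) i j).
Proof.
move=> cA cB i j l; under eq_fun do rewrite !mxE coefD coefC coefXM coefC.
by apply: ctsD; [case: (l == 0) => //; exact: ctsC|case: (l == 0); [exact: ctsC|]];
  case: (_ == 0) => //; exact: ctsC.
Qed.

Lemma cts_dpoly n (A : T -> 'M[R]_n) : (forall i j, continuous (fun t => A t i j)) ->
  cts_coefs (fun t => dpoly (A t)).
Proof.
move=> cA; apply: cts_coefs_det; apply: cts_coefs_pencil => // i j; exact: ctsC.
Qed.

Lemma cts_apoly n (A : T -> 'M[R]_n) : (forall i j, continuous (fun t => A t i j)) ->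
  forall a b, cts_coefs (fun t => apoly (A t) a b).
Proof.
move=> cA a b; have -> : (fun t => apoly (A t) a b) = (fun t => cofactor (pencil (A t) 1%:M) b a).
  by apply/funext => t; rewrite mxE.
apply: cts_coefsM; first exact: cts_coefsC.
apply: cts_coefs_det => i j; under eq_fun do rewrite 2!mxE.
by apply: cts_coefs_pencil => // k l; exact: ctsC.
Qed.

End continuity.

End pencil.

(** * Tail integrals *)

Section tail_integral.
Context {R : realType}.
Implicit Types (f : R -> R) (s t : R).

Definition tail f s : R := \int[@lebesgue_measure R]_(t in `]s, +oo[) f t.

Lemma tail_eq0 f (M s : R) : (forall t, M < t -> f t = 0) -> M <= s -> tail f s = 0.
Proof.
move=> fM Ms; transitivity (\int[@lebesgue_measure R]_(t in `]s, +oo[) (0 : R)).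
  apply: eq_Rintegral => t; rewrite inE/= in_itv/= andbT => st.
  by apply: fM; exact: le_lt_trans st.
by rewrite Rintegral_cst// mul0r.
Qed.

(** Near s the tail is a constant minus an integral from a to x, with b beyond the support.
    Continuity is asked only on the right of a0, because zeta may be singular at 0. *)
Lemma is_derive_tail f (a0 M s : R) :
  (forall t, a0 < t -> {for t, continuous f}) -> (forall t, M < t -> f t = 0) ->
  a0 < s -> is_derive s 1 (tail f) (- f s).
Proof.
move=> cf fM a0s; pose a := (a0 + s) / 2; pose b := Num.max M s + 1.
have as1 : a < s by rewrite /a; lra.
have a0a : a0 < a by rewrite /a; lra.
have sb : s < b by rewrite /b ltr_pwDr// le_max lexx orbT.
have Mb : M <= b by rewrite /b ler_wpDr// le_max lexx.
have fi : (@lebesgue_measure R).-integrable `[a, b] (EFin \o f).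
  apply: continuous_compact_integrable; first exact: segment_compact.
  apply: continuous_in_subspaceT => x; rewrite inE/= in_itv/= => /andP[ax _].
  by apply: cf; exact: lt_le_trans ax.
pose F x := \int[@lebesgue_measure R]_(t in `[a, x]) f t.
have [dF F's] := continuous_FTC1_closed sb fi as1 (cf _ a0s).
have E : \forall x \near s, F b - F x = tail f x.
  have : s \in `]a, b[ by rewrite in_itv/= as1.
  move=> /near_in_itvoo; apply: filterS => x; rewrite in_itv/= => /andP[ax xb].
  rewrite /F (Rintegral_itvB fi) ?bnd_simp ?ltW// /tail Rintegral_mkcond [RHS]Rintegral_mkcond.
  apply: eq_Rintegral => t _; rewrite !patchE; case: ifPn => [tx|tx].
    rewrite ifT//; move: tx; rewrite !inE/= !in_itv/= => /andP[-> _]; exact: andbT.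
  case: ifPn => // tx2; rewrite fM//; apply: le_lt_trans Mb _.
  move: tx tx2; rewrite !notin_setE !inE/= !in_itv/= andbT => /negP + xt.
  by rewrite xt /= -ltNge.
apply: (@near_eq_is_derive _ _ _ (fun x => F b - F x) _ _ _ _ E).
rewrite -F's -[X in is_derive _ _ _ X]add0r derive1E.
by apply: is_deriveB; exact: DeriveDef.
Qed.

End tail_integral.

(** * Derivatives of radial functions *)

Section radial.
Context {R : realType} {n : nat}.
Implicit Types (x y : 'cV[R]_n).
Local Notation e_ i := (basis_vec i).

Lemma is_derive_sqrt_dotv (c : R) x i : 0 < dotv x x + c ->
  is_derive x (e_ i) (fun y => Num.sqrt (dotv y y + c)) (x i 0 / Num.sqrt (dotv x x + c)).
Proof.
move=> p; apply/is_derive_line0E.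
have h1 : is_derive (0 : R) 1 (fun t : R => dotv (x + t *: e_ i) (x + t *: e_ i) + c) (2 * x i 0).
  rewrite -[X in is_derive _ _ _ X]addr0; apply: is_deriveD.
  by apply/(is_derive_line0E (fun y => dotv y y)); exact: is_derive_dotv.
have h2 : is_derive (dotv (x + 0 *: e_ i) (x + 0 *: e_ i) + c) 1 Num.sqrt
    (2 * Num.sqrt (dotv x x + c))^-1.
  by rewrite scale0r addr0; exact: is_derive1_sqrt.
have h3 := @is_derive1_comp R Num.sqrt (fun t => dotv (x + t *: e_ i) (x + t *: e_ i) + c) 0 _ _ h2 h1.
apply: is_derive_eq h3 _; have s0 : Num.sqrt (dotv x x + c) != 0 by rewrite gt_eqF// sqrtr_gt0.
by rewrite /GRing.scale/=; field.
Qed.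

Lemma is_derive_comp_abs0 (F : R -> R) : is_derive (0 : R) 1 F 0 ->
  is_derive (0 : R) 1 (fun t => F `|t|) 0.
Proof.
move=> [dF F0].
have hl : (fun h => h^-1 *: (F (h *: (1 : R) + 0) - F 0)) @ 0^' --> (0 : R).
  by rewrite -[X in _ --> X]F0; exact: dF.
have {}hl : (fun h => h^-1 *: (F `|h *: (1 : R) + 0| - F `|0 : R|)) @ 0^' --> (0 : R).
  apply/cvgrPdist_lt => e e0.
  move/cvgrPdist_lt : hl => /(_ e e0)/nbhs_normP[d /= d0 hd].
  apply/nbhs_normP; exists d => //= h hd1 h0.
  have := hd `|h|; rewrite /ball_/= !sub0r !normrN normr_id => /(_ _).
  have -> : `|h| < d by move: hd1; rewrite /ball_/= sub0r normrN.
  move=> /(_ isT); rewrite normr_eq0 => /(_ h0).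
  rewrite /GRing.scale/= !mulr1 !addr0 normr0 !normrM !normfV normr_id; exact.
split; [by apply/cvg_ex; exists 0|exact: cvg_lim hl].
Qed.

(** The form f(s) = s p(s) gives F'(0) = 0, so the composition is differentiable at the origin
    although the norm is not. *)
Lemma is_derive_radial (F f p : R -> R) x i :
  (forall s : R, 0 <= s -> is_derive s 1 F (f s)) -> (forall s : R, f s = s * p s) ->
  is_derive x (e_ i) (fun y => F (enorm y)) (p (enorm x) * x i 0).
Proof.
move=> dF fE; have [->|x0] := eqVneq x 0.
  apply/is_derive_line0E; rewrite mxE mulr0.
  have -> : (fun s : R => F (enorm (0 + s *: e_ i : 'cV[R]_n))) = (fun s : R => F `|s|).
    apply/funext => s; rewrite add0r enormZ /enorm dotv_basisr !mxE !eqxx.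
    by rewrite sqrtr1 mulr1.
  by apply: is_derive_comp_abs0; rewrite -[X in is_derive _ _ _ X](mul0r (p 0)) -fE; exact: dF.
have nx : 0 < enorm x by rewrite enorm_gt0.
have h1 : is_derive (0 : R) 1 (fun t : R => enorm (x + t *: e_ i)) (x i 0 / enorm x).
  apply/is_derive_line0E.
  have := @is_derive_sqrt_dotv 0 x i; rewrite addr0 -sqr_enorm => /(_ (exprn_gt0 _ nx)).
  have -> : (fun y => Num.sqrt (dotv y y + 0)) = (@enorm R n).
    by apply/funext => y; rewrite addr0.
  by rewrite sqrtr_sqr gtr0_norm.
apply/(is_derive_line0E (fun y => F (enorm y))).
have h2 : is_derive (enorm (x + 0 *: e_ i)) 1 F (f (enorm x)).
  by rewrite scale0r addr0; apply: dF; exact: ltW.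
have h3 := @is_derive1_comp R F (fun t => enorm (x + t *: e_ i)) 0 _ _ h2 h1.
apply: is_derive_eq h3 _; rewrite fE; field.
by rewrite gt_eqF.
Qed.

Lemma is_derive_inv (f : 'cV[R]_n -> R) x (v : 'cV[R]_n) (f' : R) : f x != 0 ->
  is_derive x v f f' -> is_derive x v (fun y => (f y)^-1) (- f' * ((f x)^-1 * (f x)^-1)).
Proof.
move=> f0 /is_derive_line0E df; apply/(is_derive_line0E (fun y => (f y)^-1)).
have f00 : f (x + 0 *: v) != 0 by rewrite scale0r addr0.
apply: is_derive_eq (@is_deriveV R (fun t => f (x + t *: v)) 0 f' 1 f00 df) _.
by rewrite scale0r addr0 /GRing.scale/= -exprVn expr2; ring.
Qed.

Lemma is_CkV k (f : 'cV[R]_n -> R) : (forall x, f x != 0) -> is_Ck k f ->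
  is_Ck k (fun x => (f x)^-1).
Proof.
move=> f0; elim: k f f0 => [|k ih] f f0; first by case=> cf _; split => //; exact: ctsV.
move=> Cf; apply/is_CkSP; split; first by apply: ctsV => //; exact: is_Ck_cts Cf.
exists (fun i x => - 'D_(e_ i) f x * ((f x)^-1 * (f x)^-1)) => i; split.
  by move=> x; apply: is_derive_inv => //; exact: is_Ck_derive Cf.
have Ck : is_Ck k f by exact: is_Ck_le Cf.
apply: is_CkM; last by apply: is_CkM; exact: ih.
by under eq_fun do rewrite -mulN1r; apply: is_CkZ; exact: is_Ck_D.
Qed.

Section qnorm_derivatives.
Variables (e : R) (e0 : 0 < e).

Lemma qnorm_gt0 x : 0 < qnorm e x.
Proof. by rewrite sqrtr_gt0 ltr_wpDl ?dotv_ge0// exprn_gt0. Qed.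

Lemma is_derive_qnorm x i : is_derive x (e_ i) (qnorm e) (x i 0 * (qnorm e x)^-1).
Proof. by apply: is_derive_sqrt_dotv; rewrite ltr_wpDl ?dotv_ge0// exprn_gt0. Qed.

Lemma is_Ck_qnorm k : is_Ck k (qnorm e : 'cV[R]_n -> R).
Proof.
have cq : continuous (qnorm e : 'cV[R]_n -> R).
  have c1 : continuous (fun x : 'cV[R]_n => dotv x x + e ^+ 2).
    by apply: ctsD; [exact: continuous_dotv (@cts_id _) (@cts_id _)|exact: ctsC].
  exact: (@cts_comp _ _ _ _ (@Num.sqrt R) c1 (@sqrt_continuous R)).
elim: k => [|k ih]; first by split.
apply/is_CkSP; split => //; exists (fun i x => x i 0 * (qnorm e x)^-1) => i; split.
  by move=> x; exact: is_derive_qnorm.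
apply: is_CkM; first exact: is_Ck_coord.
by apply: is_CkV => // x; rewrite gt_eqF// qnorm_gt0.
Qed.

(** A multiple of the identity minus a rank one matrix: the shape required by
    [coef_pencil_rank1]. *)
Lemma hessian_qnorm x : hessian (qnorm e) x =
  (qnorm e x)^-1 *: (1%:M - (qnorm e x) ^- 2 *: (x *m x^T)).
Proof.
have q0 : qnorm e x != 0 by rewrite gt_eqF// qnorm_gt0.
apply/matrixP => i j; rewrite hessianE.
have -> : 'D_(e_ i) (qnorm e) = (fun y => y i 0 * (qnorm e y)^-1).
  by apply/funext => y; have [_ ->] := is_derive_qnorm y i.
have h := is_derive_mul (is_derive_coord j i x) (is_derive_inv q0 (is_derive_qnorm x j)).
have [_ ->] := h; rewrite !mxE big_ord1 !mxE -exprVn expr2; ring.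
Qed.

End qnorm_derivatives.
End radial.

(** * Integration by parts for polynomial integrands *)

Section integrated_polynomials.
Context {R : realType} {n : nat}.
Implicit Types (x y : 'cV[R]_n).
Local Notation e_ i := (basis_vec i).

Lemma integral_cts_sum (I : Type) (r : seq I) (F : I -> 'cV[R]_n -> R) (M : R) :
  (forall i, continuous (F i)) -> (forall i, supp_in (F i) M) ->
  \int[Leb n]_x (\sum_(i <- r) F i x) = \sum_(i <- r) \int[Leb n]_x F i x.
Proof.
move=> cF sF; elim: r => [|i r ih].
  under eq_Rintegral do rewrite big_nil.
  by rewrite Rintegral_cst// mul0r big_nil.
under eq_Rintegral do rewrite big_cons.
rewrite RintegralD//; first by rewrite ih big_cons.
  exact: integrable_continuous_supp (cF i) (sF i).
apply: (@integrable_continuous_supp _ _ _ M); first exact: continuous_sum.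
by move=> x xM; rewrite big1// => j _; exact: sF.
Qed.

Lemma integral_horner (L : 'cV[R]_n -> {poly R}) (M : R) N r :
  (forall x, (size (L x) <= N)%N) -> cts_coefs L -> (forall l, supp_in (fun x => (L x)`_l) M) ->
  \int[Leb n]_x (L x).[r] = (\poly_(l < N) \int[Leb n]_x (L x)`_l).[r].
Proof.
move=> sL cL LM; rewrite horner_poly.
under eq_Rintegral do rewrite (horner_coef_wide _ (sL _)).
rewrite (@integral_cts_sum _ _ (fun (l : 'I_N) x => (L x)`_l * r ^+ l) M).
- apply: eq_bigr => l _.
  by rewrite RintegralZr//; exact: integrable_continuous_supp (cL l) (LM l).
- by move=> l; apply: ctsM; [exact: cL|exact: ctsC].
- by move=> l x xM; rewrite (LM l)// mul0r.
Qed.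

Lemma integral_coef_eq0 (L : 'cV[R]_n -> {poly R}) (M : R) N l :
  (forall x, (size (L x) <= N)%N) -> cts_coefs L -> (forall l, supp_in (fun x => (L x)`_l) M) ->
  (forall r, \int[Leb n]_x (L x).[r] = 0) -> \int[Leb n]_x (L x)`_l = 0.
Proof.
move=> sL cL LM L0; have [lN|Nl] := ltnP l N; last first.
  under eq_Rintegral do rewrite nth_default ?(leq_trans (sL _))//.
  by rewrite Rintegral_cst// mul0r.
have : \poly_(l < N) \int[Leb n]_x (L x)`_l = 0.
  by apply: poly_eq_horner => r; rewrite -(integral_horner r sL cL LM) L0 horner0.
by move=> /(congr1 (fun q : {poly R} => q`_l)); rewrite coef_poly lN coef0.
Qed.

Section radial_identity.
Variables (p g G : 'cV[R]_n -> R) (M : R) (u : 'cV[R]_n -> R) (i : 'I_n).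
Hypotheses (dg : forall x a, is_derive x (e_ a) g (- (p x * x a 0)))
  (dG : forall x a, is_derive x (e_ a) G (g x * x a 0))
  (cp : forall a, continuous (fun x => p x * x a 0))
  (cg : continuous g) (cG : continuous G)
  (sp : supp_in p M) (sg : supp_in g M) (sG : supp_in G M) (C3 : is_Ck 3 u).

Let C r x : 'M[R]_n := \adj (r%:M + 1 *: hessian u x).

Let CC r a b : is_Ck 1 (fun x => C r x a b).
Proof.
apply: is_Ck_adj => k l.
have -> : (fun x => (r%:M + 1 *: hessian u x) k l) = (fun x => r *+ (k == l) + hessian u x k l).
  by apply/funext => x; rewrite scale1r !mxE.
by apply: is_CkDr; [exact: is_Ck_cst|exact: is_Ck_hessian].
Qed.

Let Csym r x a b : C r x a b = C r x b a.
Proof.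
apply: adj_sym; rewrite scale1r linearD /= tr_scalar_mx hessian_sym//.
exact: is_Ck_le C3.
Qed.

Let Cg : is_Ck 1 g.
Proof.
apply/is_CkSP; split => //; exists (fun a x => - (p x * x a 0)) => a; split => //.
by split => //; apply: ctsN; exact: cp.
Qed.

Let CG : is_Ck 1 G.
Proof.
apply/is_CkSP; split => //; exists (fun a x => g x * x a 0) => a; split => //.
by split => //; apply: ctsM => //; exact: continuous_coord.
Qed.

(** The field g x_i C x minus G C e_i. Differentiating the factor x_i in the first term produces the
    unwanted g (C x)_i, which the second term cancels because grad G = g x and C is symmetric. *)
Let X r a x := \sum_b C r x a b * (g x * (x i 0 * x b 0)) - C r x a i * G x.

Let CX r a : is_Ck 1 (X r a).
Proof.
apply: is_CkB; last exact: is_CkM (CC r a i) CG.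
apply: is_Ck_sum => b; apply: is_CkM (CC r a b) _; apply: is_CkM Cg _.
by apply: is_CkM; exact: is_Ck_coord.
Qed.

Let divX r x : \sum_a 'D_(e_ a) (X r a) x =
  - (p x * x i 0) * (\sum_a \sum_b x a 0 * x b 0 * C r x a b) +
  g x * x i 0 * \sum_a C r x a a.
Proof.
pose DC a b := 'D_(e_ a) (fun y => C r y a b) x.
have DC0 b : \sum_a DC a b = 0 by exact: piola_hessian.
have dX a : 'D_(e_ a) (X r a) x =
   \sum_b (DC a b * (g x * (x i 0 * x b 0)) + C r x a b * (- (p x * x a 0) * (x i 0 * x b 0) +
     g x * ((i == a)%:R * x b 0 + x i 0 * (b == a)%:R))) -
   (DC a i * G x + C r x a i * (g x * x a 0)).
  have dC b := is_Ck_derive a x (CC r a b).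
  have h1 : is_derive x (e_ a) (fun y => \sum_b C r y a b * (g y * (y i 0 * y b 0)))
    (\sum_b (DC a b * (g x * (x i 0 * x b 0)) + C r x a b * (- (p x * x a 0) * (x i 0 * x b 0) +
     g x * ((i == a)%:R * x b 0 + x i 0 * (b == a)%:R)))).
    apply: is_derive_bigsum => b; apply: is_derive_mul => //; apply: is_derive_mul => //.
    by apply: is_derive_mul; exact: is_derive_coord.
  have h2 := is_derive_mul (dC i) (dG x a).
  by have [_ ->] := is_deriveB h1 h2.
under eq_bigr do rewrite dX.
rewrite sumrB big_split/= -mulr_suml DC0 mul0r add0r.
under eq_bigr do rewrite big_split/=.
rewrite big_split/= [X in X + _ - _]exchange_big/= [X in X + _ - _]big1 ?add0r => [|b _]; last first.
  by rewrite -mulr_suml DC0 mul0r.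
have -> : \sum_a C r x a i * (g x * x a 0) = g x * \sum_b C r x i b * x b 0.
  by rewrite mulr_sumr; apply: eq_bigr => a _; rewrite Csym; ring.
have -> : \sum_a C r x a a = \sum_a \sum_b C r x a b * (b == a)%:R.
  apply: eq_bigr => a _; rewrite (bigD1 a)//= eqxx mulr1 big1 ?addr0// => b ba.
  by rewrite (negbTE ba) mulr0.
have -> : \sum_b C r x i b * x b 0 = \sum_a \sum_b C r x a b * ((i == a)%:R * x b 0).
  rewrite [RHS](bigD1 i)//= eqxx [X in _ = _ + X]big1 ?addr0 => [|a ai].
    by apply: eq_bigr => b _; rewrite mul1r.
  by rewrite big1// => b _; rewrite eq_sym (negbTE ai) mul0r mulr0.
rewrite !mulr_sumr -big_split -sumrB/=; apply: eq_bigr => a _.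
by rewrite !mulr_sumr -big_split -sumrB/=; apply: eq_bigr => b _; ring.
Qed.

(** The integral of [divX] vanishes for every r. Both parts are polynomials in r, so coefficients
    may be compared, and the trace of the adjugate contributes (m + 1) times a coefficient of the
    determinant. *)
Lemma radial_identity m :
  \int[Leb n]_x (p x * x i 0 * (qpoly (hessian u x) x)`_m) =
  \int[Leb n]_x (g x * x i 0 * (m.+1%:R * (dpoly (hessian u x))`_m.+1)).
Proof.
pose L x : {poly R} := (g x * x i 0) *: (\sum_a apoly (hessian u x) a a) -
  (p x * x i 0) *: qpoly (hessian u x) x.
have ch k l : continuous (fun x => hessian u x k l).
  exact: is_Ck_cts (is_Ck_hessian k l C3).
have cgi : continuous (fun x => g x * x i 0) by apply: ctsM => //; exact: continuous_coord.
have ct : cts_coefs (fun x => \sum_a apoly (hessian u x) a a).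
  by apply: cts_coefs_sum => a; exact: cts_apoly.
have cq : cts_coefs (fun x => qpoly (hessian u x) x).
  apply: cts_coefs_sum => a; apply: cts_coefs_sum => b l.
  under eq_fun do rewrite coefZ.
  apply: ctsM; last exact: cts_apoly.
  by apply: ctsM; exact: continuous_coord.
have cL : cts_coefs L.
  move=> l; under eq_fun do rewrite coefB !coefZ.
  by apply: ctsB; apply: ctsM.
have sL x : (size (L x) <= n.+1)%N.
  apply: leq_trans (size_polyD _ _) _; rewrite geq_max size_polyN; apply/andP; split.
    apply: leq_trans (size_scale_leq _ _) _; apply: leq_trans (size_sum _ _ _) _.
    by apply/bigmax_leqP => a _; exact: size_apoly.
  apply: leq_trans (size_scale_leq _ _) _; apply: leq_trans (size_sum _ _ _) _.
  apply/bigmax_leqP => a _; apply: leq_trans (size_sum _ _ _) _.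
  apply/bigmax_leqP => b _; apply: leq_trans (size_scale_leq _ _) _; exact: size_apoly.
have LM l : supp_in (fun x => (L x)`_l) M.
  by move=> x xM; rewrite coefB !coefZ sg// sp// !mul0r subrr.
have L0 r : \int[Leb n]_x (L x).[r] = 0.
  rewrite -(@integral_divergence _ _ (X r) M (CX r)); last first.
    by move=> a x xM; rewrite /X sG// mulr0 subr0 big1// => b _; rewrite sg// mul0r mulr0.
  apply: eq_Rintegral => x _; rewrite divX /L hornerD hornerN !hornerZ horner_sum addrC mulNr.
  have hC a b : (apoly (hessian u x) a b).[r] = C r x a b by rewrite horner_apoly /C scale1r.
  congr (- (_ * _) + _ * _); last by apply: eq_bigr => a _; rewrite hC.
  rewrite horner_sum; apply: eq_bigr => a _; rewrite horner_sum; apply: eq_bigr => b _.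
  by rewrite hornerZ hC.
have := integral_coef_eq0 m sL cL LM L0.
under eq_Rintegral do rewrite coefB !coefZ.
rewrite RintegralB//.
- move/eqP; rewrite subr_eq0 => /eqP <-; apply: eq_Rintegral => x _.
  by rewrite coef_trace_apoly.
- apply: (@integrable_continuous_supp _ _ _ M); first by apply: ctsM.
  by move=> x xM; rewrite sg// !mul0r.
- apply: (@integrable_continuous_supp _ _ _ M); first by apply: ctsM.
  by move=> x xM; rewrite sp// !mul0r.
Qed.

End radial_identity.
End integrated_polynomials.

(* 1/t is the limit of t/(t^2 + 1/k), including at t = 0 where 0^-1 = 0. *)
Lemma measurable_invr (R : realType) : measurable_fun setT (fun t : R => t^-1).
Proof.
pose h k (t : R) := t * (t ^+ 2 + k.+1%:R^-1)^-1.
have p k (t : R) : 0 < t ^+ 2 + k.+1%:R^-1 by rewrite ltr_wpDl ?sqr_ge0// invr_gt0.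
apply: (@measurable_fun_cvg _ _ _ setT h) => [k|t _].
  apply: continuous_measurable_fun; apply: ctsM; first exact: cts_id.
  apply: ctsV; first by move=> t; rewrite gt_eqF.
  by apply: ctsD; [exact: ctsX (@cts_id _)|exact: ctsC].
have [->|t0] := eqVneq t 0.
  by rewrite invr0; apply: cvg_near_cst; apply: nearW => k; rewrite /h mul0r.
have t2 : t ^+ 2 + 0 != 0 by rewrite addr0 expf_neq0.
have h1 : (fun k => t ^+ 2 + k.+1%:R^-1) @ \oo --> t ^+ 2 + 0.
  by apply: cvgD; [exact: cvg_cst|exact: cvg_harmonic].
have -> : t^-1 = t * (t ^+ 2 + 0)^-1 by rewrite addr0; field.
apply: cvgM; [exact: cvg_cst|exact: cvgV t2 h1].
Qed.

(** * The radial profile beta and its behaviour at 0 *)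

Section profile.
Context {R : realType}.
Implicit Types (s t c e : R).

Lemma nonincreasing_derive (H H' : R -> R) s c : s <= c ->
  (forall t, s <= t -> is_derive t 1 H (H' t)) ->
  (forall t, s <= t -> t <= c -> H' t <= 0) -> H c <= H s.
Proof.
move=> sc dH H0; have h1 t : t \in `]s, c[ -> is_derive t 1 H (H' t).
  by rewrite in_itv/= => /andP[/ltW st _]; exact: dH.
have h2 : {within `[s, c], continuous H}.
  apply: derivable_within_continuous => t; rewrite in_itv/= => /andP[st _].
  by have [] := dH t st.
have [t tI E] := MVT_segment sc h1 h2.
rewrite -subr_le0 E; apply: mulr_le0_ge0; last by rewrite subr_ge0.
by move: tI; rewrite in_itv/= => /andP[]; exact: H0.
Qed.

Lemma derive_dominated (h h' k k' : R -> R) s c : s <= c ->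
  (forall t, s <= t -> is_derive t 1 h (h' t)) ->
  (forall t, s <= t -> is_derive t 1 k (k' t)) ->
  (forall t, s <= t -> t <= c -> `|h' t| <= - k' t) -> `|h s| <= `|h c| + (k s - k c).
Proof.
move=> sc dh dk hk.
have h1 : h c + k c <= h s + k s.
  apply: (@nonincreasing_derive (fun t => h t + k t) (fun t => h' t + k' t)) => // [t st|t st tc].
    exact: is_deriveD (dh t st) (dk t st).
  by have := hk t st tc; rewrite ler_norml; lra.
have h2 : k c - h c <= k s - h s.
  apply: (@nonincreasing_derive (fun t => k t - h t) (fun t => k' t - h' t)) => // [t st|t st tc].
    exact: is_deriveB (dk t st) (dh t st).
  by have := hk t st tc; rewrite ler_norml; lra.
have := ler_norm (h c); have := ler_norm (- h c); rewrite normrN => a1 a2.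
by rewrite ler_norml; apply/andP; split; lra.
Qed.

Lemma is_derive_exprVn k t : 0 < t -> is_derive t 1 (fun s => s ^- k) (- (k%:R * t ^- k.+1)).
Proof.
move=> t0; have h := @is_deriveV R (fun s => s ^+ k) t _ 1 _ _.
have d : is_derive t 1 (fun s : R => s ^+ k) (k%:R * t ^+ k.-1).
  apply: DeriveDef; first exact: exprn_derivable.
  by rewrite exp_derive /GRing.scale/= mulr1.
apply: is_derive_eq (h _ _ d) _; first by rewrite expf_neq0// gt_eqF.
rewrite /GRing.scale/=; case: k d {h} => [|k] _; first by rewrite !mul0r mulr0 oppr0.
have tn : t != 0 by rewrite gt_eqF.
have tk : t ^+ k != 0 by rewrite expf_neq0.
by rewrite /= !exprS; field; rewrite tk tn.
Qed.

Variables (zeta : R -> R) (m : nat) (M : R).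
Hypotheses (M0 : 0 < M) (zc : forall s, 0 < s -> {for s, continuous zeta})
  (zM : forall s, M < s -> zeta s = 0)
  (z0 : (fun s => s ^+ m.+1 * zeta s) @ 0^'+ --> (0 : R)).

Let f0 t := t ^+ (m - 1) * zeta t.
Definition eta s := tail f0 s.
(** The function alpha of the theorem without its binomial factor. *)
Definition beta s := s ^+ m * zeta s + m%:R * eta s.

Lemma is_derive_eta s : 0 < s -> is_derive s 1 eta (- f0 s).
Proof.
apply: (is_derive_tail (M := M)) => t ht; last by rewrite /f0 zM ?mulr0.
by apply: cvgM; [exact: exprn_continuous|exact: zc].
Qed.

Lemma eta_eq0 s : M <= s -> eta s = 0.
Proof. by apply: tail_eq0 => t tM; rewrite /f0 zM ?mulr0. Qed.

Lemma beta_eq0 s : M < s -> beta s = 0.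
Proof. by move=> sM; rewrite /beta zM// eta_eq0 ?ltW// !mulr0 addr0. Qed.

Lemma beta_continuous s : 0 < s -> {for s, continuous beta}.
Proof.
move=> s0; apply: cvgD; first by apply: cvgM; [exact: exprn_continuous|exact: zc].
apply: cvgM; first exact: cvg_cst.
have [ds _] := is_derive_eta s0.
by have /differentiable_continuous := (derivable1_diffP _ _).1 ds.
Qed.

Lemma small_zeta e : 0 < e -> exists2 d, 0 < d & forall s, 0 < s -> s < d ->
  `|s ^+ m.+1 * zeta s| <= e.
Proof.
move=> e0; move/cvgrPdist_le : z0 => /(_ e e0)[d /= d0 hd]; exists d => // s s0 sd.
have := hd s; rewrite /ball/= !sub0r !normrN; apply => //.
by rewrite gtr0_norm.
Qed.

(** The first term of s beta(s) is small by hypothesis. For the second, smallness of t^(m+1) zeta(t)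
    bounds the derivative of [eta] by e' / t^2, so near 0 [eta] is at most a constant plus e' /
    s. *)
Lemma small_beta e : 0 < e -> exists2 d, 0 < d & forall s, 0 < s -> s < d -> `|s * beta s| <= e.
Proof.
move=> e0; have e2 : 0 < e / 2 by rewrite divr_gt0.
(* Chosen so that the bound m * (2 e') on the tail term is at most e / 2. *)
pose e' := e / 4 / m.+1%:R; have e'0 : 0 < e' by rewrite !divr_gt0.
have [d1 d10 h1] := small_zeta e2; have [d2 d20 h2] := small_zeta e'0.
pose c := d2 / 2; have c0 : 0 < c by rewrite divr_gt0.
pose d3 := e' / (`|eta c| + 1).
have p : 0 < `|eta c| + 1 by rewrite ltr_wpDl.
have d30 : 0 < d3 by rewrite divr_gt0.
exists (Num.min d1 (Num.min c d3)); first by rewrite !lt_min d10 c0.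
move=> s s0; rewrite !lt_min => /and3P[sd1 sc sd3].
have zs : `|s ^+ m.+1 * zeta s| <= e / 2 by exact: h1.
have ms : `|m%:R * (s * eta s)| <= e / 2.
  (* At m = 0 the truncated exponent m - 1 is 0, but the tail term carries the coefficient m. *)
  have [->|m0] := eqVneq m 0%N; first by rewrite mul0r normr0 ltW.
  have : `|eta s| <= `|eta c| + (e' * s ^- 1 - e' * c ^- 1).
    apply: (@derive_dominated eta (fun t => - f0 t) (fun t => e' * t ^- 1)
      (fun t => e' * - (1%:R * t ^- 2))) => [|t st|t st|t st tc]; first exact: ltW.
    - by apply: is_derive_eta; exact: lt_le_trans st.
    - have t0 : 0 < t by exact: lt_le_trans st.
      have := @is_derive_mul R R (cst e') (fun t => t ^- 1) t 1 _ _ (is_derive_cst _ _ _)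
        (is_derive_exprVn 1 t0).
      by rewrite mul0r add0r.
    - have t0 : 0 < t by exact: lt_le_trans st.
      rewrite normrN mul1r mulrN opprK ler_pdivlMr ?exprn_gt0//.
      rewrite -[X in _ * X <= _](gtr0_norm (exprn_gt0 2 t0)) -normrM.
      have -> : f0 t * t ^+ 2 = t ^+ m.+1 * zeta t.
        rewrite /f0 mulrAC -exprD; congr (t ^+ _ * _).
        by rewrite addn2 subn1 prednK// lt0n.
      by apply: h2 => //; rewrite (le_lt_trans tc)// /c; lra.
  rewrite normrM normrM (gtr0_norm s0) normr_nat !expr1 => hs.
  have h3 : s * `|eta s| <= 2 * e'.
    have a1 : s * `|eta s| <= s * (`|eta c| + (e' * s^-1 - e' * c^-1)) by rewrite ler_pM2l.
    have a2 : s * (`|eta c| + 1) <= e' by move: sd3; rewrite /d3 ltr_pdivlMr// => /ltW.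
    have a3 : s * (e' * s^-1) = e' by rewrite mulrCA mulfV ?mulr1// gt_eqF.
    have a4 : 0 <= s * (e' * c^-1) by rewrite !mulr_ge0// ?invr_ge0 ltW.
    by move: a1 a2 a3 a4; rewrite !mulrDr mulrN mulr1; lra.
  have h4 : m%:R * (s * `|eta s|) <= m.+1%:R * (2 * e').
    by apply: ler_pM => //; [rewrite mulr_ge0// ltW|rewrite ler_nat].
  apply: le_trans h4 _; have : (m.+1%:R : R) != 0 by rewrite pnatr_eq0.
  by rewrite /e'; set q := m.+1%:R => q0; rewrite le_eqVlt; apply/orP; left; apply/eqP; field.
have -> : s * beta s = s ^+ m.+1 * zeta s + m%:R * (s * eta s) by rewrite /beta exprS; ring.
by apply: le_trans (ler_normD _ _) _; lra.
Qed.

(** The odd extension of s beta(s), continuous at 0 by [small_beta]; unlike [beta] it is bounded. *)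
Definition gamma t := t * beta `|t|.

Lemma gamma_continuous : continuous gamma.
Proof.
move=> t; have [->|t0] := eqVneq t 0.
  apply/(@cvgrPdist_le _ _ _ (nbhs (0 : R))) => e e0; have [d d0 hd] := small_beta e0.
  apply/nbhs_normP; exists d => //= s; rewrite /ball_/= sub0r normrN /gamma mul0r sub0r normrN => sd.
  have [->|s0] := eqVneq s 0; first by rewrite mul0r normr0 ltW.
  by rewrite normrM -[X in X * _]normr_id -normrM; apply: hd => //; rewrite normr_gt0.
apply: cvgM; first exact: cvg_id.
apply: (@cvg_comp _ _ _ (fun s : R => `|s|) beta _ (nbhs `|t|)); first exact: norm_continuous.
by apply: beta_continuous; rewrite normr_gt0.
Qed.

Lemma gamma_eq0 t : M < `|t| -> gamma t = 0.
Proof. by move=> tM; rewrite /gamma beta_eq0 ?mulr0. Qed.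

Lemma gamma_bounded : exists2 B, 0 <= B & forall t, `|gamma t| <= B.
Proof.
have : compact (gamma @` `[- M, M]).
  apply: continuous_compact; last exact: segment_compact.
  exact: continuous_subspaceT gamma_continuous.
move=> /compact_bounded[C [_ hC]]; exists (`|C| + 1); first by rewrite addr_ge0.
move=> t; have [tM|tM] := leP `|t| M; last by rewrite gamma_eq0// normr0 addr_ge0.
apply: (hC (`|C| + 1)); first by rewrite (le_lt_trans (ler_norm C))// ltrDl.
by exists t => //=; rewrite in_itv/= -ler_norml.
Qed.

Lemma beta_radial_continuous n (i : 'I_n) : continuous (fun x : 'cV[R]_n => beta (enorm x) * x i 0).
Proof.
move=> x; have [->|x0] := eqVneq x 0.
  apply/(@cvgrPdist_le _ _ _ (nbhs (0 : 'cV[R]_n))) => e e0; have [d d0 hd] := small_beta e0.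
  have := @continuous_enorm R n 0.
  move=> /cvgrPdist_lt/(_ d d0); apply: filterS => y.
  have /eqP -> : enorm (0 : 'cV[R]_n) == 0 by rewrite enorm_eq0.
  rewrite sub0r normrN ger0_norm ?enorm_ge0// => yd.
  have -> : (0 : 'cV[R]_n) i 0 = 0 by rewrite mxE.
  rewrite mulr0 sub0r normrN.
  have [->|y0] := eqVneq y 0; first by rewrite mxE mulr0 normr0 ltW.
  apply: le_trans (hd (enorm y) _ yd); last by rewrite enorm_gt0.
  rewrite !normrM mulrC ler_wpM2r// (ger0_norm (enorm_ge0 _)); exact: coord_le_enorm.
have bc : {for enorm x, continuous beta} by apply: beta_continuous; rewrite enorm_gt0.
have c1 : {for x, continuous (fun y : 'cV[R]_n => beta (enorm y))}.
  by apply: continuous_comp bc; exact: continuous_enorm.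
exact: cvgM c1 (@continuous_coord R n i x).
Qed.

(** * The regularised profile and the limit e -> 0 *)

Section regularized.
Variables (e : R) (e0 : 0 < e).

Definition qabs t := Num.sqrt (t ^+ 2 + e ^+ 2).

Lemma qabs_gt0 t : 0 < qabs t.
Proof. by rewrite sqrtr_gt0 ltr_wpDl ?sqr_ge0// exprn_gt0. Qed.

Lemma qabs_ge t : 0 <= t -> t <= qabs t.
Proof.
move=> t0; rewrite -[leLHS]ger0_norm// -sqrtr_sqr ler_wsqrtr// lerDl; exact: sqr_ge0.
Qed.

Lemma qabs_le t : 0 <= t -> qabs t <= t + e.
Proof.
have e1 := ltW e0; move=> t0; have p : 0 <= t + e by exact: addr_ge0.
rewrite -[leRHS](ger0_norm p) -sqrtr_sqr; apply: ler_wsqrtr.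
by rewrite sqrrD -addrA lerD2l lerDr mulrn_wge0// mulr_ge0.
Qed.

Lemma qabs_continuous : continuous qabs.
Proof.
have c1 : continuous (fun t : R => t ^+ 2 + e ^+ 2) by apply: ctsD; [exact: ctsX (@cts_id _)|exact: ctsC].
exact: (@cts_comp _ _ _ _ (@Num.sqrt R) c1 (@sqrt_continuous R)).
Qed.

Lemma qabsV_continuous k : continuous (fun t => qabs t ^- k).
Proof.
apply: ctsV; last exact: ctsX qabs_continuous.
by move=> t; rewrite expf_neq0// gt_eqF// qabs_gt0.
Qed.

Lemma qnorm_qabs n (x : 'cV[R]_n) : qnorm e x = qabs (enorm x).
Proof. by rewrite /qnorm /qabs sqr_enorm. Qed.

Lemma qabsV_le k t : 0 < t -> qabs t ^- k <= t ^- k.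
Proof.
move=> t0; rewrite lef_pV2 ?posrE ?exprn_gt0 ?qabs_gt0//.
apply: lerXn2r; [by rewrite nnegrE ltW|by rewrite nnegrE ltW// qabs_gt0|].
by apply: qabs_ge; exact: ltW.
Qed.

(** With y = t / q_e(t) the difference is t^-k (1 - y^k). Bernoulli's inequality bounds 1 - y^k by k
    (1 - y), and 1 - y <= e / s because q_e(t) - t <= e. *)
Lemma qabsV_close k s t : 0 < s -> s <= t ->
  `|t ^- k - qabs t ^- k| <= s ^- k * (k%:R * (e / s)).
Proof.
move=> s0 st; have t0 : 0 < t by exact: lt_le_trans st.
rewrite ger0_norm ?subr_ge0 ?qabsV_le//.
pose y := t / qabs t.
have y0 : 0 <= y by rewrite divr_ge0// ltW// qabs_gt0.
have qt := qabs_gt0 t.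
have y1 : y <= 1 by rewrite ler_pdivrMr// mul1r qabs_ge// ltW.
have tq : qabs t ^- k = t ^- k * y ^+ k.
  by rewrite /y exprMn exprVn mulrA mulVf ?mul1r// expf_neq0// gt_eqF.
have bern : 1 - y ^+ k <= k%:R * (1 - y).
  elim: (k) => [|l ih]; first by rewrite expr0 mul0r subrr.
  have : 0 <= (1 - y ^+ l) * (1 - y).
    by apply: mulr_ge0; rewrite subr_ge0// exprn_ile1.
  by rewrite exprS -natr1; move: ih; set z := y ^+ l; lra.
have ye : 1 - y <= e / s.
  have -> : 1 - y = (qabs t - t) / qabs t by rewrite /y mulrBl divff// gt_eqF.
  have a1 : qabs t - t <= e by have := qabs_le (ltW t0); lra.
  have a2 : (qabs t)^-1 <= s^-1.
    by rewrite lef_pV2 ?posrE//; apply: le_trans st _; apply: qabs_ge; exact: ltW.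
  apply: ler_pM => //; [by rewrite subr_ge0 qabs_ge// ltW|by rewrite invr_ge0 ltW].
rewrite tq -{1}[t ^- k]mulr1 -mulrBr; apply: ler_pM.
- by rewrite invr_ge0 exprn_ge0// ltW.
- by rewrite subr_ge0 exprn_ile1.
- rewrite lef_pV2 ?posrE ?exprn_gt0//; apply: lerXn2r => //; rewrite nnegrE ltW//.
- by apply: le_trans bern _; rewrite ler_wpM2l.
Qed.

(** The solution g of grad g(|x|) = - beta(|x|) q_e^(-m-2) x that vanishes for large |x|. For m > 0
    it regularises s^-m eta(s), whose derivative is - s^(-m-1) beta(s). *)
Definition greg : R -> R := tail (fun t => gamma t * qabs t ^- m.+2).

Lemma is_derive_greg s : is_derive s 1 greg (- (gamma s * qabs s ^- m.+2)).
Proof.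
apply: (@is_derive_tail _ _ (s - 1) M); last by rewrite gtrBl.
- move=> t _; apply: ctsM; [exact: gamma_continuous|exact: qabsV_continuous].
- by move=> t tM; rewrite gamma_eq0 ?mul0r// (lt_le_trans tM)// ler_norm.
Qed.

Lemma greg_eq0 s : M <= s -> greg s = 0.
Proof.
by apply: tail_eq0 => t tM; rewrite gamma_eq0 ?mul0r// (lt_le_trans tM)// ler_norm.
Qed.

Lemma greg_continuous : continuous greg.
Proof.
move=> s; have [ds _] := is_derive_greg s.
by have /differentiable_continuous := (derivable1_diffP _ _).1 ds.
Qed.

(** A bound independent of e: the derivative is at most B t^(-m-2), which is dominated by minus the
    derivative of B t^(-m-1). *)
Lemma greg_bound B s : (forall t, `|gamma t| <= B) -> 0 < s -> `|greg s| <= B * s ^- m.+1.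
Proof.
move=> hB s0; have B0 : 0 <= B by apply: le_trans (hB 0).
pose c := s + M; have sc : s <= c by rewrite lerDl ltW.
have c0 : 0 < c by exact: addr_gt0.
have := @derive_dominated greg (fun t => - (gamma t * qabs t ^- m.+2)) (fun t => B * t ^- m.+1)
  (fun t => B * - (m.+1%:R * t ^- m.+2)) s c sc (fun t _ => is_derive_greg t).
rewrite (@greg_eq0 c) ?normr0 ?add0r; last by rewrite lerDr ltW.
move=> h; apply: le_trans (h _ _) _.
- move=> t st; have t0 : 0 < t by exact: lt_le_trans st.
  have := @is_derive_mul R R (cst B) (fun t => t ^- m.+1) t 1 _ _ (is_derive_cst _ _ _)
    (is_derive_exprVn m.+1 t0).
  by rewrite mul0r add0r.
- move=> t st _; have t0 : 0 < t by exact: lt_le_trans st.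
  rewrite normrN normrM mulrN opprK; apply: ler_pM => //.
  have qv : 0 <= qabs t ^- m.+2 by rewrite invr_ge0 exprn_ge0// ltW// qabs_gt0.
  rewrite ger0_norm//; apply: le_trans (qabsV_le m.+2 t0) _.
  by rewrite ler_peMl ?ler1n// invr_ge0 exprn_ge0// ltW.
- by rewrite gerBl mulr_ge0// invr_ge0 exprn_ge0// ltW.
Qed.

(** The difference vanishes at s + M and has derivative gamma(t) (t^(-m-2) - q_e(t)^(-m-2)), which
    is at most K on [s, s + M] by [qabsV_close]. *)
Lemma greg_close B s : (0 < m)%N -> (forall t, `|gamma t| <= B) -> 0 < s ->
  `|greg s - s ^- m * eta s| <= B * (s ^- m.+2 * (m.+2%:R * (e / s))) * M.
Proof.
move=> m0 hB s0; have B0 : 0 <= B by apply: le_trans (hB 0).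
set K := B * _; pose c := s + M; have sc : s <= c by rewrite lerDl ltW.
have Mc : M <= c by rewrite lerDr ltW.
have := @derive_dominated (fun t => greg t - t ^- m * eta t)
  (fun t => gamma t * (t ^- m.+2 - qabs t ^- m.+2)) (fun t => - (K * t)) (fun t => - K) s c sc.
rewrite (greg_eq0 Mc) (eta_eq0 Mc) mulr0 subrr normr0 add0r.
move=> h; apply: le_trans (h _ _ _) _ => [t st|t st|t st _|].
- have t0 : 0 < t by exact: lt_le_trans st.
  have h1 := @is_derive_mul R R (fun t => t ^- m) eta t 1 _ _ (is_derive_exprVn m t0) (is_derive_eta t0).
  apply: is_derive_eq (is_deriveB (is_derive_greg t) h1) _.
  have tn : t != 0 by rewrite gt_eqF.
  rewrite /gamma /beta gtr0_norm// /f0; case: (m) m0 => [//|k] _.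
  have tk : t ^+ k != 0 by rewrite expf_neq0.
  rewrite subSS subn0; set q := qabs t ^- k.+3; rewrite !exprS; field.
  by rewrite tk tn.
- have := is_deriveN (@is_derive_mul R R (cst K) id t 1 _ _ (is_derive_cst _ _ _) (is_derive_id _ _)).
  by rewrite mul0r add0r mulr1.
- by rewrite opprK normrM; apply: ler_pM => //; exact: qabsV_close.
- by rewrite opprK /c mulrDr addKr.
Qed.

Section key_identity.
Variables (n : nat) (u : 'cV[R]_n -> R) (i : 'I_n).
Hypothesis C3 : is_Ck 3 u.
Local Notation d_ x := ((dpoly (hessian u x))`_m).

Let cd l : continuous (fun x => (dpoly (hessian u x))`_l).
Proof. by apply: cts_dpoly => k j; exact: is_Ck_cts (is_Ck_hessian k j C3). Qed.

Let ci : continuous (fun x : 'cV[R]_n => x i 0) := @continuous_coord R n i.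

Let cq k : continuous (fun x : 'cV[R]_n => qabs (enorm x) ^- k).
Proof. exact: (@cts_comp _ _ _ _ (fun t => qabs t ^- k) (@continuous_enorm R n) (@qabsV_continuous k)). Qed.

Let cg : continuous (fun x : 'cV[R]_n => greg (enorm x)).
Proof. exact: (@cts_comp _ _ _ _ greg (@continuous_enorm R n) greg_continuous). Qed.

Let b0 (x : 'cV[R]_n) : M < `|x| -> beta (enorm x) = 0.
Proof. by move=> xM; apply: beta_eq0; exact: lt_le_trans (norm_le_enorm x). Qed.

Let g0 (x : 'cV[R]_n) : M < `|x| -> greg (enorm x) = 0.
Proof. by move=> xM; apply: greg_eq0; apply: ltW; exact: lt_le_trans (norm_le_enorm x). Qed.

Let radial k :
  \int[Leb n]_x (beta (enorm x) * qabs (enorm x) ^- m.+2 * x i 0 * (qpoly (hessian u x) x)`_k) =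
  \int[Leb n]_x (greg (enorm x) * x i 0 * (k.+1%:R * (dpoly (hessian u x))`_k.+1)).
Proof.
(* The potential G is minus the tail integral of this function, so that its gradient is greg(|x|)
   x. *)
pose f2 t := t * greg `|t|.
have f20 t : M < t -> f2 t = 0.
  by move=> tM; rewrite /f2 greg_eq0 ?mulr0// ltW// (lt_le_trans tM)// ler_norm.
have cf2 : continuous f2.
  apply: ctsM; first exact: cts_id.
  exact: (@cts_comp _ _ _ _ greg (@norm_continuous R R) greg_continuous).
have d2 s : is_derive s 1 (fun t => - tail f2 t) (f2 s).
  rewrite -[X in is_derive _ _ _ X]opprK; apply: is_deriveN.
  by apply: (@is_derive_tail _ _ (s - 1) M) => [t _|t|]; [exact: cf2|exact: f20|rewrite gtrBl].
have cG : continuous (fun t => - tail f2 t).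
  move=> s; have [ds _] := d2 s.
  by have /differentiable_continuous := (derivable1_diffP _ _).1 ds.
apply: (@radial_identity R n _ _ (fun x => - tail f2 (enorm x)) M u i _ _ _ cg _ _ g0 _ C3).
- move=> x a; rewrite -mulNr.
  have := @is_derive_radial R n greg (fun s => - (gamma s * qabs s ^- m.+2))
    (fun s => - (beta `|s| * qabs s ^- m.+2)) x a (fun s _ => is_derive_greg s).
  rewrite (ger0_norm (enorm_ge0 x)); apply => s.
  by rewrite /gamma; ring.
- move=> x a.
  have := @is_derive_radial R n (fun t => - tail f2 t) f2 (fun s => greg `|s|) x a (fun s _ => d2 s).
  by rewrite (ger0_norm (enorm_ge0 x)); apply.
- move=> a; have -> : (fun x : 'cV[R]_n => beta (enorm x) * qabs (enorm x) ^- m.+2 * x a 0) =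
      (fun x => beta (enorm x) * x a 0 * qabs (enorm x) ^- m.+2).
    by apply/funext => x; rewrite mulrAC.
  by apply: ctsM => //; exact: beta_radial_continuous.
- exact: (@cts_comp _ _ _ _ (fun t => - tail f2 t) (@continuous_enorm R n) cG).
- by move=> x xM; rewrite b0// mul0r.
- move=> x xM; rewrite (tail_eq0 f20) ?oppr0//; apply: ltW; exact: lt_le_trans (norm_le_enorm x).
Qed.

(** The rank one formula splits the coefficient into a D_m term and a Q_(m-1) term, and [radial]
    converts the latter into m greg D_m. At m = 0 the second term is absent on both sides. *)
Lemma key_identity :
  \int[Leb n]_x (beta (enorm x) * x i 0 *
    (\det (pencil (hessian u x) (hessian (qnorm e) x)))`_m) =
  \int[Leb n]_x (x i 0 * d_ x * (beta (enorm x) * qabs (enorm x) ^- m - m%:R * greg (enorm x))).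
Proof.
pose I1 x := beta (enorm x) * x i 0 * (qabs (enorm x) ^- m * d_ x).
pose I2 x := beta (enorm x) * qabs (enorm x) ^- m.+2 * x i 0 * (qpoly (hessian u x) x)`_m.-1.
have ch k j : continuous (fun x => hessian u x k j) by exact: is_Ck_cts (is_Ck_hessian k j C3).
have cb : continuous (fun x : 'cV[R]_n => beta (enorm x) * x i 0) := @beta_radial_continuous n i.
have i1 : (Leb n).-integrable setT (EFin \o I1).
  apply: (@integrable_continuous_supp _ _ _ M); last by move=> x xM; rewrite /I1 b0// !mul0r.
  by apply: ctsM => //; apply: ctsM.
have i2 : (Leb n).-integrable setT (EFin \o (fun x => (m != 0)%:R * I2 x)).
  apply: (@integrable_continuous_supp _ _ _ M); last by move=> x xM; rewrite /I2 b0// !mul0r mulr0.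
  apply: ctsM; first exact: ctsC.
  have -> : I2 = (fun x => beta (enorm x) * x i 0 * (qabs (enorm x) ^- m.+2 * (qpoly (hessian u x) x)`_m.-1)).
    by apply/funext => x; rewrite /I2; ring.
  apply: ctsM => //; apply: ctsM => //.
  have cq' : cts_coefs (fun x => qpoly (hessian u x) x).
    apply: cts_coefs_sum => a; apply: cts_coefs_sum => b l.
    under eq_fun do rewrite coefZ.
    apply: ctsM; last exact: cts_apoly.
    by apply: ctsM; exact: continuous_coord.
  exact: cq'.
have i3 : (Leb n).-integrable setT (EFin \o (fun x => greg (enorm x) * x i 0 * (m%:R * d_ x))).
  apply: (@integrable_continuous_supp _ _ _ M); last by move=> x xM; rewrite g0// !mul0r.
  by apply: ctsM; apply: ctsM => //; exact: ctsC.
transitivity (\int[Leb n]_x (I1 x - (m != 0)%:R * I2 x)).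
  apply: eq_Rintegral => x _.
  rewrite (hessian_qnorm e0) coef_pencil_rank1 qnorm_qabs /I1 /I2.
  rewrite exprVn; have q0 : qabs (enorm x) != 0 by rewrite gt_eqF// qabs_gt0.
  have -> : qabs (enorm x) ^- m.+2 = qabs (enorm x) ^- m * qabs (enorm x) ^- 2.
    by rewrite -addn2 exprD invfM.
  by ring.
rewrite RintegralB// -[RHS](_ : \int[Leb n]_x (I1 x - greg (enorm x) * x i 0 * (m%:R * d_ x)) = _).
  rewrite [RHS]RintegralB//; congr (_ - _).
  have [m0|m0] := eqVneq m 0%N.
    have mE : (m%:R : R) = 0 by rewrite m0.
    under eq_Rintegral do rewrite mul0r.
    by under [RHS]eq_Rintegral do rewrite mE mul0r mulr0.
  have := radial m.-1; rewrite prednK ?lt0n// => <-.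
  by apply: eq_Rintegral => x _; rewrite mul1r.
by apply: eq_Rintegral => x _; rewrite /I1; ring.
Qed.

End key_identity.
End regularized.

Lemma Leb_cball_le n (r : R) : 0 < r -> (Leb n (@cball R n r) <= ((4 * r) ^+ n)%:E)%E.
Proof.
move=> r0; pose a : 'cV[R]_n := const_mx (- (2 * r)); pose b : 'cV[R]_n := const_mx (2 * r).
apply: (@le_trans _ _ (Leb n (hbox a b))).
  apply: le_measure; rewrite ?inE; [exact: measurable_ball_cV|exact: measurable_hbox|].
  move=> x xr k; rewrite !mxE; have := coord_le_norm x k; rewrite ler_norml.
  by move=> /andP[h1 h2]; have : `|x| <= r by []; move: h1 h2; set N := `|x|; lra.
rewrite Leb_hbox; last by move=> k; rewrite !mxE; lra.
rewrite lee_fin; under eq_bigr do rewrite !mxE.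
rewrite prodr_const card_ord le_eqVlt; apply/orP; left; apply/eqP; congr (_ ^+ _); lra.
Qed.

Lemma enormV_le (n : nat) (x : 'cV[R]_n) (N : R) : 0 < N -> N <= `|x| -> enorm x ^- m <= N ^- m.
Proof.
move=> N0 Nx; have Ne : N <= enorm x by apply: le_trans (norm_le_enorm x).
rewrite lef_pV2 ?posrE ?exprn_gt0//; last exact: lt_le_trans Ne.
by apply: lerXn2r => //; rewrite nnegrE ?ltW//; exact: lt_le_trans Ne.
Qed.

(** On the dyadic shell M / 2^(k+1) < |x| <= M / 2^k the integrand is at most [c k]. The sum over k
    of [c k] times the volume of the k-th ball is geometric with ratio 2^(m-n). *)
Lemma integrable_enormV n : (m < n)%N ->
  (Leb n).-integrable setT (EFin \o (fun x => enorm x ^- m * \1_(@cball R n M) x)).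
Proof.
move=> mn; pose D k := @cball R n (M / 2 ^+ k).
have mD k : measurable (D k) by exact: measurable_ball_cV.
pose c k := (M / 2 ^+ k.+1) ^- m.
have M2 k : 0 < M / 2 ^+ k by rewrite divr_gt0// exprn_gt0.
have c0 k : 0 <= c k by rewrite invr_ge0 exprn_ge0// ltW.
have men : measurable_fun setT (fun x : borelR R n => enorm (x : 'cV[R]_n)).
  by apply: continuous_measurable_cV; exact: continuous_enorm.
have mh : measurable_fun setT (fun x : borelR R n => enorm (x : 'cV[R]_n) ^- m * \1_(@cball R n M) x).
  apply: measurable_funM; last by apply: measurable_indic; exact: measurable_ball_cV.
  have mV : measurable_fun setT (fun t : R => t ^- m).
    have -> : (fun t : R => t ^- m) = (fun t : R => t^-1 ^+ m) by apply/funext => t; rewrite exprVn.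
    by apply: measurable_funX; exact: measurable_invr.
  exact: (measurableT_comp mV men).
apply/integrableP; split; first exact/measurable_EFinP.
(* Chosen so that the k-th term is at most A / 2^(k+1). *)
pose A := 2 * (2 ^+ m * ((4 * M) ^+ n / M ^+ m)).
have A0 : 0 <= A by rewrite !mulr_ge0// ?exprn_ge0// ?invr_ge0 ?exprn_ge0 ?mulr_ge0 ?ltW.
apply: (@le_lt_trans _ _ (A%:E)); last exact: ltry.
pose hh : borelR R n -> R := fun x => enorm (x : 'cV[R]_n) ^- m * \1_(@cball R n M) x.
have mck k : measurable_fun setT (fun x : borelR R n => (c k * \1_(D k) x)%:E).
  by apply/measurable_EFinP; apply: measurable_funM => //; exact: measurable_indic.
have key : (\int[Leb n]_x `|(hh x)%:E| <=
    \int[Leb n]_x (\sum_(k <oo) (c k * \1_(D k) x)%:E))%E.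
  apply: ge0_le_integral => //.
  - by apply: measurableT_comp => //; exact/measurable_EFinP.
  - apply: ge0_emeasurable_sum => [k x _ _|k _]; first by rewrite lee_fin mulr_ge0.
    exact: mck.
  - move=> x _; rewrite /hh /=; have [xM|xM] := boolP (x \in @cball R n M); last first.
      rewrite indicE (negbTE xM) mulr0 normr0; apply: nneseries_ge0 => k _ _.
      by rewrite lee_fin mulr_ge0.
    have e_ge0 : 0 <= enorm x ^- m by rewrite invr_ge0 exprn_ge0// enorm_ge0.
    rewrite indicE xM mulr1 ger0_norm//.
    suff [k Dk ck] : exists2 k, D k x & enorm x ^- m <= c k.
      apply: le_trans (@nneseries_lim_ge _ (fun k => (c k * \1_(D k) x)%:E) xpredT 0%N k.+1 _).
        rewrite big_nat_recr//= indicE (mem_set Dk) mulr1.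
        apply: (@le_trans _ _ (c k)%:E); first by rewrite lee_fin.
        rewrite leeDr//; apply: sume_ge0 => l _; by rewrite lee_fin mulr_ge0.
      by move=> l _ _; rewrite lee_fin mulr_ge0.
    have xM' : `|x| <= M by move: xM; rewrite inE.
    have [x0|x0] := eqVneq x 0.
      exists 0%N; first by rewrite /D /cball /= x0 normr0 ltW.
      have [m0|m0] := eqVneq m 0%N; first by rewrite /c m0 !expr0.
      have /eqP -> : enorm x == 0 by rewrite enorm_eq0 x0.
      by rewrite expr0n (negbTE m0) invr0.
    have N0 : 0 < `|x| by rewrite normr_gt0.
    have exk : exists k, M / 2 ^+ k.+1 < `|x|.
      have [k hk] := @exists_pow2_lt R (`|x| / M) (divr_gt0 N0 M0).
      exists k; have := hk k.+1 (leqnSn _); rewrite ltr_pdivlMr// mulrC; exact.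
    have [k hk kmin] := ex_minnP exk.
    exists k; last by apply: enormV_le => //; exact: ltW.
    rewrite /D /cball /=; case: k hk kmin => [|k] hk kmin; first by rewrite expr0 divr1.
    rewrite leNgt; apply/negP => h; have := kmin k h; by rewrite ltnn.
apply: le_trans key _; rewrite integral_nneseries//; last first.
- by move=> k x _; rewrite lee_fin mulr_ge0.
apply: le_trans (@epsilon_trick0 R A xpredT A0).
apply: lee_nneseries => k.
  by move=> _ _; apply: integral_ge0 => x _; rewrite lee_fin mulr_ge0.
move=> _; under eq_integral do rewrite EFinM.
rewrite ge0_integralZl//; last 2 first.
- by apply/measurable_EFinP; exact: measurable_indic.
- by rewrite lee_fin.
rewrite integral_indic// setIT.
apply: le_trans (lee_wpmul2l _ (Leb_cball_le n (M2 k))) _; first by rewrite lee_fin.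
rewrite -EFinM lee_fin natrX.
have [l ln] : exists l, (n = m + l.+1)%N by exists (n - m).-1; rewrite prednK ?subn_gt0// subnKC// ltnW.
have Mn : M != 0 by rewrite gt_eqF.
have p2 : (2 ^+ k : R) != 0 by rewrite expf_neq0// pnatr_eq0.
have -> : c k * (4 * (M / 2 ^+ k)) ^+ n = A / 2 ^+ k.+1 * (2 ^+ k)^-1 ^+ l.
  rewrite /c /A ln [2 ^+ k.+1]exprS; set t := 2 ^+ k in p2 *.
  have e1 : (4 * (M / t)) ^+ (m + l.+1) = (4 * M) ^+ (m + l.+1) * (t^-1 ^+ m * (t^-1 * t^-1 ^+ l)).
    by rewrite mulrA exprMn; congr (_ * _); rewrite exprD exprS.
  have e2 : (M / (2 * t)) ^- m = 2 ^+ m * t ^+ m * (M ^+ m)^-1.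
    by rewrite -exprVn invf_div !exprMn exprVn.
  have e3 : t ^+ m * t^-1 ^+ m = 1 by rewrite -exprMn mulfV// expr1n.
  rewrite e1 e2; set P := (4 * M) ^+ _; set a := (M ^+ m)^-1; set y := t^-1 ^+ l; set b := 2 ^+ m.
  have -> : b * t ^+ m * a * (P * (t^-1 ^+ m * (t^-1 * y))) =
    (t ^+ m * t^-1 ^+ m) * (b * a * P * t^-1 * y) by ring.
  by rewrite e3 mul1r; field.
rewrite ler_piMr ?divr_ge0 ?exprn_ge0//; apply: exprn_ile1; first by rewrite invr_ge0 exprn_ge0.
by rewrite invf_le1 ?exprn_gt0// exprn_ege1// ler1n.
Qed.

Lemma real_dominated_convergence n (hk : nat -> 'cV[R]_n -> R) (l g : 'cV[R]_n -> R) :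
  (forall k, continuous (hk k)) -> (forall x, (fun k => hk k x) @ \oo --> l x) ->
  (Leb n).-integrable setT (EFin \o g) -> (forall k x, `|hk k x| <= g x) ->
  (fun k => \int[Leb n]_x hk k x) @ \oo --> \int[Leb n]_x l x.
Proof.
move=> ck cv ig hg.
have mk k : measurable_fun setT (fun x : borelR R n => hk k x) by exact: continuous_measurable_cV.
have ml : measurable_fun setT (fun x : borelR R n => l x).
  by apply: (@measurable_fun_cvg _ _ _ setT (fun k (x : borelR R n) => hk k x)) => // x _; exact: cv.
have mkE k : measurable_fun setT (fun x : borelR R n => (hk k x)%:E) by exact/measurable_EFinP.
have mlE : measurable_fun setT (fun x : borelR R n => (l x)%:E) by exact/measurable_EFinP.
have cae : {ae Leb n, forall x, setT x -> (fun k => (hk k x)%:E) @ \oo --> (l x)%:E}.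
  by apply: aeW => x _; apply/fine_cvgP; split; [exact: nearW|exact: cv].
have bae : {ae Leb n, forall x k, setT x -> (`|(hk k x)%:E| <= (g x)%:E)%E}.
  by apply: aeW => x k _; rewrite lee_fin.
have [il _] := dominated_convergence measurableT mkE mlE cae ig bae.
have -> : (\int[Leb n]_x (l x)%:E = (\int[Leb n]_x l x)%:E)%E.
  by rewrite /Rintegral fineK//; exact: integrable_fin_num.
by move=> /fine_cvg.
Qed.

Let eps (k : nat) : R := k.+1%:R^-1.

Let eps_gt0 k : 0 < eps k. Proof. by rewrite invr_gt0. Qed.

(** Solving the definition of [beta] for zeta gives zeta = beta s^-m - m s^-m eta; both regularised
    terms differ from these by at most a constant, depending on s, times e. *)
Let profile_cvg s : 0 < s ->
  (fun k => beta s * qabs (eps k) s ^- m - m%:R * greg (eps k) s) @ \oo --> zeta s.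
Proof.
move=> s0; have [B B0 hB] := gamma_bounded.
pose K := `|beta s| * (s ^- m * (m%:R / s)) + m%:R * (B * (s ^- m.+2 * (m.+2%:R / s)) * M).
have K0 : 0 <= K.
  by rewrite /K !(addr_ge0, mulr_ge0)// ?invr_ge0 ?exprn_ge0// ltW.
have hc : (fun k => K * eps k) @ \oo --> K * 0.
  by apply: cvgM; [exact: cvg_cst|exact: cvg_harmonic].
apply/cvgrPdist_le => e e0; move: hc; rewrite mulr0 => /cvgrPdist_le/(_ e e0).
apply: filterS => k; rewrite sub0r normrN ger0_norm ?mulr_ge0//; last exact: ltW.
apply: le_trans; rewrite distrC.
have h1 := qabsV_close (eps_gt0 k) m s0 (lexx s).
have zE : zeta s = beta s * s ^- m - m%:R * (s ^- m * eta s).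
  have sm : s ^+ m != 0 by rewrite expf_neq0// gt_eqF.
  by rewrite /beta; field.
have h2 : m%:R * `|greg (eps k) s - s ^- m * eta s| <=
    m%:R * (B * (s ^- m.+2 * (m.+2%:R * (eps k / s))) * M).
  have [->|m0] := eqVneq m 0%N; first by rewrite !mul0r.
  by rewrite ler_wpM2l//; apply: greg_close => //; rewrite lt0n.
rewrite zE (_ : _ - _ = - (beta s * (s ^- m - qabs (eps k) s ^- m)) -
  m%:R * (greg (eps k) s - s ^- m * eta s)); last by ring.
apply: le_trans (ler_normB _ _) _; rewrite normrN !normrM normr_nat.
have h3 : `|beta s| * `|s ^- m - qabs (eps k) s ^- m| <= `|beta s| * (s ^- m * (m%:R * (eps k / s))).
  by rewrite ler_wpM2l.
apply: le_trans (lerD h3 h2) _; rewrite le_eqVlt; apply/orP; left; apply/eqP; rewrite /K; ring.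
Qed.

(** Dominated convergence in [key_identity]. Since |gamma| <= B, the bounds on 1 / q_e and [greg]
    dominate the integrand by a constant times |x|^-m on the ball of radius M, independently of
    e. *)
Theorem regularized_limit n (u : 'cV[R]_n -> R) (i : 'I_n) : (m < n)%N -> is_Ck 3 u ->
  (fun k : nat => \int[Leb n]_x (beta (enorm x) * x i 0 *
    (\det (pencil (hessian u x) (hessian (qnorm k.+1%:R^-1) x)))`_m)) @ \oo -->
  \int[Leb n]_x (zeta (enorm x) * x i 0 * (dpoly (hessian u x))`_m).
Proof.
move=> mn C3; pose d x := (dpoly (hessian u x))`_m.
have cd : continuous d.
  by apply: cts_dpoly => k j; exact: is_Ck_cts (is_Ck_hessian k j C3).
have [Dm hD] := compact_norm_bounded_fun (@compact_ball R n M) cd.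
have Dm0 : 0 <= Dm by apply: le_trans (hD 0 _); rewrite ?normr_ge0//= normr0 ltW.
have [B B0 hB] := gamma_bounded.
pose hk k (x : 'cV[R]_n) := x i 0 * d x * (beta (enorm x) * qabs (eps k) (enorm x) ^- m - m%:R * greg (eps k) (enorm x)).
rewrite (_ : (fun k : nat => _) = (fun k => \int[Leb n]_x hk k x)); last first.
  by apply/funext => k; rewrite (key_identity (eps_gt0 k) i C3).
pose K := Dm * (B + m%:R * B).
apply: (@real_dominated_convergence n hk _ (fun x => K * (enorm x ^- m * \1_(@cball R n M) x))).
- move=> k; have -> : hk k = (fun x => beta (enorm x) * x i 0 * (qabs (eps k) (enorm x) ^- m * d x) -
      greg (eps k) (enorm x) * x i 0 * (m%:R * d x)).
    by apply/funext => x; rewrite /hk; ring.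
  have c1 : continuous (fun x : 'cV[R]_n => qabs (eps k) (enorm x) ^- m).
    exact: (@cts_comp _ _ _ _ (fun t => qabs (eps k) t ^- m) (@continuous_enorm R n)
      (@qabsV_continuous _ (eps_gt0 k) m)).
  have c2 : continuous (fun x : 'cV[R]_n => greg (eps k) (enorm x)).
    exact: (@cts_comp _ _ _ _ (greg (eps k)) (@continuous_enorm R n) (@greg_continuous _ (eps_gt0 k))).
  apply: ctsB; apply: ctsM; [exact: beta_radial_continuous|exact: ctsM| |].
    by apply: ctsM c2 _; exact: continuous_coord.
  by apply: ctsM => //; exact: ctsC.
- move=> x; have [->|x0] := eqVneq x 0.
    have E : (0 : 'cV[R]_n) i 0 = 0 by rewrite mxE.
    by rewrite /hk E mulr0 !mul0r; apply: cvg_near_cst; apply: nearW => k; rewrite !mul0r.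
  rewrite (_ : zeta _ * _ * _ = x i 0 * d x * zeta (enorm x)); last by rewrite /d; ring.
  by apply: cvgM; [exact: cvg_cst|apply: profile_cvg; rewrite enorm_gt0].
- have := integrableZl measurableT K (integrable_enormV mn).
  by apply: eq_integrable => // x _; rewrite /= EFinM.
- move=> k x; have [xM|xM] := leP `|x| M; last first.
    rewrite /hk beta_eq0 ?(lt_le_trans xM) ?norm_le_enorm// greg_eq0; last first.
      by apply: ltW; rewrite (lt_le_trans xM)// norm_le_enorm.
    rewrite mul0r mulr0 subrr mulr0 normr0 !mulr_ge0 ?addr_ge0 ?mulr_ge0//.
    by rewrite invr_ge0 exprn_ge0// enorm_ge0.
  have xD : x \in @cball R n M by apply/mem_set.
  rewrite indicE xD mulr1.
  have [x0|x0] := eqVneq x 0.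
    have E : x i 0 = 0 by rewrite x0 mxE.
    rewrite /hk E !mul0r normr0 !mulr_ge0 ?addr_ge0 ?mulr_ge0//.
    by rewrite invr_ge0 exprn_ge0// enorm_ge0.
  have s0 : 0 < enorm x by rewrite enorm_gt0.
  set s := enorm x in s0 *.
  have sm0 : 0 <= s ^- m by rewrite invr_ge0 exprn_ge0// ltW.
  have a1 : s * `|beta s * qabs (eps k) s ^- m| <= B * s ^- m.
    rewrite normrM mulrA; apply: ler_pM => //; first by rewrite mulr_ge0// ltW.
      by have := hB s; rewrite /gamma normrM (gtr0_norm s0).
    rewrite ger0_norm; last by rewrite invr_ge0 exprn_ge0// ltW// qabs_gt0.
    exact: qabsV_le.
  have a2 : s * `|m%:R * greg (eps k) s| <= m%:R * B * s ^- m.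
    rewrite normrM normr_nat mulrCA -mulrA ler_wpM2l//.
    have h : s * `|greg (eps k) s| <= s * (B * s ^- m.+1).
      by rewrite ler_pM2l//; exact: greg_bound.
    apply: le_trans h _.
    rewrite le_eqVlt; apply/orP; left; apply/eqP; rewrite exprS; field.
    by rewrite expf_neq0 gt_eqF.
  rewrite /hk normrM (normrM (x i 0)).
  have a3 : `|x i 0| * `|d x| <= s * Dm by apply: ler_pM => //; [exact: coord_le_enorm|exact: hD].
  apply: le_trans (ler_wpM2r _ a3) _; first exact: normr_ge0.
  rewrite -/s [s * Dm]mulrC -mulrA /K -mulrA ler_wpM2l//.
  apply: (@le_trans _ _ (s * (`|beta s * qabs (eps k) s ^- m| + `|m%:R * greg (eps k) s|))).
    by rewrite ler_pM2l// ler_normB.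
  by rewrite mulrDr [leRHS]mulrDl lerD.
Qed.

End profile.

(** * Smooth strongly convex approximation *)

Section approximation.
Context {R : realType} {n : nat}.
Implicit Types (x y : 'cV[R]_n) (v : 'cV[R]_n -> R).
Local Notation e_ i := (basis_vec i).

(** Mollify v at a scale where its oscillation on the ball of radius k is at most d = 1 / (k + 1),
    then add d / 2 |x|^2 to gain strong convexity. *)
Lemma smooth_approximation v k : is_Conv v -> exists vk : 'cV[R]_n -> R,
  sconv k.+1%:R^-1 vk /\
  forall x, `|x| <= k%:R -> `|vk x - v x| <= k.+1%:R^-1 * (1 + dotv x x).
Proof.
move=> cv; have cts := is_Conv_continuous cv.
pose d : R := k.+1%:R^-1; have d0 : 0 < d by rewrite invr_gt0.
have [r [r0 _ hr]] := uniform_continuity_ball k%:R cts d0.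
have [ka [k3 kr kp k1]] := @exists_kernel R n r r0.
exists (fun x => cnv ka v x + d / 2 * dotv x x); split; [split|].
- apply: is_CkDr; first exact: is_Ck_cnv k3 kr cts.
  by apply: is_CkZ; exact: is_Ck_sqnorm.
- by under eq_fun do rewrite addrK; exact: is_Conv_cnv (is_Ck_cts k3) kr kp cv.
move=> x xk; have := cnv_bound (x := x) (is_Ck_cts k3) kr cts kp k1 (fun y => hr x y xk).
rewrite -/d => h; rewrite addrAC; apply: le_trans (ler_normD _ _) _.
rewrite mulrDr mulr1; apply: lerD => //.
have q0 := dotv_ge0 x; rewrite ger0_norm; last by rewrite mulr_ge0// divr_ge0// ltW.
by rewrite ler_wpM2r//; lra.
Qed.

Lemma lucvg_le (wk : nat -> 'cV[R]_n -> R) v (c : 'cV[R]_n -> R) : continuous c ->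
  (forall k x, `|x| <= k%:R -> `|wk k x - v x| <= k.+1%:R^-1 * c x) -> lucvg wk v.
Proof.
move=> cc hw M h h0; have [C hC] := compact_norm_bounded_fun (@compact_ball R n M) cc.
have p : 0 < `|C| + 1 by rewrite ltr_wpDl.
have hc : (fun k => k.+1%:R^-1 * (`|C| + 1)) @ \oo --> 0 * (`|C| + 1).
  by apply: cvgM; [exact: cvg_harmonic|exact: cvg_cst].
move: hc; rewrite mul0r => /cvgrPdist_le/(_ h h0) near1.
have near2 : \forall k \near \oo, M <= k%:R :> R.
  exists (Num.bound `|M|) => // k /= hk; apply: le_trans (ler_norm M) _.
  apply: (@le_trans _ _ (Num.bound `|M|)%:R); last by rewrite ler_nat.
  by apply: ltW; exact: archi_boundP.
apply: filterS2 near1 near2 => k; rewrite sub0r normrN ger0_norm; last first.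
  by rewrite mulr_ge0// ltW.
move=> h1 Mk x xM; apply: le_trans (hw k x (le_trans xM Mk)) _; apply: le_trans h1.
rewrite ler_wpM2l//; have := hC x xM; have := ler_norm (c x); have := ler_norm C; lra.
Qed.

(** w_k(x_k) tends to v(x) along every sequence x_k tending to x. This gives the lower bound, and
    the constant sequence serves as recovery sequence. *)
Lemma lucvg_epi_cvg (wk : nat -> 'cV[R]_n -> R) v : continuous v -> lucvg wk v -> epi_cvg wk v.
Proof.
move=> cv lu x.
have key (xk : nat -> 'cV[R]_n) : xk @ \oo --> x -> (fun k => wk k (xk k)) @ \oo --> v x.
  move=> cx; apply/cvgrPdist_le => e e0; have e2 : 0 < e / 2 by rewrite divr_gt0.
  have c1 : (fun k => v (xk k)) @ \oo --> v x by apply: (cvg_comp _ v cx); exact: cv.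
  have n1 : \forall k \near \oo, `|v x - v (xk k)| <= e / 2 by move/cvgrPdist_le : c1; apply.
  have n2 : \forall k \near \oo, `|xk k| <= `|x| + 1.
    have cn : (fun k => `|xk k|) @ \oo --> `|x| by exact: cvg_norm.
    have h : `|x| < `|x| + 1 by rewrite ltrDl.
    by have /cvgr_lt/(_ _ h) := cn; apply: filterS => k /ltW.
  have n3 := lu (`|x| + 1) _ e2.
  apply: filterS3 n1 n2 n3 => k h1 h2 /(_ _ h2) h3.
  rewrite (_ : _ - _ = (v x - v (xk k)) - (wk k (xk k) - v (xk k))); last by ring.
  by apply: le_trans (ler_normB _ _) _; lra.
split => [xk cx|]; last first.
  by exists (fun=> x); [exact: cvg_cst|apply: key; exact: cvg_cst].
have h : (fun k => (wk k (xk k))%:E) @ \oo --> (v x)%:E.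
  by apply/fine_cvgP; split; [exact: nearW|exact: key].
by have [-> _] := cvg_limn_einf_sup h.
Qed.

Lemma hessianD (u h : 'cV[R]_n -> R) r x : is_Ck 2 u -> is_Ck 2 h ->
  hessian (fun y => u y + r * h y) x = hessian u x + r *: hessian h x.
Proof.
move=> Cu Ch; apply/matrixP => i j.
have hE (A B : 'M[R]_n) : (A + r *: B) i j = A i j + r * B i j by rewrite !mxE.
apply: etrans (hessianE _ x i j) _.
apply: etrans _ (esym (etrans (hE _ _)
  (congr2 (fun a b => a + r * b) (hessianE u x i j) (hessianE h x i j)))).
have dD (f g : 'cV[R]_n -> R) k y : is_Ck 1 f -> is_Ck 1 g ->
    'D_(e_ k) (fun z => f z + r * g z) y = 'D_(e_ k) f y + r * 'D_(e_ k) g y.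
  move=> Cf Cg; have h1 := is_derive_mul (is_derive_cst r y (e_ k)) (is_Ck_derive k y Cg).
  by have [_ ->] := is_deriveD (is_Ck_derive k y Cf) h1; rewrite mul0r add0r.
have -> : 'D_(e_ i) (fun y => u y + r * h y) = (fun y => 'D_(e_ i) u y + r * 'D_(e_ i) h y).
  by apply/funext => y; apply: dD; [exact: is_Ck_le Cu|exact: is_Ck_le Ch].
by apply: dD; exact: is_Ck_D.
Qed.

Lemma qnorm_close e x : 0 <= e -> `|qnorm e x - enorm x| <= e.
Proof.
move=> e0; have s0 := enorm_ge0 x.
have h1 : enorm x <= qnorm e x.
  by rewrite /qnorm -[leLHS](ger0_norm s0) -sqrtr_sqr sqr_enorm; apply: ler_wsqrtr; rewrite lerDl sqr_ge0.
have p : 0 <= enorm x + e by exact: addr_ge0.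
have h2 : qnorm e x <= enorm x + e.
  rewrite /qnorm -[leRHS](ger0_norm p) -sqrtr_sqr; apply: ler_wsqrtr.
  by rewrite sqrrD sqr_enorm -addrA lerD2l lerDr mulrn_wge0// mulr_ge0.
by rewrite ger0_norm; lra.
Qed.

Lemma sconvD d (u h : 'cV[R]_n -> R) r : 0 <= r -> sconv d u -> is_Ck 3 h -> is_Conv h ->
  sconv d (fun y => u y + r * h y).
Proof.
move=> r0 [Cu cu] Ch ch; split; first exact: is_CkDr Cu (is_CkZ r Ch).
have := is_ConvD cu (is_ConvZ r0 ch).
by under eq_fun do rewrite addrAC.
Qed.

End approximation.

(** * Nonnegative combinations of measures *)

Section measure_sum.
Context {R : realType} {n : nat}.
Variables (N : nat) (c : nat -> {nonneg R}) (m : nat -> {measure set (borelR R n) -> \bar R}).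

(** Packages the right-hand side of the expansion defining MA_j as a measure, the form in which
    [weak_convergence] takes the Monge-Ampere measure. *)
Definition msumscale : {measure set (borelR R n) -> \bar R} :=
  [the measure _ _ of msum (fun l => [the measure _ _ of mscale (c l) (m l)]) N].

Lemma msumscaleE A : msumscale A = (\sum_(l < N) (c l)%:num%:E * m l A)%E.
Proof. by []. Qed.

Lemma integral_msumscale (f : borelR R n -> R) : measurable_fun setT f ->
  (forall l, (l < N)%N -> (m l).-integrable setT (EFin \o f)) ->
  (\int[msumscale]_x (f x)%:E = (\sum_(l < N) (c l)%:num * \int[m l]_x f x)%:E)%E.
Proof.
move=> mf fi; have mfE : measurable_fun setT (EFin \o f) by exact/measurable_EFinP.
have ge0 (g : borelR R n -> \bar R) : measurable_fun setT g -> (forall x, 0 <= g x)%E ->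
    (forall l, (l < N)%N -> (\int[m l]_x g x)%E \is a fin_num) ->
    (\int[msumscale]_x g x = (\sum_(l < N) (c l)%:num * fine (\int[m l]_x g x))%:E)%E.
  move=> mg g0 gf; rewrite /msumscale ge0_integral_measure_sum// -sumEFin.
  by apply: eq_bigr => l _; rewrite ge0_integral_mscale// EFinM fineK//; exact: gf.
rewrite integralE ge0; last 3 first.
- exact: measurable_funepos.
- by move=> x; exact: funepos_ge0.
- by move=> l lN; apply: integrable_pos_fin_num => //; exact: fi.
rewrite ge0; last 3 first.
- exact: measurable_funeneg.
- by move=> x; exact: funeneg_ge0.
- by move=> l lN; apply: integrable_neg_fin_num => //; exact: fi.
rewrite -EFinB -sumrB; congr EFin; apply: eq_bigr => l _.
have h := fi l (ltn_ord l).
have E : \int[m l]_x f x = fine (\int[m l]_x (EFin \o f)^\+ x) - fine (\int[m l]_x (EFin \o f)^\- x).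
  rewrite [LHS](congr1 fine (integralE _ _ (EFin \o f))).
  by apply: fineB; [exact: integrable_pos_fin_num|exact: integrable_neg_fin_num].
by rewrite -mulrBr E.
Qed.

End measure_sum.

(** * Identification of the valuation *)

Section representation.
Context {R : realType} {n : nat}.
Variables (j : nat) (zeta : R -> R) (z : ('cV[R]_n -> R) -> 'cV[R]_n) (M : R).
Hypotheses (n0 : (0 < n)%N) (j0 : (0 < j)%N) (jn : (j <= n)%N).
Let m := (n - j)%N.
Hypotheses (M0 : 0 < M) (zc : forall s, 0 < s -> {for s, continuous zeta})
  (zM : forall s, M < s -> zeta s = 0)
  (z0 : (fun s => s ^+ m.+1 * zeta s) @ 0^'+ --> (0 : R)) (zt : is_tstar j zeta z).

Let b := beta zeta m.

Let mn : (m < n)%N. Proof. by rewrite /m ltn_subrL j0. Qed.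

Lemma tstar_smooth (u : 'cV[R]_n -> R) i : is_Conv u -> is_Ck 3 u ->
  z u i 0 = \int[Leb n]_x (zeta (enorm x) * x i 0 * (dpoly (hessian u x))`_m).
Proof.
move=> cu C3; have [_ _ _ _ /(_ u cu (is_Ck_le _ C3) i)] := zt => /(_ isT).
rewrite lebesgue_nE => /(congr1 fine) /= ->.
apply: eq_Rintegral => x _; congr (_ * _); rewrite elem_symE//.
by apply: hessian_sym; exact: is_Ck_le C3.
Qed.

(** A diagonal choice: for the k-th smooth function, [regularized_limit] provides e_k <= 1 / (k + 1)
    with the coefficient integral within 1 / (k + 1) of z(v_k), and z(v_k) tends to z(v) by
    epi-continuity. *)
Lemma approximating_sequence (v : 'cV[R]_n -> R) i : is_Conv v ->
  exists (vk : nat -> 'cV[R]_n -> R) (e : nat -> R),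
  [/\ forall k, sconv k.+1%:R^-1 (vk k), forall k, 0 < e k <= k.+1%:R^-1,
    lucvg vk v & (fun k => \int[Leb n]_x (b (enorm x) * x i 0 *
      (\det (pencil (hessian (vk k) x) (hessian (qnorm (e k)) x)))`_m)) @ \oo --> z v i 0].
Proof.
move=> cv; have [vk hvk] := choice (fun k => smooth_approximation k cv).
have d0 k : 0 < k.+1%:R^-1 :> R by rewrite invr_gt0.
have svk k : sconv k.+1%:R^-1 (vk k) by have [] := hvk k.
have C3 k : is_Ck 3 (vk k) by have [] := svk k.
have cvk k : is_Conv (vk k) := sconv_conv (d0 k) (svk k).
have lu : lucvg vk v.
  apply: (@lucvg_le _ _ _ _ (fun x => 1 + dotv x x)).
    by apply: ctsD; [exact: ctsC|exact: continuous_dotv (@cts_id _) (@cts_id _)].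
  by move=> k x xk; have [_] := hvk k; exact.
pose J k e := \int[Leb n]_x (b (enorm x) * x i 0 *
      (\det (pencil (hessian (vk k) x) (hessian (qnorm e) x)))`_m).
have exe k : exists e, 0 < e <= k.+1%:R^-1 /\ `|z (vk k) i 0 - J k e| <= k.+1%:R^-1.
  have := @regularized_limit R zeta m M M0 zc zM z0 n (vk k) i mn (C3 k); rewrite -tstar_smooth//.
  move=> /cvgrPdist_le/(_ _ (d0 k))[K _ hK].
  exists (maxn K k).+1%:R^-1; split.
    rewrite invr_gt0 ltr0n/= lef_pV2 ?posrE// ler_nat ltnS; exact: leq_maxr.
  by apply: hK => /=; exact: leq_maxl.
have [e he] := choice exe; exists vk, e; split => //.
  by move=> k; have [] := he k.
have cz : (fun k => z (vk k) i 0) @ \oo --> z v i 0.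
  have [_ zcont _ _ _] := zt.
  have := zcont vk v cvk cv (lucvg_epi_cvg (is_Conv_continuous cv) lu).
  by move/cvg_cVP; exact.
have cd : (fun k => z (vk k) i 0 - J k (e k)) @ \oo --> (0 : R).
  apply/cvgrPdist_le => h h0; have hh := @cvg_harmonic R.
  move/cvgrPdist_le : hh => /(_ h h0); apply: filterS => k.
  rewrite !sub0r !normrN => hk; have [_ h1] := he k.
  by apply: le_trans h1 _; apply: le_trans (ler_norm _) hk.
have E : (fun k => z (vk k) i 0 - (z (vk k) i 0 - J k (e k))) = (fun k => J k (e k)).
  by apply/funext => k; rewrite opprB addrC subrK.
have h : (fun k => z (vk k) i 0 - (z (vk k) i 0 - J k (e k))) @ \oo --> z v i 0 - 0.
  exact: cvgB cz cd.
by move: h; rewrite E subr0.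
Qed.

(** The r^m coefficient of the integral of f det D^2(v_k + r q_(e_k)) has two limits. By
    [approximating_sequence] it tends to 'C(n, j) z(v)_i; by [weak_convergence] and interpolation it
    tends to the r^m coefficient of the integral of f against MA(v + r|.|). *)
Theorem representation (v : 'cV[R]_n -> R)
    (MAv : nat -> {measure set (borelR R n) -> \bar R}) (i : 'I_n) :
  is_Conv v -> is_MAj v MAv ->
  (MAv j).-integrable setT (EFin \o (fun x : 'cV[R]_n => 'C(n, j)%:R * (b (enorm x) * x i 0))) /\
  z v i 0 = \int[MAv j]_x ('C(n, j)%:R * (b (enorm x) * x i 0)).
Proof.
move=> cv hMA; pose f (x : 'cV[R]_n) := 'C(n, j)%:R * (b (enorm x) * x i 0).
have cf : continuous f.
  by apply: ctsM; [exact: ctsC|exact: @beta_radial_continuous R zeta m M zc zM z0 n i].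
have fM : supp_in f M.
  move=> x xM; rewrite /f /b (beta_eq0 m zM) ?mul0r ?mulr0//.
  by rewrite (lt_le_trans xM)// norm_le_enorm.
have mf : measurable_fun setT (f : borelR R n -> R) := continuous_measurable_cV cf.
have [C fC] := continuous_supp_bounded cf fM.
have cr0 r l : 0 <= r -> 0 <= 'C(n, l)%:R * r ^+ (n - l) :> R.
  by move=> r0; rewrite mulr_ge0// exprn_ge0.
pose cc r (r0 : 0 <= r) l : {nonneg R} := NngNum (cr0 r l r0).
pose mur r (r0 : 0 <= r) := msumscale n.+1 (cc r r0) MAv.
have murE r (r0 : 0 <= r) (B : set (borelR R n)) : measurable B -> MA (fun x => v x + r * enorm x) B = mur r r0 B.
  by move=> mB; rewrite (hMA r B r0 mB) msumscaleE.
have cw r (r0 : 0 <= r) : is_Conv (fun x => v x + r * enorm x).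
  by apply: is_ConvD => //; apply: is_ConvZ => //; exact: is_Conv_enorm.
(* At r = 1 each MA_l occurs with a positive coefficient in MA(v + |.|), which is finite on
   balls. *)
have MAfin l : (l < n.+1)%N -> (MAv l (@cball R n M) < +oo)%E.
  move=> ln; have h := mu_ball_lty n0 (cw 1 ler01) (murE 1 ler01) M.
  have C0 : 0 < 'C(n, l)%:R :> R by rewrite ltr0n bin_gt0.
  have : ('C(n, l)%:R%:E * MAv l (@cball R n M) < +oo)%E.
    apply: le_lt_trans h; rewrite msumscaleE (bigD1 (Ordinal ln))//= expr1n mulr1 leeDl//.
    by apply: sume_ge0 => k _; rewrite mule_ge0// lee_fin mulr_ge0// exprn_ge0.
  have := measure_ge0 (MAv l) (@cball R n M); case: (MAv l _) => [a| |] //=.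
    by move=> _ _; exact: ltry.
  by move=> _; rewrite mulry gtr0_sg// mul1e.
have fi l : (l < n.+1)%N -> (MAv l).-integrable setT (EFin \o f).
  by move=> ln; exact: (integrable_bounded_supp (MAfin l ln) mf fC fM).
split; first exact: fi.
have [vk [e [svk he lu cJ]]] := approximating_sequence i cv.
have d0 k : 0 < k.+1%:R^-1 :> R by rewrite invr_gt0.
have e0 k : 0 < e k by have /andP[] := he k.
have C3 k : is_Ck 3 (vk k) by have [] := svk k.
pose A k (x : 'cV[R]_n) := hessian (vk k) x.
pose H k (x : 'cV[R]_n) := hessian (qnorm (e k)) x.
pose L k (x : 'cV[R]_n) : {poly R} := f x *: \det (pencil (A k x) (H k x)).
pose P k : {poly R} := \poly_(l < n.+1) \int[Leb n]_x (L k x)`_l.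
pose Q : {poly R} := \poly_(l < n.+1) ('C(n, n - l)%:R * \int[MAv (n - l)%N]_x f x).
have cD k : cts_coefs (fun x => \det (pencil (A k x) (H k x))).
  apply: cts_coefs_det; apply: cts_coefs_pencil => a a'.
    exact: is_Ck_cts (is_Ck_hessian a a' (C3 k)).
  exact: is_Ck_cts (is_Ck_hessian a a' (is_Ck_qnorm (e0 k) 3)).
have cL k : cts_coefs (L k).
  by move=> l; under eq_fun do rewrite coefZ; apply: ctsM; [exact: cf|exact: cD].
have LM k l : supp_in (fun x => (L k x)`_l) M.
  by move=> x xM; rewrite coefZ fM// mul0r.
(* Values at natural r suffice, as these are the nodes of the interpolation. *)
have cvP (r : nat) : (fun k => (P k).[r%:R]) @ \oo --> Q.[r%:R].
  have r0 : 0 <= r%:R :> R by [].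
  pose wk k x := vk k x + r%:R * qnorm (e k) x.
  have swk k : sconv k.+1%:R^-1 (wk k).
    by apply: sconvD => //; [exact: is_Ck_qnorm|exact: is_Conv_qnorm].
  have lw : lucvg wk (fun x => v x + r%:R * enorm x).
    move=> M' h h0; have h2 : 0 < h / 2 by rewrite divr_gt0.
    have hc : (fun k : nat => r%:R * k.+1%:R^-1 : R) @ \oo --> (r%:R * 0 : R).
      by apply: cvgM; [exact: cvg_cst|exact: cvg_harmonic].
    move: hc; rewrite mulr0 => /cvgrPdist_le/(_ _ h2); apply: filterS2 (lu M' _ h2).
    move=> k h1; rewrite sub0r normrN ger0_norm; last by rewrite mulr_ge0// ltW.
    move=> hr x xM; have h3 := h1 x xM.
    rewrite /wk (_ : _ - _ = (vk k x - v x) + r%:R * (qnorm (e k) x - enorm x)); last by ring.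
    apply: le_trans (ler_normD _ _) _; rewrite normrM normr_nat.
    have h4 : r%:R * `|qnorm (e k) x - enorm x| <= r%:R * k.+1%:R^-1.
      rewrite ler_wpM2l//; apply: le_trans (qnorm_close x (ltW (e0 k))) _.
      by have /andP[] := he k.
    by rewrite [leRHS]splitr; apply: lerD; [exact: h3|exact: le_trans h4 hr].
  have d1 k : k.+1%:R^-1 <= 1 :> R by rewrite invf_le1// ler1n.
  have E : (fun k => (P k).[r%:R]) = (fun k => \int[Leb n]_x (f x * \det (hessian (wk k) x))).
    apply/funext => k; have sL x : (size (L k x) <= n.+1)%N.
      by apply: leq_trans (size_scale_leq _ _) _; exact: size_det_pencil.
    rewrite /P -(integral_horner _ sL (cL k) (LM k)); apply: eq_Rintegral => x _.
    rewrite hornerZ horner_det_pencil; congr (_ * \det _).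
    by rewrite hessianD//; [exact: is_Ck_le (C3 k)|exact: is_Ck_qnorm].
  have QE : \int[mur r%:R r0]_x f x = Q.[r%:R].
    rewrite /Rintegral integral_msumscale//= horner_poly.
    (* The expansion is indexed by l with power r^(n - l), the polynomial Q by the power itself. *)
    rewrite (reindex_inj rev_ord_inj)/=; apply: eq_bigr => l _.
    by rewrite subSS subKn -1?ltnS//; ring.
  have [_] := weak_convergence n0 (cw _ r0) (murE _ r0) d0 d1 swk lw (ltW M0) cf fM.
  by rewrite E QE; exact.
have cP : (fun k => (P k)`_m) @ \oo --> Q`_m.
  by apply: (cvg_coef _ _ cvP) => [k|]; exact: size_poly.
have mn1 : (m < n.+1)%N by rewrite ltnS ltnW.
have Cj : 'C(n, j)%:R != 0 :> R by rewrite pnatr_eq0 -lt0n bin_gt0.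
(* Besides the binomial factor of the expansion, f contains its own 'C(n, j); the former is
   cancelled at the end against the one that f brings to [cP']. *)
have QE : Q`_m = 'C(n, j)%:R * \int[MAv j]_x f x.
  by rewrite coef_poly mn1 /m subKn.
have cP' : (fun k => (P k)`_m) @ \oo --> 'C(n, j)%:R * z v i 0.
  have h : (fun k => 'C(n, j)%:R * (\int[Leb n]_x (b (enorm x) * x i 0 *
      (\det (pencil (A k x) (H k x)))`_m))) @ \oo --> 'C(n, j)%:R * z v i 0.
    by apply: cvgM; [exact: cvg_cst|exact: cJ].
  suff E : (fun k => (P k)`_m) = (fun k => 'C(n, j)%:R * (\int[Leb n]_x (b (enorm x) * x i 0 *
      (\det (pencil (A k x) (H k x)))`_m))) by rewrite E; exact: h.
  apply/funext => k; rewrite coef_poly mn1.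
  pose g (x : 'cV[R]_n) := b (enorm x) * x i 0 * (\det (pencil (A k x) (H k x)))`_m.
  have cg : continuous g.
    by apply: ctsM; [exact: (@beta_radial_continuous R zeta m M zc zM z0 n i)|exact: cD].
  have gM : supp_in g M.
    move=> x xM; rewrite /g /b (beta_eq0 m zM) ?mul0r//.
    by rewrite (lt_le_trans xM)// norm_le_enorm.
  have E : \int[Leb n]_x ('C(n, j)%:R * g x) = 'C(n, j)%:R * \int[Leb n]_x g x.
    by apply: RintegralZl => //; exact: integrable_continuous_supp cg gM.
  apply: etrans _ E; apply: eq_Rintegral => x _.
  by rewrite coefZ /f /g !mulrA.
have E : 'C(n, j)%:R * z v i 0 = 'C(n, j)%:R * \int[MAv j]_x f x.
  by rewrite -QE; exact: cvg_unique cP' cP.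
exact: (mulfI Cj E).
Qed.

End representation.

(** Continuity and bounded support come from [beta]; the condition at 0 with exponent n - n + 1 = 1
    is [small_beta]. *)
Lemma classT_beta (R : realType) (n m : nat) (zeta alpha : R -> R) (M c : R) :
  (forall s, 0 < s -> {for s, continuous zeta}) -> (forall s, M < s -> zeta s = 0) ->
  (fun s => s ^+ m.+1 * zeta s) @ 0^'+ --> (0 : R) -> 0 < M -> 0 < c ->
  (forall s, 0 < s -> alpha s = c * beta zeta m s) -> classT n n alpha.
Proof.
move=> zc zM z0 M0 c0 aE; split.
- move=> s s0; have h : (fun t => c * beta zeta m t) @ nbhs s --> c * beta zeta m s.
    by apply: cvgM; [exact: cvg_cst|exact: (beta_continuous zc zM s0)].
  move: h; rewrite -(aE s s0) => h; apply: (cvg_trans _ h); apply: near_eq_cvg.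
  apply: filterS (lt_nbhsr s0) => t t0; first [exact: aE|exact: esym (aE t t0)].
- by exists M => s sM; rewrite aE ?(lt_trans M0)// (beta_eq0 m zM)// mulr0.
apply/cvgrPdist_le => e e0; have [d d0 hd] := small_beta zc zM z0 (divr_gt0 e0 c0).
exists d => //= s; rewrite /ball/= !sub0r !normrN => sd s0.
rewrite subnn add0n expr1 aE// mulrCA normrM gtr0_norm// mulrC -ler_pdivlMr//.
by apply: hd => //; rewrite gtr0_norm in sd.
Qed.

Unset Implicit Arguments.

Theorem theorem2 (R : realType) (n j : nat) (zeta alpha : R -> R)
    (z : ('cV[R]_n -> R) -> 'cV[R]_n)
    (n_ge1 : (1 <= n)%N) (j_range : (1 <= j <= n)%N)
    (zetaT : classT n j zeta)
    (z_tstar : is_tstar j zeta z)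
    (alphaE : forall s : R, 0 < s ->
       alpha s = 'C(n, j)%:R *
         (s ^+ (n - j) * zeta s +
          (n - j)%:R *
          \int[@lebesgue_measure R]_(t in `]s, +oo[) (t ^+ (n - j - 1) * zeta t))) :
  classT n n alpha /\
  forall (v : 'cV[R]_n -> R) (MAv : nat -> {measure set (borelR R n) -> \bar R}),
    is_Conv v -> is_MAj v MAv ->
    forall i : 'I_n,
      (z v i 0)%:E = (\int[MAv j]_x (alpha (enorm x) * x i 0)%:E)%E.
Proof.
have [j0 jn] := andP j_range; have [zc [M1 zM1] z0'] := zetaT.
pose M := Num.max M1 1; have M0 : 0 < M by rewrite lt_max ltr01 orbT.
have zM s : M < s -> zeta s = 0 by rewrite gt_max => /andP[sM _]; exact: zM1.
have z0 : (fun s => s ^+ (n - j).+1 * zeta s) @ 0^'+ --> (0 : R) by rewrite -addn1.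
have C0 : 0 < 'C(n, j)%:R :> R by rewrite ltr0n bin_gt0.
have aE s : 0 < s -> alpha s = 'C(n, j)%:R * beta zeta (n - j) s by exact: alphaE.
split; first exact: (classT_beta n zc zM z0 M0 C0 aE).
move=> v MAv cv hMA i.
have [fi ->] := representation n_ge1 j0 jn M0 zc zM z0 z_tstar i cv hMA.
rewrite /Rintegral fineK; last exact: integrable_fin_num.
(* alpha is prescribed only for s > 0; at the origin both integrands vanish through the
   coordinate. *)
apply: eq_integral => x _; congr EFin; have [->|x0] := eqVneq x 0.
  by rewrite !mxE !mulr0.
by rewrite aE ?enorm_gt0// mulrA.
Qed.
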